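(* A finite-dimensional anticommutative Engel algebra $A$ over $\mathbf{k}$ has infinite level $3$ if and only if it is stably isomorphic to one of the algebras $\eta_3$, $T^{2,2}(\epsilon_{23}^{n-2})$, $T^{2,2}(\epsilon_{24}^n)$, $T^3$ or $T^{2,2,2}$.
   Context: $\mathbf{k}$ is a fixed algebraically closed field. An algebra is a $\mathbf{k}$-vector space with a bilinear multiplication (not necessarily associative). $A$ is anticommutative if $a^2=0$ for all $a\in A$; $A$ is Engel if there is $m>0$ with $(L_a)^m=0$ for all $a\in A$, where $L_a(b)=ab$. $\mathbf{k}^m$ denotes the $m$-dimensional algebra with zero multiplication. Finite-dimensional algebras $A,B$ are stably isomorphic if $A\oplus\mathbf{k}^p\cong B\oplus\mathbf{k}^q$ for some integers $p,q\ge0$. Degenerations and level. Fix an $n$-dimensional space $V$ with basis $e_1,\dots,e_n$ and let $\mathcal{A}_n=\mathrm{Hom}(V\otimes V,V)\cong\mathbf{k}^{n^3}$ (Zariski topology), with $GL(V)$ acting by $(g*\mu)(x\otimes y)=g\mu(g^{-1}x\otimes g^{-1}y)$. A structure $\mu\in\mathcal{A}_n$ represents $A$ if $A\cong(V,\mu)$. For $n$-dimensional algebras $A,B$ represented by $\mu,\chi$, write $A\to B$ if $\chi$ lies in the closure of the orbit $O(\mu)$; the degeneration is non-trivial if $A\not\cong B$. The level $lev(A)$ is the maximal $m$ such that there is a chain of non-trivial degenerations $A\to A_{m-1}\to\dots\to A_1\to A_0$ of $n$-dimensional algebras. The infinite level is $lev_\infty(A)=\lim_{m\to\infty}lev(A\oplus\mathbf{k}^m)$.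 Algebras with basis $e_1,\dots,e_n$ (only the non-zero products $e_ie_j$ with $i<j$ are listed, all products not determined by these and anticommutativity are zero; for each name the stable isomorphism class does not depend on the admissible $n$): $\eta_3$ ($n\ge 7$): $e_{2i-1}e_{2i}=e_{7}$, $1\le i\le 3$; $T^{2,2}(\epsilon_{23}^{n-2})$ ($n\ge6$): $e_1e_2=e_{n-1}$, $e_1e_3=e_n$, $e_2e_3=e_{n-2}$; $T^{2,2}(\epsilon_{24}^{n})$ ($n\ge6$): $e_1e_2=e_{n-1}$, $e_1e_3=e_2e_4=e_n$; $T^3$ ($n\ge4$): $e_1e_2=e_3$, $e_1e_3=e_n$; $T^{2,2,2}$ ($n\ge7$): $e_1e_{i+1}=e_{i+n-3}$, $1\le i\le3$. *)

(* Defs.v *)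
From HB Require Import structures.
From mathcomp Require Import all_boot all_algebra.
From mathcomp Require Import mpoly.

Set Implicit Arguments.
Unset Strict Implicit.
Unset Printing Implicit Defensive.

Import GRing.Theory.
Local Open Scope ring_scope.

(* Carriers are vectTypes, so every algebra below is finite-dimensional. *)
Record algebra (K : fieldType) := Algebra {
  carrier :> vectType K;
  amul : {bilinear carrier -> carrier -> carrier}
}.

Definition anticomm (K : fieldType) (A : algebra K) : Prop :=
  forall a : A, amul A a a = 0.

Definition engel (K : fieldType) (A : algebra K) : Prop :=
  exists2 m : nat, (0 < m)%N &
    forall a b : A, iter m (amul A a) b = 0.

Definition isomorphic (K : fieldType) (A B : algebra K) : Prop :=
  exists2 f : {linear A -> B}, bijective f &
    forall a b : A, f (amul A a b) = amul B (f a) (f b).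

Section DirectSum.
Variables (K : fieldType) (A B : algebra K).

Definition dsum_mul (x y : (A * B)%type) : (A * B)%type :=
  (amul A x.1 y.1, amul B x.2 y.2).

Fact dsum_mul_bilinear : bilinear_for *:%R *:%R dsum_mul.
Proof.
split=> z c x y; rewrite /dsum_mul /=.
  by congr pair; rewrite linearPl.
by congr pair; rewrite linearPr.
Qed.

HB.instance Definition _ :=
  bilinear_isBilinear.Build K (A * B)%type (A * B)%type (A * B)%type
    *:%R *:%R dsum_mul dsum_mul_bilinear.

Definition dsum : algebra K := @Algebra K (A * B)%type dsum_mul.
End DirectSum.

(* A point of Hom(V (x) V, V) for V = K^n, given by its n^3 coordinates:
   mu (i, j, k) is the coefficient of e_k in the product e_i e_j. *)
Definition structure (K : fieldType) (n : nat) :=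
  {ffun 'I_n * 'I_n * 'I_n -> K}.

Section StructureAlgebra.
Variables (K : fieldType) (n : nat) (mu : structure K n).

Definition smul (x y : 'cV[K]_n) : 'cV[K]_n :=
  \col_k \sum_i \sum_j x i 0 * y j 0 * mu (i, j, k).

Fact smul_bilinear : bilinear_for *:%R *:%R smul.
Proof.
split=> z c x y; apply/colP=> k; rewrite !mxE mulr_sumr -big_split /=;
  apply: eq_bigr => i _; rewrite mulr_sumr -big_split /=;
  apply: eq_bigr => j _; rewrite !mxE.
  by rewrite !mulrDl !mulrA.
by rewrite mulrDr mulrDl !mulrA (mulrC _ c).
Qed.

HB.instance Definition _ :=
  bilinear_isBilinear.Build K 'cV[K]_n 'cV[K]_n 'cV[K]_n
    *:%R *:%R smul smul_bilinear.

Definition salg : algebra K := @Algebra K 'cV[K]_n smul.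
End StructureAlgebra.

Definition zero_algebra (K : fieldType) (m : nat) : algebra K :=
  salg ([ffun => 0] : structure K m).

Definition stably_isomorphic (K : fieldType) (A B : algebra K) : Prop :=
  exists p q : nat,
    isomorphic (dsum A (zero_algebra K p)) (dsum B (zero_algebra K q)).

Definition represents (K : fieldType) (n : nat) (mu : structure K n)
  (A : algebra K) : Prop := isomorphic A (salg mu).

(* The GL(V)-orbit of mu: chi = g * mu for some g. *)
Definition orbit (K : fieldType) (n : nat) (mu chi : structure K n) : Prop :=
  exists2 g : 'M[K]_n, g \in unitmx &
    forall x y : 'cV[K]_n,
      smul chi x y = g *m smul mu (invmx g *m x) (invmx g *m y).

(* Polynomial functions on the affine space K^(n^3): the variable X_v is the
   coordinate indexed by the v-th element of 'I_n * 'I_n * 'I_n. *)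
Definition peval (K : fieldType) (n : nat)
  (p : {mpoly K[#|{: 'I_n * 'I_n * 'I_n}|]}) (mu : structure K n) : K :=
  p.@[fun v => mu (enum_val v)].

Definition zariski_closed (K : fieldType) (n : nat)
  (Z : structure K n -> Prop) : Prop :=
  exists I : {mpoly K[#|{: 'I_n * 'I_n * 'I_n}|]} -> Prop,
    forall mu, Z mu <-> (forall p, I p -> peval p mu = 0).

Definition zariski_closure (K : fieldType) (n : nat)
  (S : structure K n -> Prop) (mu : structure K n) : Prop :=
  forall Z : structure K n -> Prop,
    zariski_closed Z -> (forall chi, S chi -> Z chi) -> Z mu.

(* Having structures of the same size n forces dim A = dim B = n. *)
Definition degenerates (K : fieldType) (A B : algebra K) : Prop :=
  exists n (mu chi : structure K n),
    [/\ represents mu A, represents chi B & zariski_closure (orbit mu) chi].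

Definition nontrivially_degenerates (K : fieldType) (A B : algebra K) : Prop :=
  degenerates A B /\ ~ isomorphic A B.

(* There is a chain A -> A_(m-1) -> ... -> A_0 of m non-trivial
   degenerations. *)
Fixpoint degeneration_chain (K : fieldType) (m : nat) (A : algebra K) : Prop :=
  if m is m'.+1 then
    exists2 B : algebra K,
      nontrivially_degenerates A B & degeneration_chain m' B
  else True.

Definition has_level (K : fieldType) (A : algebra K) (l : nat) : Prop :=
  degeneration_chain l A /\
  forall m : nat, degeneration_chain m A -> (m <= l)%N.

(* lev(A (+) K^m) tends to l; a limit of naturals is an eventual value. *)
Definition has_infinite_level (K : fieldType) (A : algebra K) (l : nat) : Prop :=
  exists N : nat,
    forall m : nat, (N <= m)%N -> has_level (dsum A (zero_algebra K m)) l.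

(* The anticommutative algebra on e_1, ..., e_n in which e_i e_j = e_k for
   (i, j, k) in s, all other e_i e_j with i < j being zero. The entries of s
   are 1-based and must satisfy i < j, with each (i, j) occurring once. *)
Definition anticomm_table (K : fieldType) (n : nat) (s : seq (nat * nat * nat)) :
  algebra K :=
  salg ([ffun t : 'I_n * 'I_n * 'I_n =>
    let i := t.1.1.+1 in let j := t.1.2.+1 in let k := t.2.+1 in
    ((i, j, k) \in s)%:R - ((j, i, k) \in s)%:R] : structure K n).

Definition eta3 (K : fieldType) (n : nat) : algebra K :=
  anticomm_table K n [:: (1, 2, 7); (3, 4, 7); (5, 6, 7)]%N.

Definition T22_eps23 (K : fieldType) (n : nat) : algebra K :=
  anticomm_table K n [:: (1, 2, n - 1); (1, 3, n); (2, 3, n - 2)]%N.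

Definition T22_eps24 (K : fieldType) (n : nat) : algebra K :=
  anticomm_table K n [:: (1, 2, n - 1); (1, 3, n); (2, 4, n)]%N.

Definition T3 (K : fieldType) (n : nat) : algebra K :=
  anticomm_table K n [:: (1, 2, 3); (1, 3, n)]%N.

Definition T222 (K : fieldType) (n : nat) : algebra K :=
  anticomm_table K n [:: (1, 2, n - 2); (1, 3, n - 1); (1, 4, n)]%N.

(* Main.v *)
(* An anticommutative Engel algebra that does not have the multiplication table
   of one of the four algebras of level at most 2, namely 0, T^2, eta_2 and
   T^{2,2} (up to a summand with zero multiplication), degenerates to one of the
   five algebras of the theorem. If some L_a^2 is nonzero the target is T^3; if
   all L_a^2 vanish but x(yz) does not, then x(yz) is alternating and some L_x
   has rank 3, which gives T^{2,2,2}; for two-step nilpotent algebras one argues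
   on the ranks of the L_x, by contractions along weights of a suitable basis.

   Conversely the level of each of the nine algebras is bounded by closed
   conditions on its degenerations: the codimension of the annihilator and the
   dimension of the square cannot grow, and two-step nilpotency is preserved.
   For T^{2,2,2} one adds that all forms l(xy) have pairwise vanishing polarised
   Pfaffians and that xy, xz, yz are dependent, and for the algebra of eps_24
   that the binary quadratic form given by the Pfaffian on the pencil of the
   l(xy) has discriminant 0. By the classification, these conditions leave only
   the algebra itself and algebras of smaller level. *)

From HB Require Import structures.
From mathcomp Require Import all_boot all_algebra.
From mathcomp Require Import mpoly zify ring.
From Stdlib Require Import Classical_Prop.
Require Import Defs.

Set Implicit Arguments.
Unset Strict Implicit.
Unset Printing Implicit Defensive.

Import GRing.Theory.
Local Open Scope ring_scope.

(* The classification is used twice. A witness for one of the five algebras is weak enough to be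
   found in every algebra outside the models of level at most 2, yet strong enough for a
   contraction. Conversely, an algebra in the closure of an orbit is classified again, and there the
   closed conditions either refute a witness or turn it into the exact multiplication table; no
   orbit closure has to be computed. Closures are tested by polynomials only, so a contraction is a
   polynomial curve in t that lies in the orbit for t nonzero, over an infinite field. The extra
   conditions are forced: codimension of the annihilator and dimension of the square do not separate
   T^{2,2,2} from eps_23 and eps_24, nor eps_24 from pencils of alternating forms on a 4-space whose
   Pfaffian has two distinct roots. Characteristic 2 is allowed, so quadratic identities are kept
   next to their polarisations. The algebra T^3 already exists in dimension 4, where T^{2,2} does
   not fit; it degenerates to T^{2,2} only after a central vector is added, one reason to work with
   large zero summands. *)
Reserved Notation "a ∘ b" (at level 40, left associativity).
Notation "a ∘ b" := (amul _ a b) : ring_scope.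

(** * Products and the annihilator *)

Section Multiplication.
Variables (K : fieldType) (A : algebra K).
Implicit Types a b c : A.

Lemma amulDl a b c : (a + b) ∘ c = a ∘ c + b ∘ c. Proof. exact: linearDl. Qed.
Lemma amulDr a b c : a ∘ (b + c) = a ∘ b + a ∘ c. Proof. exact: linearDr. Qed.
Lemma amulZl (k : K) a b : (k *: a) ∘ b = k *: (a ∘ b).
Proof. exact: linearZl_LR. Qed.
Lemma amulZr (k : K) a b : a ∘ (k *: b) = k *: (a ∘ b).
Proof. exact: linearZr_LR. Qed.
Lemma amulNr a b : a ∘ (- b) = - (a ∘ b). Proof. exact: linearNr. Qed.
Lemma amulBl a b c : (a - b) ∘ c = a ∘ c - b ∘ c. Proof. exact: linearBl. Qed.
Lemma amulBr a b c : a ∘ (b - c) = a ∘ b - a ∘ c. Proof. exact: linearBr. Qed.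
Lemma amul0l a : 0 ∘ a = 0. Proof. exact: linear0l. Qed.
Lemma amul0r a : a ∘ 0 = 0. Proof. exact: linear0r. Qed.
Lemma amul_suml I (r : seq I) (P : pred I) (F : I -> A) b :
  (\sum_(i <- r | P i) F i) ∘ b = \sum_(i <- r | P i) F i ∘ b.
Proof. exact: linear_sumlz. Qed.
Lemma amul_sumr I (r : seq I) (P : pred I) (F : I -> A) b :
  b ∘ (\sum_(i <- r | P i) F i) = \sum_(i <- r | P i) b ∘ F i.
Proof. exact: linear_sumr. Qed.

Definition lmul a : 'Hom(A, A) := linfun (amul A a).

Lemma lmulE a b : lmul a b = a ∘ b. Proof. exact: lfunE. Qed.

Fact lmul_is_linear : linear lmul.
Proof.
by move=> k a b; apply/lfunP => c; rewrite lmulE !lfunE /= lfunE /= !lmulE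
  amulDl amulZl.
Qed.
HB.instance Definition _ :=
  GRing.isLinear.Build K A 'Hom(A, A) _ lmul lmul_is_linear.

Definition annihilator : {vspace A} := lker (linfun lmul).

Lemma annP a : reflect (forall b, a ∘ b = 0) (a \in annihilator).
Proof.
rewrite memv_ker lfunE /=; apply: (iffP eqP) => [La0 b|a0].
  by rewrite -lmulE La0 lfunE.
by apply/lfunP => b; rewrite lmulE a0 lfunE.
Qed.

Definition two_step : Prop := forall a b c, a ∘ b ∘ c = 0.

Lemma two_step_ann : two_step -> forall a b, a ∘ b \in annihilator.
Proof. by move=> two a b; apply/annP => c; rewrite two. Qed.

Hypothesis anti : anticomm A.

Lemma amulC a b : a ∘ b = - (b ∘ a).
Proof.
have := anti (a + b); rewrite amulDl !amulDr !anti addr0 add0r => /eqP.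
by rewrite addr_eq0 => /eqP.
Qed.

Lemma ann_mulr a : a \in annihilator -> forall b, b ∘ a = 0.
Proof. by move=> /annP a0 b; rewrite amulC a0 oppr0. Qed.

Lemma two_step_r : two_step -> forall a b c, c ∘ (a ∘ b) = 0.
Proof. by move=> two a b c; rewrite amulC two oppr0. Qed.

End Multiplication.

(** * Polynomial functions of the structure constants *)

Section PolynomialFunctions.
Variables (K : fieldType) (n : nat).
Implicit Types (mu : structure K n) (f g : structure K n -> K).

Definition polyfun f : Prop := exists p, forall mu, f mu = peval p mu.

Definition polyvec (F : structure K n -> 'cV[K]_n) : Prop :=
  forall k, polyfun (fun mu => F mu k 0).

Lemma polyfun_ext f g : f =1 g -> polyfun g -> polyfun f.
Proof. by move=> fg [p gp]; exists p => mu; rewrite fg. Qed.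

Lemma polyfun_const c : polyfun (fun _ => c).
Proof. by exists c%:MP => mu; rewrite /peval mevalC. Qed.

Lemma polyfun_coord t : polyfun (fun mu => mu t).
Proof. by exists 'X_(enum_rank t) => mu; rewrite /peval mevalXU enum_rankK. Qed.

Lemma polyfunD f g : polyfun f -> polyfun g -> polyfun (fun mu => f mu + g mu).
Proof.
by move=> [p fp] [q gq]; exists (p + q) => mu; rewrite /peval mevalD fp gq.
Qed.

Lemma polyfunM f g : polyfun f -> polyfun g -> polyfun (fun mu => f mu * g mu).
Proof.
by move=> [p fp] [q gq]; exists (p * q) => mu; rewrite /peval mevalM fp gq.
Qed.

Lemma polyfunN f : polyfun f -> polyfun (fun mu => - f mu).
Proof. by move=> [p fp]; exists (- p) => mu; rewrite /peval mevalN fp. Qed.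

Lemma polyfunB f g : polyfun f -> polyfun g -> polyfun (fun mu => f mu - g mu).
Proof. by move=> pf pg; apply: polyfunD => //; apply: polyfunN. Qed.

Lemma polyfunX f m : polyfun f -> polyfun (fun mu => f mu ^+ m).
Proof.
move=> pf; elim: m => [|m IHm]; first exact: polyfun_const.
by apply: polyfun_ext (polyfunM pf IHm) => mu; rewrite exprS.
Qed.

Lemma polyfun_sum I (r : seq I) (F : I -> structure K n -> K) :
  (forall i, polyfun (F i)) -> polyfun (fun mu => \sum_(i <- r) F i mu).
Proof.
move=> pF; elim: r => [|i r IHr].
  by apply: polyfun_ext (polyfun_const 0) => mu; rewrite big_nil.
by apply: polyfun_ext (polyfunD (pF i) IHr) => mu; rewrite big_cons.
Qed.

Lemma polyfun_prod I (r : seq I) (F : I -> structure K n -> K) :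
  (forall i, polyfun (F i)) -> polyfun (fun mu => \prod_(i <- r) F i mu).
Proof.
move=> pF; elim: r => [|i r IHr].
  by apply: polyfun_ext (polyfun_const 1) => mu; rewrite big_nil.
by apply: polyfun_ext (polyfunM (pF i) IHr) => mu; rewrite big_cons.
Qed.

Lemma polyfun_det m (F : structure K n -> 'M[K]_m) :
  (forall i j, polyfun (fun mu => F mu i j)) -> polyfun (fun mu => \det (F mu)).
Proof.
move=> pF; apply: polyfun_sum => s; apply: polyfunM; first exact: polyfun_const.
exact: polyfun_prod.
Qed.

Lemma polyvec_const v : polyvec (fun _ => v).
Proof. by move=> k; apply: polyfun_const. Qed.

Lemma polyvec_mul F G : polyvec F -> polyvec G ->
  polyvec (fun mu => amul (salg mu) (F mu) (G mu)).
Proof.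
move=> pF pG k; apply: (@polyfun_ext _
  (fun mu => \sum_i \sum_j F mu i 0 * G mu j 0 * mu (i, j, k))) => [mu|].
  by rewrite /= mxE.
apply: polyfun_sum => i; apply: polyfun_sum => j; apply: polyfunM.
  exact: polyfunM.
exact: polyfun_coord.
Qed.

Lemma polyfun_scalar (l : {scalar 'cV[K]_n}) F :
  polyvec F -> polyfun (fun mu => l (F mu)).
Proof.
move=> pF; apply: (@polyfun_ext _ (fun mu => \sum_i F mu i 0 * l (delta_mx i 0))).
  move=> mu; rewrite [in LHS](matrix_sum_delta (F mu)) linear_sum.
  by apply: eq_bigr => i _; rewrite big_ord1 linearZ.
by apply: polyfun_sum => i; apply: polyfunM => //; apply: polyfun_const.
Qed.

Lemma closure_polyfun (S : structure K n -> Prop) f mu :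
  zariski_closure S mu -> polyfun f -> (forall chi, S chi -> f chi = 0) ->
  f mu = 0.
Proof.
move=> Smu [p fp] S0; rewrite fp.
apply: (Smu (fun chi => peval p chi = 0)) => [|chi /S0]; last by rewrite fp.
by exists (eq^~ p) => chi; split=> [p0 _ ->|]; last apply.
Qed.

Lemma closure_polyvec (S : structure K n -> Prop) F mu :
  zariski_closure S mu -> polyvec F -> (forall chi, S chi -> F chi = 0) ->
  F mu = 0.
Proof.
move=> Smu pF S0; apply/colP => k; rewrite mxE.
by apply: (closure_polyfun Smu (pF k)) => chi /S0 ->; rewrite mxE.
Qed.

(* The closed condition is the vanishing of all maximal minors. *)
Lemma closure_row_free (S : structure K n -> Prop) m p
    (F : structure K n -> 'M[K]_(m, p)) mu :
  zariski_closure S mu -> (forall i j, polyfun (fun chi => F chi i j)) ->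
  (forall chi, S chi -> ~~ row_free (F chi)) -> ~~ row_free (F mu).
Proof.
move=> Smu pF S0; apply/negP => Fmu.
have FT : row_full (F mu)^T by rewrite /row_full mxrank_tr.
pose g := fullrankfun FT.
have gU : colsub g (F mu) \in unitmx.
  rewrite -unitmx_tr; have := fullrowsub_unit FT.
  by congr (_ \in unitmx); apply/matrixP => i j; rewrite !mxE.
have : \det (colsub g (F mu)) = 0.
  apply: (closure_polyfun (f := fun chi => \det (colsub g (F chi))) Smu).
    by apply: polyfun_det => i j; apply: polyfun_ext (pF i (g j)) => chi; rewrite mxE.
  move=> chi /S0 nf; apply/eqP; rewrite -[_ == 0]negbK; apply: contra nf => dn0.
  have U : colsub g (F chi) \in unitmx by rewrite unitmxE unitfE.
  apply/row_freeP; exists (colsub g 1%:M *m invmx (colsub g (F chi))).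
  by rewrite mulmxA mulmx_colsub mulmx1 mulmxV.
by apply/eqP; rewrite -unitfE -unitmxE.
Qed.

End PolynomialFunctions.

(** * Isomorphisms and properties inherited by degenerations *)

Section Isomorphisms.
Variable K : fieldType.
Implicit Types A B C : algebra K.

Lemma isomorphic_sym A B : isomorphic A B -> isomorphic B A.
Proof.
case=> f [g fK gK] fM.
have ker0 : lker (linfun f) == 0%VS.
  by apply/lker0P => x y; rewrite !lfunE; apply: can_inj fK _ _.
have inv_g x : ((linfun f)^-1)%VF x = g x.
  by rewrite -{1}[x]gK -[f _](lfunE f) lker0_lfunK.
exists ((linfun f)^-1)%VF; first by exists f => x; rewrite /= inv_g.
by move=> a b; rewrite /= !inv_g -{1}[a]gK -{1}[b]gK -fM fK.
Qed.

Lemma isomorphic_trans A B C :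
  isomorphic A B -> isomorphic B C -> isomorphic A C.
Proof.
case=> f bf fM [g bg gM]; exists (g \o f : {linear A -> C}).
  exact: bij_comp.
by move=> a b /=; rewrite fM gM.
Qed.

Lemma isomorphic_dim A B : isomorphic A B -> dim A = dim B.
Proof.
case=> f [g fK gK] _.
have ker0 : lker (linfun f) == 0%VS.
  by apply/lker0P => x y; rewrite !lfunE; apply: can_inj fK _ _.
have im : limg (linfun f) = fullv.
  apply/vspaceP => x; rewrite memvf -[x]gK -[f _](lfunE f).
  by rewrite memv_img ?memvf.
rewrite -!dimvf -im limg_dim_eq //; first by rewrite (eqP ker0) capv0.
Qed.

Lemma orbit_isomorphic n (mu chi : structure K n) :
  orbit mu chi -> isomorphic (salg mu) (salg chi).
Proof.
case=> g gU chiE; exists (mulmx g : {linear salg mu -> salg chi}).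
  by exists (mulmx (invmx g)) => x /=; rewrite (mulKmx, mulKVmx).
by move=> a b /=; rewrite chiE !mulKmx.
Qed.

Lemma basis_isomorphic A n (b : n.-tuple A) (mu : structure K n) :
  basis_of fullv b ->
  (forall i j : 'I_n, b`_i ∘ b`_j = \sum_k mu (i, j, k) *: b`_k) ->
  isomorphic (salg mu) A.
Proof.
move=> bb bM.
pose f (x : 'cV[K]_n) := \sum_i x i 0 *: b`_i.
have fL : linear f.
  move=> c x y; rewrite scaler_sumr -big_split; apply: eq_bigr => i _.
  by rewrite !mxE scalerDl scalerA.
pose g (v : A) : 'cV[K]_n := \col_i coord b i v.
pose fl : {linear 'cV[K]_n -> A} := HB.pack f (GRing.isLinear.Build _ _ _ _ f fL).
exists (fl : {linear salg mu -> A}).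
  exists g => x.
    by apply/colP => i; rewrite mxE /= coord_sum_free ?(basis_free bb).
  rewrite /= /f [RHS](coord_basis bb (memvf x)).
  by apply: eq_bigr => i _; rewrite mxE.
move=> x y; rewrite /= /f amul_suml.
transitivity (\sum_i \sum_j \sum_k (x i 0 * y j 0 * mu (i, j, k)) *: b`_k).
  under eq_bigr => k _ do (rewrite mxE scaler_suml;
     under eq_bigr => i _ do rewrite scaler_suml).
  rewrite exchange_big; apply: eq_bigr => i _.
  by rewrite exchange_big.
apply: eq_bigr => i _; rewrite amulZl amul_sumr scaler_sumr.
apply: eq_bigr => j _; rewrite amulZr scalerA bM scaler_sumr.
by apply: eq_bigr => k _; rewrite scalerA.
Qed.

Lemma degenerates_dim A B : degenerates A B -> dim A = dim B.
Proof.
by case=> n [mu] [chi] [/isomorphic_dim -> /isomorphic_dim -> _].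
Qed.

(** The common argument for all obstructions: the orbit consists of algebras isomorphic to [A], so
    an invariant property holds on the orbit, and a closed one then holds on its closure. *)
Lemma degenerates_closed (P : algebra K -> Prop) :
  (forall A B, isomorphic A B -> P A -> P B) ->
  (forall n (S : structure K n -> Prop) mu, zariski_closure S mu ->
     (forall chi, S chi -> P (salg chi)) -> P (salg mu)) ->
  forall A B, degenerates A B -> P A -> P B.
Proof.
move=> Piso Pcl A B [n [mu [chi [muA chiB mu_chi]]]] PA.
apply: (Piso _ _ (isomorphic_sym chiB)); apply: (Pcl _ _ _ mu_chi).
by move=> psi /orbit_isomorphic /Piso; apply; apply: Piso muA PA.
Qed.

End Isomorphisms.

Lemma span_linear0 (K : fieldType) (V : vectType K) (W : lmodType K)
    (f : {linear V -> W}) (X : seq V) v :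
  {in X, forall x, f x = 0} -> v \in <<X>>%VS -> f v = 0.
Proof.
move=> fX /(@coord_span _ _ _ (in_tuple X)) ->; rewrite linear_sum big1 // => i _.
by rewrite linearZ /= fX ?scaler0 // mem_nth.
Qed.

(** For nonzero p the polynomial p X + 1 is not constant, and a root of it is neither 0 nor a root
    of p. *)
Lemma closed_field_poly0 (K : closedFieldType) (p : {poly K}) :
  (forall t, t != 0 -> p.[t] = 0) -> p = 0.
Proof.
move=> p0; apply/eqP/negPn/negP => pn0.
have /closed_rootP[t] : size (p * 'X + 1) != 1.
  rewrite size_polyDl size_mulX ?size_poly1 //.
    by rewrite eqSS size_poly_eq0.
  by rewrite ltnS lt0n size_poly_eq0.
rewrite /root !hornerE; have [->|tn0] := eqVneq t 0.
  by rewrite mulr0 add0r oner_eq0.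
by rewrite p0 // mul0r add0r oner_eq0.
Qed.

(** * Contractions *)

Section Contraction.
Variable K : closedFieldType.

(* The one-parameter family attached to the weights [w] rescales the structure
   constant (i, j, k) by t^(w i + w j - w k); at t = 0 only the homogeneous part
   of the multiplication survives. *)
Lemma weight_degeneration (A : algebra K) n (b : n.-tuple A) (w : 'I_n -> nat)
    (chi : structure K n) :
  basis_of fullv b ->
  (forall i j k, chi (i, j, k) != 0 -> w k = (w i + w j)%N) ->
  (forall i j : 'I_n, b`_i ∘ b`_j - \sum_k chi (i, j, k) *: b`_k
     \in <<[seq b`_(val k) | k <- enum 'I_n & (w k < w i + w j)%N]>>%VS) ->
  degenerates A (salg chi).
Proof.
move=> bb chi_w lower; have bf := basis_free bb.
pose mu : structure K n := [ffun t : 'I_n * 'I_n * 'I_n =>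
    coord b t.2 (b`_(val t.1.1) ∘ b`_(val t.1.2))].
have mu_chi i j k : (w i + w j <= w k)%N -> mu (i, j, k) = chi (i, j, k).
  move=> wk; apply/eqP; rewrite -subr_eq0 ffunE /=.
  have /= <- : coord b k (\sum_l chi (i, j, l) *: b`_l) = chi (i, j, k).
    exact: coord_sum_free.
  rewrite -linearB /=; apply/eqP.
  apply: (span_linear0 (f := coord b k : {linear A -> K^o}) _ (lower i j)).
  move=> v /mapP[l]; rewrite mem_filter => /andP[wl _] -> /=.
  rewrite coord_free //; case: eqP => // lk.
  by move: wl; rewrite lk ltnNge wk.
exists n, mu, chi; split.
- apply: isomorphic_sym; apply: (basis_isomorphic bb) => i j.
  rewrite [LHS](coord_basis bb (memvf _)).
  by apply: eq_bigr => k _; rewrite ffunE.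
- by exists (idfun : {linear salg chi -> salg chi}) => //; exists id.
move=> Z [I ZE] orbZ; apply/ZE => p Ip.
(* The subtraction is truncated, but where w k exceeds w i + w j the coefficient [mu t] equals that
   of [chi] and vanishes by homogeneity. *)
pose q (t : 'I_n * 'I_n * 'I_n) : {poly K} :=
  (mu t)%:P * 'X^(w t.1.1 + w t.1.2 - w t.2).
pose P := mmap polyC (fun v => q (enum_val v)) p.
have PE t : P.[t] = peval p [ffun v => (q v).[t]].
  rewrite /P /peval mevalE /mmap horner_sum; apply: eq_bigr => m _.
  rewrite hornerM hornerC; congr (_ * _); rewrite /mmap1 horner_prod.
  by apply: eq_bigr => i _; rewrite horner_exp ffunE.
(* For t nonzero the values of [q] are the structure constants of [mu] moved by the diagonal matrix
   with entries t^(-w i), hence a point of the orbit; at t = 0 they are those of [chi]. *)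
have P0 : P = 0.
  apply: closed_field_poly0 => t tn0; rewrite PE.
  apply: (iffLR (ZE _)) Ip; apply: orbZ.
  pose h := diag_mx (\row_i t ^+ w i : 'rV[K]_n).
  pose g := diag_mx (\row_i t ^- w i : 'rV[K]_n).
  have hg : h *m g = 1%:M.
    apply/matrixP => i j; rewrite mulmx_diag !mxE.
    by rewrite divff ?expf_neq0.
  have [_ gU] := mulmx1_unit hg.
  have gV : invmx g = h by rewrite -[LHS]mul1mx -hg mulmxK.
  exists g => // x y; apply/colP => k; rewrite gV mul_diag_mx !mxE mulr_sumr.
  apply: eq_bigr => i _; rewrite mulr_sumr; apply: eq_bigr => j _.
  rewrite !mul_diag_mx !mxE !ffunE hornerM hornerC hornerXn [mu _]ffunE /=.
  have [le_k|lt_k] := leqP (w k) (w i + w j)%N.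
    rewrite exprB ?unitfE // exprD //; ring.
  suff -> : coord b k (b`_i ∘ b`_j) = 0 by rewrite mul0r !mulr0.
  have := mu_chi i j k (ltnW lt_k); rewrite ffunE => ->.
  by apply/eqP/negPn/negP => /chi_w wk; rewrite wk ltnn in lt_k.
have := congr1 (fun p => p.[0]) P0; rewrite PE horner0 => <-.
congr peval; apply/ffunP => -[[i j] k]; rewrite ffunE hornerM hornerC hornerXn.
rewrite expr0n subn_eq0 /=; have [le_k|lt_k] := leqP.
  by rewrite mulr1 mu_chi.
rewrite mulr0; apply/eqP/negPn/negP => /chi_w wk.
by rewrite wk ltnn in lt_k.
Qed.

End Contraction.

(** * Multiplication tables *)

Section Tables.
Variable K : fieldType.
Implicit Types (s : seq (nat * nat * nat)) (A : algebra K).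

(** Here [i] and [j] count from 0 while tables count from 1, hence the successors and the
    predecessor. *)
Definition tprod A s (X : seq A) (i j : nat) : A :=
  \sum_(t <- s) ((t.1 == (i.+1, j.+1))%:R - (t.1 == (j.+1, i.+1))%:R)
    *: X`_t.2.-1.

(** Uniqueness makes the sum over the table in [tprod] agree with the membership tests of
    [anticomm_table]. *)
Definition table_wf s (r k : nat) : bool :=
  [&& r <= k, uniq s & all (fun t => [&& 0 < t.1.1 <= r, 0 < t.1.2 <= r
    & 0 < t.2 <= k])%N s]%N.

(* [A] is the algebra with table [s] plus a summand with zero multiplication:
   [X] is the family e_1, ..., e_k, of which e_(r+1), ..., e_k are central. *)
Definition model s (r k : nat) A : Prop :=
  exists X : seq A,
    [/\ size X = k, free X,
        forall i j, (i < k)%N -> (j < k)%N -> X`_i ∘ X`_j = tprod s X i j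
      & forall v, exists c : nat -> K,
          v - \sum_(i < r) c i *: X`_i \in annihilator A].

Lemma tprodC A s (X : seq A) i j : tprod s X i j = - tprod s X j i.
Proof.
by rewrite -sumrN; apply: eq_bigr => t _; rewrite -scaleNr opprB.
Qed.

Lemma tprod_cat A s r k (X Y : seq A) i j :
  table_wf s r k -> (k <= size X)%N -> tprod s (X ++ Y) i j = tprod s X i j.
Proof.
case/and3P=> _ _ /allP s_wf kX.
apply: eq_big_seq => -[[t1 t2] t3] /s_wf /and3P[_ _ /= tk].
by rewrite nth_cat; case: ltnP => // kt; lia.
Qed.

Lemma tprod_out A s r k (X : seq A) i j :
  table_wf s r k -> (r <= i)%N || (r <= j)%N -> tprod s X i j = 0.
Proof.
case/and3P=> _ _ /allP s_wf ij; apply: big1_seq => t /andP[_ /s_wf].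
move=> /and3P[t1 t2 _]; case: eqP => [tE|_].
  by move: t1 t2; rewrite tE /=; lia.
case: eqP => [tE|_]; last by rewrite subrr scale0r.
by move: t1 t2; rewrite tE /=; lia.
Qed.

Lemma sum_table A s n (b : seq A) (i j : nat) :
  uniq s -> (forall t, t \in s -> (0 < t.2 <= n)%N) ->
  \sum_(l < n) (((i.+1, j.+1, l.+1) \in s)%:R - ((j.+1, i.+1, l.+1) \in s)%:R)
    *: b`_l = tprod s b i j.
Proof.
move=> s_uniq s_n.
have sum_mem x : (x \in s)%:R = \sum_(t <- s) (t == x)%:R :> K.
  rewrite -count_uniq_mem // -sum1_count natr_sum [LHS]big_mkcond /=.
  by apply: eq_bigr => t _ /=; case: (t == x).
transitivity (\sum_(l < n) \sum_(t <- s)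
  ((t == (i.+1, j.+1, l.+1))%:R - (t == (j.+1, i.+1, l.+1))%:R) *: b`_l).
  by apply: eq_bigr => l _; rewrite !sum_mem -sumrB scaler_suml.
rewrite exchange_big; apply: eq_big_seq => -[t1 t2] /s_n /= t_n.
have l0n : (t2.-1 < n)%N by lia.
rewrite (bigD1 (Ordinal l0n)) //= big1 ?addr0 => [|l /eqP ln].
  by rewrite prednK ?(andP t_n).1 // !xpair_eqE eqxx !andbT.
rewrite !xpair_eqE; have -> : (t2 == l.+1) = false.
  by apply/negP => /eqP t2E; apply: ln; apply: val_inj; rewrite /= t2E.
by rewrite !andbF subrr scale0r.
Qed.

Lemma basis_table A s r k n (b : n.-tuple A) :
  table_wf s r k -> (k <= n)%N -> basis_of fullv b ->
  (forall i j, (i < n)%N -> (j < n)%N -> b`_i ∘ b`_j = tprod s b i j) ->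
  isomorphic A (anticomm_table K n s).
Proof.
move=> /and3P[_ s_uniq /allP s_wf] kn bb bM; apply: isomorphic_sym.
apply: (basis_isomorphic bb) => i j; rewrite bM // -(@sum_table _ _ n) //.
  by apply: eq_bigr => l _; rewrite ffunE.
by move=> [t1 t2] /s_wf /and3P[_ _ /=]; lia.
Qed.

Section Model.
Variables (A : algebra K) (s : seq (nat * nat * nat)) (r k : nat).
Hypotheses (anti : anticomm A) (s_wf : table_wf s r k).
Variable X : seq A.
Hypotheses (sizeX : size X = k)
  (XM : forall i j, (i < k)%N -> (j < k)%N -> X`_i ∘ X`_j = tprod s X i j)
  (cover : forall v, exists c : nat -> K,
          v - \sum_(i < r) c i *: X`_i \in annihilator A).

Lemma model_mul v x (c d : nat -> K) :
  v - \sum_(i < r) c i *: X`_i \in annihilator A ->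
  x - \sum_(i < r) d i *: X`_i \in annihilator A ->
  v ∘ x = \sum_(i < r) \sum_(j < r) (c i * d j) *: tprod s X i j.
Proof.
move=> /annP v0 /(ann_mulr anti) x0.
move: (v0 x); rewrite amulBl => /eqP; rewrite subr_eq0 => /eqP ->.
move: (x0 (\sum_(i < r) c i *: X`_i)); rewrite amulBr => /eqP.
rewrite subr_eq0 => /eqP ->.
have rk : (r <= k)%N by case/and3P: s_wf.
rewrite amul_suml; apply: eq_bigr => i _; rewrite amulZl amul_sumr scaler_sumr.
by apply: eq_bigr => j _; rewrite amulZr scalerA XM //; apply: leq_trans rk.
Qed.

Lemma model_ann l : (r <= l < k)%N -> X`_l \in annihilator A.
Proof.
case/andP=> rl lk; apply/annP => v; have [c /(ann_mulr anti)/(_ X`_l)] := cover v.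
rewrite amulBr => /eqP; rewrite subr_eq0 => /eqP ->.
have rk : (r <= k)%N by case/and3P: s_wf.
rewrite amul_sumr big1 // => i _; rewrite amulZr XM //; last exact: leq_trans rk.
by rewrite (tprod_out _ s_wf) ?scaler0 // rl.
Qed.

End Model.

(** A model is determined by its dimension: [X] spans the algebra modulo the annihilator, so it
    extends to a basis by central vectors only. *)
Lemma model_table A s r k :
  anticomm A -> table_wf s r k -> model s r k A ->
  isomorphic A (anticomm_table K (dim A) s).
Proof.
move=> anti s_wf [X [sizeX X_free XM cover]].
pose Y := vbasis (annihilator A :\: <<X>>)%VS.
have rk : (r <= k)%N by case/and3P: s_wf.
have full : (<<X>> + (annihilator A :\: <<X>>) = fullv)%VS.
  rewrite addvC addv_diff; apply/eqP; rewrite eqEsubv subvf /=.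
  apply/subvP => v _; have [c vc] := cover v.
  rewrite -[v](subrK (\sum_(i < r) c i *: X`_i)) memv_add //.
  apply: memv_suml => i _; rewrite memvZ // memv_span // mem_nth //.
  by rewrite sizeX; apply: leq_trans rk.
have bb : basis_of fullv (X ++ Y).
  rewrite -full cat_basis ?vbasisP //.
    by apply/directv_addP; rewrite capvC capv_diff.
  by rewrite basisEfree X_free subvv (eqnP X_free) leqnn.
have sz : size (X ++ Y) == dim A.
  by rewrite -dimvf -(span_basis bb) (eqnP (basis_free bb)).
have kn : (k <= dim A)%N by rewrite -(eqP sz) size_cat sizeX leq_addr.
have X_ann := model_ann anti s_wf XM cover.
have Y_ann y : y \in Y -> y \in annihilator A.
  by move/vbasis_mem; apply: subvP; apply: diffvSl.
have b_ann l : (r <= l < dim A)%N -> (X ++ Y)`_l \in annihilator A.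
  move=> /andP[rl ln]; rewrite nth_cat sizeX; case: ltnP => lk.
    by rewrite X_ann ?rl.
  by rewrite Y_ann ?mem_nth // -(ltn_add2l k) subnKC // -sizeX -size_cat (eqP sz).
apply: (@basis_table _ s r k _ (Tuple sz)) => //= i j i_n j_n.
rewrite (tprod_cat _ _ _ s_wf) ?sizeX //.
have [ri|ir] := leqP r i.
  by rewrite (annP _ (b_ann _ _)) ?ri // (tprod_out _ s_wf) ?ri.
have [rj|jr] := leqP r j.
  by rewrite ann_mulr ?b_ann ?rj // (tprod_out _ s_wf) ?rj ?orbT.
by rewrite !nth_cat sizeX !(leq_trans _ rk) // XM // (leq_trans _ rk).
Qed.

(** Surjectivity is asked modulo the annihilator only, so that this covers isomorphisms as well as
    the inclusions that enlarge a zero summand. *)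
Lemma model_transfer (A B : algebra K) s r k (f : {linear A -> B}) :
  anticomm B -> injective f -> (forall a b, f (a ∘ b) = f a ∘ f b) ->
  (forall v, exists u, v - f u \in annihilator B) ->
  model s r k A -> model s r k B.
Proof.
move=> anti f_inj fM f_surj [X [sizeX X_free XM cover]]; exists (map f X).
have nth_f i : (map f X)`_i = f X`_i.
  have [lt_i|le_i] := ltnP i (size X); first by rewrite (nth_map 0).
  by rewrite !nth_default ?size_map ?linear0.
split=> [||i j ik jk|v]; rewrite ?size_map //.
- rewrite -[map f X](eq_map (lfunE f)) /free -limg_span size_map.
  rewrite limg_dim_eq ?(eqnP X_free) //; apply/eqP.
  have /lker0P/eqP -> : injective (linfun f) by move=> x y; rewrite !lfunE => /f_inj.
  by rewrite capv0.
- rewrite !nth_f -fM XM // linear_sum; apply: eq_bigr => t _.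
  by rewrite linearZ nth_f.
have [u vu] := f_surj v; have [c uc] := cover u; exists c.
rewrite -(subrKA (f u)) memvD //.
have -> : \sum_(i < r) c i *: (map f X)`_i = f (\sum_(i < r) c i *: X`_i).
  by rewrite linear_sum; apply: eq_bigr => i _; rewrite linearZ nth_f.
rewrite -linearB; apply/annP => w; have [w' /(ann_mulr anti) ww'] := f_surj w.
move: (ww' (f (u - \sum_(i < r) c i *: X`_i))); rewrite amulBr => /eqP.
by rewrite subr_eq0 -fM (annP _ uc) linear0 => /eqP.
Qed.

Lemma model_isomorphic (A B : algebra K) s r k :
  anticomm B -> isomorphic A B -> model s r k A -> model s r k B.
Proof.
move=> anti [f [g fK gK] fM]; apply: (model_transfer anti (can_inj fK) fM) => v.
by exists (g v); rewrite gK subrr mem0v.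
Qed.

Lemma salg_delta n (mu : structure K n) (i j : 'I_n) :
  amul (salg mu) (delta_mx i 0) (delta_mx j 0) =
  \sum_l mu (i, j, l) *: (delta_mx l 0 : salg mu).
Proof.
apply/colP => l; rewrite summxE (bigD1 l) //= [X in _ + X]big1 ?addr0; last first.
  by move=> m /negPf ml; rewrite !mxE eq_sym ml mulr0.
rewrite !mxE (bigD1 i) //= [X in _ + X]big1 ?addr0; last first.
  by move=> i' /negPf i'i; rewrite big1 // => j' _; rewrite mxE i'i !mul0r.
rewrite (bigD1 j) //= [X in _ + X]big1 ?addr0; last first.
  by move=> j' /negPf j'j; rewrite !mxE j'j mulr0 mul0r.
by rewrite !mxE !eqxx !mul1r mulr1.
Qed.

Lemma anticomm_table_anticomm s n : anticomm (anticomm_table K n s).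
Proof.
move=> x; apply/colP => l; rewrite /= !mxE.
set F := fun i j : 'I_n => ((i.+1, j.+1, l.+1) \in s)%:R : K.
rewrite (eq_bigr (fun i => \sum_j x i 0 * x j 0 * F i j -
    \sum_j x i 0 * x j 0 * F j i)) => [|i _]; last first.
  by rewrite -sumrB; apply: eq_bigr => j _; rewrite ffunE /= mulrBr.
rewrite sumrB.
rewrite [X in _ - X]exchange_big /=; apply/eqP; rewrite subr_eq0; apply/eqP.
by apply: eq_bigr => i _; apply: eq_bigr => j _; rewrite [x i 0 * _]mulrC.
Qed.

(* [sigma] is 1-based, like the tables. *)
Lemma table_model s r k n (sigma : nat -> nat) :
  table_wf s r k -> (forall i, 0 < i <= k -> 0 < sigma i <= n)%N ->
  {in [pred i | (0 < i <= k)%N] &, injective sigma} ->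
  model s r k (anticomm_table K n
    [seq (sigma t.1.1, sigma t.1.2, sigma t.2) | t <- s]).
Proof.
move=> s_wf' sigma_n sigma_inj.
have /and3P[rk s_uniq /allP s_wf] := s_wf'.
set s' := map _ s; set A := anticomm_table K n s'.
pose E : n.-tuple A := mktuple (fun i : 'I_n => delta_mx i 0 : A).
have E_nth (i : 'I_n) : E`_i = delta_mx i 0 by rewrite nth_mktuple.
have s_wfk t : t \in s -> [&& 0 < t.1.1 <= k, 0 < t.1.2 <= k & 0 < t.2 <= k]%N.
  by move=> /s_wf; case: t => -[t1 t2] t3 /=; lia.
have s'_uniq : uniq s'.
  rewrite map_inj_in_uniq // => -[[t1 t2] t3] [[u1 u2] u3].
  move=> /s_wfk/and3P[/= t1k t2k t3k] /s_wfk/and3P[/= u1k u2k u3k] [].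
  by do 3!move=> /sigma_inj -> //.
have s'_n t : t \in s' -> (0 < t.2 <= n)%N.
  by move=> /mapP[u /s_wfk/and3P[_ _ uk] ->]; apply: sigma_n.
have EM (i j : 'I_n) : amul A (delta_mx i 0) (delta_mx j 0) = tprod s' E i j.
  rewrite salg_delta -(sum_table _ _ _ s'_uniq s'_n).
  by apply: eq_bigr => l _; rewrite ffunE E_nth.
pose X : k.-tuple A := mktuple (fun l : 'I_k => E`_(sigma l.+1).-1).
have X_nth i : (i < k)%N -> X`_i = E`_(sigma i.+1).-1.
  by move=> ik; rewrite (nth_mktuple _ 0 (Ordinal ik)).
have X_ord i : (i < k)%N ->
    {i' : 'I_n | i'.+1 = sigma i.+1 & X`_i = delta_mx i' 0 :> 'cV[K]_n}.
  move=> ik; have sk : (0 < sigma i.+1 <= n)%N by apply: sigma_n; rewrite ik.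
  have lt : ((sigma i.+1).-1 < n)%N by lia.
  exists (Ordinal lt) => /=; first by lia.
  by rewrite X_nth // (E_nth (Ordinal lt)).
exists X; split; rewrite ?size_tuple //.
- apply/freeP => c X0 i; have [i' i'E _] := X_ord i (ltn_ord i).
  have /= /colP/(_ i') := X0; rewrite mxE summxE (bigD1 i) //= big1 ?addr0.
    have [i2 i2E ->] := X_ord i (ltn_ord i); rewrite !mxE.
    have -> : i' = i2 by apply: val_inj; apply: succn_inj; rewrite i'E i2E.
    by rewrite !eqxx mulr1.
  move=> j /eqP ji; have [j' j'E ->] := X_ord j (ltn_ord j).
  rewrite !mxE; case: eqP => [ij|]; last by rewrite mulr0.
  case: ji; apply: val_inj; apply: succn_inj; apply: sigma_inj.
  + by rewrite !inE /= ltn_ord.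
  + by rewrite !inE /= ltn_ord.
  by rewrite -i'E -j'E ij.
- move=> i j ik jk; have [i' i'E Xi] := X_ord i ik.
  have [j' j'E Xj] := X_ord j jk.
  transitivity (tprod s' E i' j'); first by rewrite -EM -Xi -Xj.
  rewrite /tprod big_map; apply: eq_big_seq => t /s_wfk /and3P[/= t1k t2k t3k].
  rewrite X_nth; last by lia.
  rewrite prednK; last by case/andP: t3k.
  have sigma_eq a b : (0 < a <= k)%N -> (b < k)%N ->
      (sigma a == sigma b.+1) = (a == b.+1).
    by move=> ak bk; apply: (inj_in_eq sigma_inj); rewrite inE.
  case: t => -[t1 t2] t3 in t1k t2k t3k *; move: t1k t2k => /= t1k t2k.
  by rewrite i'E j'E !xpair_eqE !sigma_eq.
move=> v; have lt_r (i : 'I_r) : (i < k)%N by apply: leq_trans rk.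
(* These are the coordinates of [v] at the images of 1, ..., r; the default is not reached for l <
   r. What remains of [v] has coordinate 0 at every index that occurs as a factor in the table, so
   it is central. *)
pose c l := if insub (sigma l.+1).-1 is Some i then (v : 'cV[K]_n) i 0 else 0.
exists c; set u := v - _.
have u0 (i' : 'I_n) (i : 'I_r) : i'.+1 = sigma i.+1 -> (u : 'cV[K]_n) i' 0 = 0.
  move=> i'E; rewrite !mxE summxE (bigD1 i) //= [X in _ - (_ + X)]big1 ?addr0.
    have [i2 i2E ->] := X_ord i (lt_r i); rewrite !mxE.
    have <- : i' = i2 by apply: val_inj; apply: succn_inj; rewrite i'E i2E.
    by rewrite !eqxx mulr1 /c -i'E /= valK subrr.
  move=> j /eqP ji; have [j' j'E ->] := X_ord j (lt_r j).
  rewrite !mxE; case: eqP => [ij|]; last by rewrite mulr0.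
  case: ji; apply: val_inj; apply: succn_inj; apply: sigma_inj.
  + by rewrite !inE /= lt_r.
  + by rewrite !inE /= lt_r.
  by rewrite -i'E -j'E ij.
apply/annP => w; apply/colP => l; rewrite [RHS]mxE [LHS]mxE big1 // => i _.
rewrite big1 // => j _; rewrite ffunE /=.
have s'_0 a b d : (a.+1, b.+1, d.+1) \in s' -> (a == i) || (b == i) ->
    (u : 'cV[K]_n) i 0 = 0.
  move=> /mapP[[[t1 t2] t3] /s_wf /and3P[/= t1r t2r _] [aE bE _]].
  case/orP => /eqP eqi; first by apply: (u0 _ (Ordinal (_ : t1.-1 < r)%N));
    [lia | move=> /= ?; rewrite -eqi aE; congr sigma; lia].
  by apply: (u0 _ (Ordinal (_ : t2.-1 < r)%N));
    [lia | move=> /= ?; rewrite -eqi bE; congr sigma; lia].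
case: (boolP (_ \in s')) => [/s'_0 ->|_]; rewrite ?eqxx ?mul0r //.
case: (boolP (_ \in s')) => [/s'_0 ->|_]; rewrite ?eqxx ?orbT ?mul0r //.
by rewrite subrr mulr0.
Qed.

End Tables.

(** * Contractions onto multiplication tables *)

Section Contractions.
Variable K : closedFieldType.
Implicit Types (s : seq (nat * nat * nat)) (A : algebra K).

(** The part of a product of total weight [d] that vanishes in the limit. *)
Definition below A (b : seq A) (w : nat -> nat) (d : nat) : {vspace A} :=
  <<[seq b`_l | l <- iota 0 (size b) & (w l < d)%N]>>%VS.

Lemma mem_below A (b : seq A) w d l :
  (l < size b)%N -> (w l < d)%N -> b`_l \in below b w d.
Proof.
move=> lb wl; rewrite memv_span //; apply: map_f.
by rewrite mem_filter wl mem_iota.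
Qed.

Lemma table_degeneration A s r (X Y : seq A) (w : nat -> nat) :
  anticomm A -> table_wf s r (size X) -> basis_of fullv (X ++ Y) ->
  all (fun t => w t.2.-1 == (w t.1.1.-1 + w t.1.2.-1)%N) s ->
  (forall i j, (i < j < size X)%N ->
     X`_i ∘ X`_j - tprod s X i j \in below (X ++ Y) w (w i + w j)) ->
  (forall i j, (i < size (X ++ Y))%N -> (size X <= j < size (X ++ Y))%N ->
     (X ++ Y)`_i ∘ (X ++ Y)`_j \in below (X ++ Y) w (w i + w j)) ->
  degenerates A (anticomm_table K (dim A) s).
Proof.
move=> anti s_wf' bb /allP s_w XX YY; set b := X ++ Y in bb XX YY *.
have /and3P[rk s_uniq /allP s_wf] := s_wf'.
have size_b : size b = dim A by rewrite -dimvf -(span_basis bb) (eqnP (basis_free bb)).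
have kb : (size X <= size b)%N by rewrite size_cat leq_addr.
rewrite -size_b; apply: (@weight_degeneration _ _ _ (in_tuple b) (fun i => w i)).
- exact: bb.
- have mem_w a1 a2 a3 : (a1.+1, a2.+1, a3.+1) \in s -> w a3 = (w a1 + w a2)%N.
    by move=> /s_w /= /eqP.
  move=> i j l; rewrite ffunE /=; case: (boolP (_ \in s)) => [/mem_w //|_].
  case: (boolP (_ \in s)) => [/mem_w ->|_]; first by rewrite addnC.
  by rewrite subrr eqxx.
move=> i j.
rewrite (eq_bigr (fun l : 'I_(size b) => (((i.+1, j.+1, l.+1) \in s)%:R -
  ((j.+1, i.+1, l.+1) \in s)%:R) *: b`_l)); last by move=> l _; rewrite ffunE.
rewrite sum_table //; last first.
  by move=> [[t1 t2] t3] /s_wf /and3P[_ _ /=]; lia.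
rewrite (tprod_cat _ _ _ s_wf') //.
suff : b`_i ∘ b`_j - tprod s X i j \in below b w (w i + w j).
  apply: subvP; apply/sub_span => v /mapP[l].
  rewrite mem_filter mem_iota /= add0n => /andP[wl lb] ->.
  by apply/mapP; exists (Ordinal lb) => //; rewrite mem_filter mem_enum wl.
have [ki|ik] := leqP (size X) i.
  rewrite (tprod_out _ s_wf') ?(leq_trans rk ki) // subr0 amulC // memvN addnC.
  by rewrite YY ?ki /=.
have [kj|jk] := leqP (size X) j.
  by rewrite (tprod_out _ s_wf') ?(leq_trans rk kj) ?orbT // subr0 YY ?kj /=.
have nth_b l : (l < size X)%N -> b`_l = X`_l by move=> lk; rewrite nth_cat lk.
rewrite !nth_b //; have [lt_ij|lt_ji|eq_ij] := ltngtP i j.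
- by rewrite XX // lt_ij.
- by rewrite amulC // tprodC -opprD memvN addnC XX // lt_ji.
rewrite eq_ij anti /tprod big1 ?subrr ?mem0v // => t _.
by rewrite subrr scale0r.
Qed.

(** On the quotient by a proper invariant subspace the nilpotent [f] still has a kernel: among the
    iterates of a vector outside the subspace, the last one outside it is mapped into it. Adjoining
    that vector keeps the subspace invariant. *)
Lemma triangular_basis A (f : 'End(A)) m (X : seq A) :
  (forall v, iter m f v = 0) -> free X ->
  (forall v, v \in <<X>>%VS -> f v \in <<X>>%VS) ->
  exists Y, basis_of fullv (X ++ Y) /\
    forall j, (j < size Y)%N -> f Y`_j \in <<X ++ take j Y>>%VS.
Proof.
move=> f_nil; move: {2}(dim A - size X)%N (erefl (dim A - size X)%N) => d.
elim: d X => [|d IHd] X codim X_free X_stable.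
  exists [::]; split=> //; rewrite cats0 basisEfree X_free subvf dimvf /=.
  by rewrite -subn_eq0 codim.
have [u uX fuX] : exists2 u, u \notin <<X>>%VS & f u \in <<X>>%VS.
  have [v _ vX] : exists2 v, v \in fullv & v \notin <<X>>%VS.
    apply/subvPn; apply: contraTN isT => /dimvS.
    by rewrite dimvf (eqnP X_free) -subn_eq0 codim.
  have : iter m f v \in <<X>>%VS by rewrite f_nil mem0v.
  elim: m {f_nil} => [|m IHm] /=; first by rewrite (negPf vX).
  by case: (boolP (iter m f v \in <<X>>%VS)) => [/IHm //|]; exists (iter m f v).
have Xu_perm : perm_eq (rcons X u) (u :: X) by rewrite perm_rcons.
have span_Xu : <<rcons X u>>%VS = <<u :: X>>%VS by apply/eq_span/perm_mem.
have [|||Y [bY fY]] := IHd (rcons X u).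
- by rewrite size_rcons; lia.
- by rewrite (perm_free Xu_perm) free_cons uX.
- move=> v; rewrite span_Xu span_cons => /memv_addP[v1 /vlineP[c ->] [v2 v2X ->]].
  apply: (subvP (addvSr _ _)). rewrite linearD linearZ /=.
  by apply: memvD; [apply: memvZ | apply: X_stable].
exists (u :: Y); rewrite -cat_rcons; split=> // -[_|j /fY] /=.
  by rewrite cats0.
by rewrite -cat_rcons.
Qed.

(* With weight 0 for [x] and large weights that increase along a triangular
   basis elsewhere, only the action of [x] on the span of [H] survives. *)
Lemma operator_degeneration A s r m (x : A) (H : seq A) :
  anticomm A -> table_wf s r (size H).+1 ->
  all (fun t => [&& t.1.1 == 1, 1 < t.1.2 & 1 < t.2])%N s ->
  (forall v, iter m (amul A x) v = 0) -> free (x :: H) ->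
  (forall j, (j < size H)%N -> x ∘ H`_j = tprod s (x :: H) 0 j.+1) ->
  degenerates A (anticomm_table K (dim A) s).
Proof.
move=> anti s_wf' /allP s_x x_nil X_free xH; set X := x :: H in X_free xH *.
have /and3P[rk s_uniq /allP s_wf] := s_wf'.
have f_nil v : iter m (lmul x) v = 0.
  by rewrite -[RHS](x_nil v); apply: eq_iter => u; rewrite lmulE.
have tprodX i j : tprod s X i j \in <<X>>%VS.
  rewrite memv_suml // => t _; rewrite memvZ //.
  have [lt_t|ge_t] := ltnP t.2.-1 (size X); first by rewrite memv_span ?mem_nth.
  by rewrite nth_default ?mem0v.
have xX j : (j < size X)%N -> x ∘ X`_j = tprod s X 0 j.
  case: j => [_|j /xH //]; rewrite anti [RHS]big1 // => t _.
  by rewrite subrr scale0r.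
have [|Y [bb xY]] := triangular_basis f_nil X_free.
  move=> v /(@coord_span _ _ _ (in_tuple X)) ->; rewrite linear_sum memv_suml //.
  by move=> i _; rewrite linearZ memvZ //= lmulE xX.
pose n := size (X ++ Y).
(* All weights are below 2(n+1), so products not involving [x] vanish in the limit. On the rest of
   [X] the weight is constant and the action of [x] survives; on [Y] it increases strictly, and the
   triangular action of [x] vanishes. *)
pose w i := if i == 0%N then 0%N else if (i < size X)%N then n.+1
            else (n.+2 + i)%N.
have w_small i : (i < n)%N -> (w i < n.+1 + n.+1)%N.
  by rewrite /w; case: ifP => // _; case: ifP => // _; lia.
have below_all v d : (n.+1 + n.+1 <= d)%N -> v \in below (X ++ Y) w d.
  move=> le_d; apply: subvP (memvf v); rewrite -(span_basis bb).
  apply/span_subvP => u /(nthP 0)[l ln <-]; apply: mem_below => //.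
  by apply: leq_trans le_d; apply: w_small.
have w_big i : (0 < i)%N -> (n.+1 <= w i)%N.
  by rewrite /w lt0n => /negPf ->; case: ifP => // _; lia.
apply: (@table_degeneration _ _ r X Y w) => //.
- apply/allP => -[[t1 t2] t3] t_s; have := s_x _ t_s; have := s_wf _ t_s.
  move=> /and3P[/= t1r t2r t3k] /and3P[/eqP t1E lt2 lt3]; rewrite t1E /w /=.
  have -> : (t3.-1 == 0%N) = false by lia.
  have -> : (t2.-1 == 0%N) = false by lia.
  have -> : (t3.-1 < size X)%N by rewrite /=; lia.
  by have -> : (t2.-1 < size X)%N by rewrite /=; lia.
- case=> [|i] j /andP[ij jX]; first by rewrite xX // subrr mem0v.
  by apply: below_all; rewrite leq_add ?w_big // (leq_trans _ ij).
case=> [|i] j i_n /andP[kj jn]; last first.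
  by apply: below_all; rewrite leq_add ?w_big // (leq_trans _ kj).
have nth_Y : (X ++ Y)`_j = Y`_(j - size X) by rewrite nth_cat ltnNge kj.
have wj : w j = (n.+2 + j)%N by rewrite /w gtn_eqF ?(leq_trans _ kj) // ltnNge kj.
have /xY : (j - size X < size Y)%N by move: jn; rewrite size_cat; lia.
have -> : (X ++ Y)`_0 = x by [].
rewrite nth_Y lmulE; apply: subvP; apply/span_subvP => v.
rewrite mem_cat => /orP[] /(nthP 0)[l ln <-].
  have -> : X`_l = (X ++ Y)`_l by rewrite nth_cat ln.
  apply: mem_below; first by rewrite size_cat ltn_addr.
  by rewrite wj /w /= ln; case: ifP => _; lia.
rewrite nth_take; last by move: ln; rewrite size_take; case: ifP; lia.
have lt_l : (size X + l < j)%N by move: ln; rewrite size_take; case: ifP; lia.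
have -> : Y`_l = (X ++ Y)`_(size X + l) by rewrite nth_cat ltnNge leq_addr /= addKn.
apply: mem_below; first by apply: leq_trans jn; lia.
have wl : (w (size X + l)%N <= n.+2 + (size X + l))%N.
  by rewrite /w gtn_eqF // ltnNge leq_addr.
rewrite wj add0n. apply: leq_ltn_trans wl _. by rewrite ltn_add2l.
Qed.

(* The central vectors outside of [X] get weight 0 and the non-central ones a
   large weight. *)
Lemma two_step_degeneration A s r (X D : seq A) (w : nat -> nat) :
  anticomm A -> two_step A ->
  table_wf s r (size X) -> free (X ++ D) ->
  <<drop r X ++ D>>%VS = annihilator A ->
  (forall i, (i < size X)%N -> (0 < w i < 5)%N) ->
  all (fun t => w t.2.-1 == (w t.1.1.-1 + w t.1.2.-1)%N) s ->
  (forall i j, (i < j < r)%N -> X`_i ∘ X`_j - tprod s X i j \in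
     <<[seq X`_l | l <- iota 0 (size X) & (w l < w i + w j)%N] ++ D>>%VS) ->
  degenerates A (anticomm_table K (dim A) s).
Proof.
move=> anti two s_wf' XD_free AnnE w_bound s_w XX.
have /and3P[rk _ _] := s_wf'.
pose C := vbasis (fullv :\: <<X ++ D>>)%VS.
have full : (<<X ++ D>> + (fullv :\: <<X ++ D>>))%VS = fullv.
  by rewrite addvC addv_diff sumfv.
have bb : basis_of fullv (X ++ (D ++ C)).
  have dx : directv (<<X ++ D>> + (fullv :\: <<X ++ D>>)).
    by apply/directv_addP; rewrite capvC capv_diff.
  have XD_basis : basis_of <<X ++ D>> (X ++ D).
    by rewrite basisEfree XD_free subvv (eqnP XD_free) leqnn.
  by have := cat_basis dx XD_basis (vbasisP _); rewrite full -catA.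
(* All products are central and central vectors have weight at most 4, so weight 5 on [C] makes
   every product with [C] vanish in the limit. Weight 0 on [D] removes the components along [D] from
   all other products. *)
pose w' i := if (i < size X)%N then w i else if (i < size (X ++ D))%N then 0%N
             else 5%N.
have mulA a b : a ∘ b \in annihilator A by apply/annP => c; rewrite two.
have X_ann i : (r <= i < size X)%N -> X`_i \in annihilator A.
  move=> /andP[ri ik]; rewrite -AnnE memv_span // mem_cat; apply/orP; left.
  rewrite -(subnKC ri) -nth_drop mem_nth // size_drop.
  by rewrite ltn_sub2r // (leq_ltn_trans ri).
have below_ann v d : v \in annihilator A -> (5 <= d)%N ->
    v \in below (X ++ (D ++ C)) w' d.
  move=> + d5; rewrite -AnnE; apply: subvP; apply/span_subvP => u.
  rewrite mem_cat => /orP[] /(nthP 0)[l ln <-].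
    have lk : (r + l < size X)%N by rewrite size_drop ltn_subRL in ln.
    rewrite nth_drop.
    have -> : X`_(r + l) = (X ++ (D ++ C))`_(r + l) by rewrite nth_cat lk.
    apply: mem_below; first by rewrite size_cat ltn_addr.
    by rewrite /w' lk; have := w_bound _ lk; lia.
  have -> : D`_l = (X ++ (D ++ C))`_(size X + l).
    by rewrite nth_cat ltnNge leq_addr /= addKn nth_cat ln.
  apply: mem_below; first by rewrite !size_cat ltn_add2l ltn_addr.
  by rewrite /w' -ltn_subRL subnn ltn0 size_cat ltn_add2l ln; lia.
have D_ann v : v \in D -> v \in annihilator A.
  by move=> vD; rewrite -AnnE memv_span // mem_cat vD orbT.
have X_w' l : (l < size X)%N -> w' l = w l by rewrite /w' => ->.
apply: (@table_degeneration _ _ r X (D ++ C) w') => //.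
- apply/allP => -[[t1 t2] t3] t_s; have /eqP /= wt := allP s_w _ t_s.
  have /and3P[_ _ /allP/(_ _ t_s)/and3P[/= t1r t2r t3k]] := s_wf'.
  by rewrite !X_w'; [exact/eqP | lia | lia | lia].
- move=> i j /andP[ij jX]; have iX := ltn_trans ij jX; rewrite !X_w' //.
  have [rj|jr] := leqP r j.
    rewrite (ann_mulr anti) ?X_ann ?rj // (tprod_out _ s_wf') ?rj ?orbT //.
    by rewrite subrr mem0v.
  have := XX i j; rewrite ij jr => /(_ isT); apply: subvP; apply/span_subvP => v.
  rewrite mem_cat => /orP[/mapP[l] | /(nthP 0)[l ln <-]].
    rewrite mem_filter mem_iota /= add0n => /andP[wl lk] ->.
    have -> : X`_l = (X ++ (D ++ C))`_l by rewrite nth_cat lk.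
    by apply: mem_below; rewrite ?X_w' // size_cat ltn_addr.
  have -> : D`_l = (X ++ (D ++ C))`_(size X + l).
    by rewrite nth_cat ltnNge leq_addr /= addKn nth_cat ln.
  apply: mem_below; first by rewrite !size_cat ltn_add2l ltn_addr.
  rewrite /w' -ltn_subRL subnn ltn0 size_cat ltn_add2l ln.
  by have := w_bound _ iX; lia.
move=> i j i_n /andP[kj jn].
have -> : (X ++ (D ++ C))`_j = (D ++ C)`_(j - size X) by rewrite nth_cat ltnNge kj.
rewrite [(D ++ C)`_ _]nth_cat; case: ifP => jD.
  by rewrite (ann_mulr anti) ?mem0v // D_ann ?mem_nth.
have w'j : w' j = 5%N.
  by rewrite /w' ltnNge (kj : (size X <= j)%N) /= size_cat -ltn_subLR // jD.
by apply: below_ann => //; rewrite w'j leq_addl.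
Qed.

End Contractions.

(** * Degenerations to the algebras of level at most 3 *)

(* The tables of T^2, eta_2 and T^{2,2} (infinite levels 1, 2, 2) and of the five
   algebras of the theorem, for the smallest admissible n. *)
Definition tab_eta1 : seq (nat * nat * nat) := [:: (1, 2, 3)]%N.
Definition tab_eta2 : seq (nat * nat * nat) := [:: (1, 2, 5); (3, 4, 5)]%N.
Definition tab_T22 : seq (nat * nat * nat) := [:: (1, 2, 4); (1, 3, 5)]%N.
Definition tab_eta3 : seq (nat * nat * nat) :=
  [:: (1, 2, 7); (3, 4, 7); (5, 6, 7)]%N.
Definition tab_eps23 : seq (nat * nat * nat) :=
  [:: (1, 2, 5); (1, 3, 6); (2, 3, 4)]%N.
Definition tab_eps24 : seq (nat * nat * nat) :=
  [:: (1, 2, 5); (1, 3, 6); (2, 4, 6)]%N.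
Definition tab_T3 : seq (nat * nat * nat) := [:: (1, 2, 3); (1, 3, 4)]%N.
Definition tab_T222 : seq (nat * nat * nat) :=
  [:: (1, 2, 5); (1, 3, 6); (1, 4, 7)]%N.

Ltac tprod_simpl := rewrite /tprod !big_cons big_nil /= ?(subr0, sub0r, subrr,
  scale0r, scale1r, scaleN1r, addr0, add0r).

(** * Linear independence modulo the annihilator *)

Section FreeExtension.
Variables (K : fieldType) (V W : vectType K).

(** The map is injective on the span of [Y] and zero on that of [Z], so the spans meet in 0. Most
    independence proofs below choose such an [f], usually some L_a or a functional after L_a. *)
Lemma free_ext (f : {linear V -> W}) (Y Z : seq V) :
  free (map f Y) -> {in Z, forall z, f z = 0} -> free Z -> free (Y ++ Z).
Proof.
move=> fY_free fZ Z_free.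
have imY : (linfun f @: <<Y>>)%VS = <<map f Y>>%VS.
  by rewrite limg_span (eq_map (lfunE f)).
have := limg_ker_dim (linfun f) <<Y>>%VS.
rewrite imY (eqnP fY_free) size_map => dimY.
have dimY_le := dim_span Y.
have Y_free : free Y by rewrite /free eqn_leq dimY_le -dimY leq_addl.
rewrite cat_free Y_free Z_free /=; apply/directv_addP/eqP.
rewrite -subv0; have <- : (<<Y>> :&: lker (linfun f) = 0)%VS.
  by apply/eqP; rewrite -dimv_eq0 -leqn0 -(leq_add2r (size Y)) dimY.
apply: capvS => //; apply/span_subvP => z zZ.
by rewrite memv_ker lfunE /= fZ.
Qed.

Lemma free_ext1 (f : {linear V -> W}) (y : V) (Z : seq V) :
  f y != 0 -> {in Z, forall z, f z = 0} -> free Z -> free (y :: Z).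
Proof.
by move=> fy fZ; apply: (free_ext (f := f) (Y := [:: y])) => //; rewrite seq1_free.
Qed.

Lemma free_ext_cons (f : {linear V -> W}) (x : V) (Y Z : seq V) :
  free (map f Y) -> {in x :: Z, forall z, f z = 0} -> free (x :: Z) ->
  free (x :: Y ++ Z).
Proof.
move=> fY fZ fr; have := free_ext fY fZ fr.
by rewrite -(perm_free (permEl (perm_catCA [:: x] Y Z))).
Qed.

End FreeExtension.

Section AnnFree.
Variables (K : fieldType) (A : algebra K).
Hypothesis anti : anticomm A.

(* [E] is linearly independent modulo the annihilator. *)
Definition ann_free (E : seq A) : Prop := forall D,
  {subset D <= annihilator A} -> free D -> free (E ++ D).

Lemma ann_free_cons (W : vectType K) (f : {linear A -> W}) (x : A) (E : seq A) :
  f x != 0 -> {in E, forall v, f v = 0} ->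
  {in annihilator A, forall v, f v = 0} -> ann_free E -> ann_free (x :: E).
Proof.
move=> fx fE fA E_free D DA D_free; apply: (free_ext1 (f := f)) => // [v|].
  by rewrite mem_cat => /orP[/fE|/DA/fA].
exact: E_free.
Qed.

Lemma ann_free_mul (y x : A) (E : seq A) :
  y ∘ x != 0 -> {in E, forall v, y ∘ v = 0} -> ann_free E -> ann_free (x :: E).
Proof.
move=> yx yE; apply: (ann_free_cons (f := amul A y)) => // v.
by move/(ann_mulr anti); apply.
Qed.

(** L_x kills [x] and central vectors and is injective on the span of [Y]; left multiplication by a
    member of [Y] then separates [x] from the annihilator. *)
Lemma ann_free_block (x : A) (Y : seq A) :
  Y != [::] -> free [seq x ∘ y | y <- Y] -> ann_free (x :: Y).
Proof.
case: Y => // y Y _ fY D DA D_free.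
apply: (free_ext_cons (f := amul A x) (Y := y :: Y)) => //.
  by move=> v; rewrite in_cons => /orP[/eqP ->|/DA/(ann_mulr anti)];
    [apply: anti | apply].
apply: (ann_free_mul (y := y) (E := [::])) => //.
by rewrite amulC // oppr_eq0; apply: (free_not0 fY); rewrite mem_head.
Qed.

(** Mutually orthogonal hyperbolic pairs, the product being read as an alternating form with values
    in the line of [c]. *)
Definition hyperbolic (c : A) (E : seq (A * A)) : bool :=
  all (fun p => p.1 ∘ p.2 == c) E && pairwise (fun p q =>
    [&& p.1 ∘ q.1 == 0, p.1 ∘ q.2 == 0, p.2 ∘ q.1 == 0 & p.2 ∘ q.2 == 0]) E.

(* Each component of a hyperbolic pair is detected by the product with the
   other one. *)
Lemma hyperbolic_ann_free (E : seq (A * A)) (c : A) :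
  c != 0 -> hyperbolic c E -> ann_free (flatten [seq [:: p.1; p.2] | p <- E]).
Proof.
rewrite /hyperbolic => c0; elim: E => [|[e1 e2] E IHE] /=; first by move=> _ D.
move=> /andP[/andP[/eqP e12 Ec] /andP[/allP eE pE]].
have eE0 v : v \in flatten [seq [:: p.1; p.2] | p <- E] ->
    e1 ∘ v = 0 /\ e2 ∘ v = 0.
  case/flattenP => l /mapP[p /eE /and4P[/eqP ? /eqP ? /eqP ? /eqP ?] ->].
  by rewrite !inE => /orP[] /eqP ->.
apply: (ann_free_mul (y := e2)).
- by rewrite amulC // e12 oppr_eq0.
- by move=> v; rewrite inE => /orP[/eqP ->|/eE0[]]; [apply: anti|].
apply: (ann_free_mul (y := e1)); first by rewrite e12.
  by move=> v /eE0[].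
by apply: IHE; rewrite Ec.
Qed.

End AnnFree.

(** * Degenerations obtained from witnesses *)

Section Witnesses.
Variables (K : closedFieldType) (A : algebra K).
Hypotheses (anti : anticomm A) (eng : engel A).

Lemma engel_eigen (a b : A) c : a ∘ b = c *: b -> b != 0 -> c = 0.
Proof.
move=> abE bn0; have [m _ /(_ a b) nil] := eng.
have itE k : iter k (amul A a) b = c ^+ k *: b.
  elim: k => [|k IHk] /=; first by rewrite scale1r.
  by rewrite IHk amulZr abE scalerA exprSr.
by move/eqP: nil; rewrite itE scaler_eq0 expf_eq0 (negPf bn0) orbF => /andP[_ /eqP].
Qed.

Lemma T222_degeneration (x y1 y2 y3 : A) :
  free [:: x; x ∘ y1; x ∘ y2; x ∘ y3] ->
  x ∘ (x ∘ y1) = 0 -> x ∘ (x ∘ y2) = 0 -> x ∘ (x ∘ y3) = 0 ->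
  degenerates A (anticomm_table K (dim A) tab_T222).
Proof.
move=> fr x1 x2 x3; have [m _ nil] := eng.
apply: (@operator_degeneration _ _ _ 4 m x
  [:: y1; y2; y3; x ∘ y1; x ∘ y2; x ∘ y3]) => //.
  apply: (free_ext_cons (f := amul A x) (Y := [:: y1; y2; y3]) _ _ fr) => //=.
    by move: fr; rewrite free_cons => /andP[].
  by move=> z; rewrite !inE => /or4P[] /eqP ->.
by do 6?[case=> [_|]] => //; tprod_simpl.
Qed.

Lemma T22_degeneration (x y z : A) :
  free [:: x; x ∘ y; x ∘ z] -> x ∘ (x ∘ y) = 0 -> x ∘ (x ∘ z) = 0 ->
  degenerates A (anticomm_table K (dim A) tab_T22).
Proof.
move=> fr xy xz; have [m _ nil] := eng.
apply: (@operator_degeneration _ _ _ 3 m x [:: y; z; x ∘ y; x ∘ z]) => //.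
  apply: (free_ext_cons (f := amul A x) (Y := [:: y; z]) _ _ fr) => //=.
    by move: fr; rewrite free_cons => /andP[].
  by move=> v; rewrite !inE => /or3P[] /eqP ->.
by do 4?[case=> [_|]] => //; tprod_simpl.
Qed.

Lemma eta1_degeneration (x y : A) :
  free [:: x; x ∘ y] -> x ∘ (x ∘ y) = 0 ->
  degenerates A (anticomm_table K (dim A) tab_eta1).
Proof.
move=> fr xy; have [m _ nil] := eng.
apply: (@operator_degeneration _ _ _ 2 m x [:: y; x ∘ y]) => //.
  apply: (free_ext_cons (f := amul A x) (Y := [:: y]) _ _ fr) => //=.
    by move: fr; rewrite free_cons => /andP[].
  by move=> v; rewrite !inE => /orP[] /eqP ->.
by do 2?[case=> [_|]] => //; tprod_simpl.
Qed.

Lemma T3_free (a b : A) :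
  a ∘ (a ∘ b) != 0 -> a ∘ (a ∘ (a ∘ b)) = 0 ->
  free [:: a; b; a ∘ b; a ∘ (a ∘ b)].
Proof.
move=> n0 a0; set u := a ∘ (a ∘ b) in n0 a0 *.
have fu : free [:: u] by rewrite seq1_free.
apply: (free_ext_cons (f := amul A a) (Y := [:: b; a ∘ b]) (Z := [:: u])).
- rewrite /= -/u; apply: (free_ext1 (f := amul A a)) => // z.
  by rewrite inE => /eqP ->.
- by move=> z; rewrite !inE => /orP[] /eqP -> //; apply: anti.
(* If a = c u, then (a b) a = -u = -c^-1 a, so L_{ab} would have a nonzero eigenvalue, against the
   Engel condition. *)
rewrite free_cons span_seq1 fu andbT; apply/negP => /vlineP[c aE].
have cn0 : c != 0.
  by apply/eqP => c0; move: n0; rewrite /u aE c0 scale0r amul0l eqxx.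
have an0 : a != 0 by rewrite aE scaler_eq0 negb_or cn0.
have /engel_eigen/(_ an0)/eqP : (a ∘ b) ∘ a = (- c^-1) *: a.
  by rewrite amulC // -/u [in RHS]aE scalerA mulNr mulVf // scaleN1r.
by rewrite oppr_eq0 invr_eq0 (negPf cn0).
Qed.

(** Replace [b] by a b as long as L_a^3 b is nonzero; nilpotency of L_a ends this. *)
Lemma T3_chain (a b : A) :
  a ∘ (a ∘ b) != 0 -> exists2 b' : A, a ∘ (a ∘ b') != 0 & a ∘ (a ∘ (a ∘ b')) = 0.
Proof.
move=> n0; have [m _ /(_ a b)] := eng.
elim: m b n0 => [|m IHm] b n0.
  by move=> /= b0; move: n0; rewrite b0 !amul0r eqxx.
rewrite iterSr => nil; have [|/IHm] := eqVneq (a ∘ (a ∘ (a ∘ b))) 0.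
  by exists b.
exact.
Qed.

Lemma T3_degeneration (a b : A) :
  a ∘ (a ∘ b) != 0 -> degenerates A (anticomm_table K (dim A) tab_T3).
Proof.
move=> /T3_chain[b' n0' a0]; have [m _ nil] := eng.
apply: (@operator_degeneration _ _ _ 3 m a
  [:: b'; a ∘ b'; a ∘ (a ∘ b')]) => //.
  exact: T3_free.
by do 3?[case=> [_|]] => //; tprod_simpl.
Qed.

Section TwoStep.
Hypothesis two : two_step A.

Let two_r := two_step_r anti two.
Let mul_ann := two_step_ann two.

Lemma complete_basis (U : {vspace A}) (X : seq A) :
  free X -> {subset X <= U} ->
  exists D, [/\ free (X ++ D), <<X ++ D>>%VS = U & {subset D <= U}].
Proof.
move=> X_free XU; exists (vbasis (U :\: <<X>>)%VS).
have DU : {subset vbasis (U :\: <<X>>)%VS <= U}.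
  by move=> v /vbasis_mem; apply: subvP (diffvSl _ _) _.
have dx : directv (<<X>> + (U :\: <<X>>)).
  by apply/directv_addP; rewrite capvC capv_diff.
have Xb : basis_of <<X>> X by rewrite basisEfree X_free subvv (eqnP X_free) leqnn.
have bb := cat_basis dx Xb (vbasisP _).
split=> //; first exact: basis_free bb.
rewrite (span_basis bb) addvC addv_diff; apply/addv_idPl.
exact/span_subvP.
Qed.

Lemma exact_two_step_degeneration r s (E F : seq A) (w : nat -> nat) :
  table_wf s r (size (E ++ F)) -> size E = r ->
  ann_free E -> free F -> {subset F <= annihilator A} ->
  (forall i, (i < size (E ++ F))%N -> (0 < w i < 5)%N) ->
  all (fun t => w t.2.-1 == (w t.1.1.-1 + w t.1.2.-1)%N) s ->
  (forall i j, (i < j < r)%N ->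
     (E ++ F)`_i ∘ (E ++ F)`_j = tprod s (E ++ F) i j) ->
  degenerates A (anticomm_table K (dim A) s).
Proof.
move=> s_wf sizeE EFD F_free F_ann w_bound s_w XX.
have [D [FD_free FD DA]] := complete_basis F_free F_ann.
apply: (@two_step_degeneration _ _ _ r (E ++ F) D w) => //.
- rewrite -catA EFD // => v.
  by rewrite mem_cat => /orP[/F_ann|/DA].
- by rewrite -sizeE drop_size_cat.
by move=> i j /XX ->; rewrite subrr mem0v.
Qed.

Lemma eps23_degeneration (x y z : A) :
  free [:: y ∘ z; x ∘ y; x ∘ z] ->
  degenerates A (anticomm_table K (dim A) tab_eps23).
Proof.
move=> fr.
apply: (@exact_two_step_degeneration 3 _ [:: x; y; z]
   [:: y ∘ z; x ∘ y; x ∘ z] (nth 0%N [:: 1; 1; 1; 2; 2; 2]%N)) => //.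
- apply: ann_free_block => //.
  by have := fr; rewrite free_cons => /andP[].
- by move=> v; rewrite !inE => /or3P[] /eqP ->.
- by do 6?[case=> [//|]].
by move=> [|[|[|i]]] [|[|[|j]]] //= ij; try (by exfalso; lia); tprod_simpl.
Qed.

Lemma eta2_degeneration (e1 e2 e3 e4 c : A) :
  hyperbolic c [:: (e1, e2); (e3, e4)] -> c != 0 ->
  degenerates A (anticomm_table K (dim A) tab_eta2).
Proof.
move=> hE c0; have := hE; rewrite /hyperbolic /= !andbT.
move=> /andP[/andP[/eqP e12 /eqP e34] /and4P[/eqP e13 /eqP e14 /eqP e23 /eqP e24]].
have cA : c \in annihilator A by rewrite -e12.
apply: (@exact_two_step_degeneration 4 _ [:: e1; e2; e3; e4] [:: c]
   (nth 0%N [:: 1; 1; 1; 1; 2]%N)) => //.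
- exact: (hyperbolic_ann_free anti c0 hE).
- by rewrite seq1_free.
- by move=> v; rewrite inE => /eqP ->.
- by do 5?[case=> [//|]].
by move=> [|[|[|[|i]]]] [|[|[|[|j]]]] //= ij; try (by exfalso; lia); tprod_simpl.
Qed.

Lemma eta3_degeneration (e1 e2 e3 e4 e5 e6 c : A) :
  hyperbolic c [:: (e1, e2); (e3, e4); (e5, e6)] -> c != 0 ->
  degenerates A (anticomm_table K (dim A) tab_eta3).
Proof.
move=> hE c0; have := hE; rewrite /hyperbolic /= !andbT.
move=> /andP[/and3P[/eqP e12 /eqP e34 /eqP e56]].
move=> /andP[/andP[/and4P[/eqP e13 /eqP e14 /eqP e23 /eqP e24]
  /and4P[/eqP e15 /eqP e16 /eqP e25 /eqP e26]]
  /and4P[/eqP e35 /eqP e36 /eqP e45 /eqP e46]].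
have cA : c \in annihilator A by rewrite -e12.
apply: (@exact_two_step_degeneration 6 _ [:: e1; e2; e3; e4; e5; e6] [:: c]
   (nth 0%N [:: 1; 1; 1; 1; 1; 1; 2]%N)) => //.
- exact: (hyperbolic_ann_free anti c0 hE).
- by rewrite seq1_free.
- by move=> v; rewrite inE => /eqP ->.
- by do 7?[case=> [//|]].
by move=> [|[|[|[|[|[|i]]]]]] [|[|[|[|[|[|j]]]]]] //= ij; try (by exfalso; lia);
  tprod_simpl.
Qed.

(* In the limit e1 e2 and a second central vector dual to [mu] survive, so that
   these conditions suffice for a degeneration to [T22_eps24]. *)
Definition eps24_pencil (e1 e2 e3 e4 : A) (mu : {scalar A}) : Prop :=
  [/\ e1 ∘ e2 != 0, mu (e1 ∘ e2) = 0 &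
   [/\ mu (e1 ∘ e3) = 1, mu (e2 ∘ e4) = 1, mu (e1 ∘ e4) = 0
     & mu (e2 ∘ e3) = 0]].

(** Each vector is separated from the later ones and from the annihilator: e3 by mu after L_{e1}, e4
    by mu after L_{e2}, e2 by L_{e1}, e1 by L_{e2}. *)
Lemma eps24_ann_free (e1 e2 e3 e4 : A) (mu : {scalar A}) :
  eps24_pencil e1 e2 e3 e4 mu -> ann_free [:: e3; e4; e2; e1].
Proof.
case=> f0 mu12 [mu13 mu24 mu14 mu23].
pose L e := (mu : {linear A -> K^o}) \o (amul A e) : {linear A -> K^o}.
have LA e : {in annihilator A, forall v, L e v = 0}.
  by move=> v /(ann_mulr anti) v0; rewrite /= v0 linear0.
apply: (@ann_free_cons _ _ _ (L e1)) => //; first by rewrite /= mu13 oner_eq0.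
  by move=> v; rewrite !inE => /or3P[] /eqP -> //; rewrite /= anti linear0.
apply: (@ann_free_cons _ _ _ (L e2)) => //; first by rewrite /= mu24 oner_eq0.
  move=> v; rewrite !inE => /orP[] /eqP -> //=; first by rewrite anti linear0.
  by rewrite amulC // linearN /= mu12 oppr0.
apply: (ann_free_mul anti (y := e1)) => // [v|].
  by rewrite inE => /eqP ->; apply: anti.
apply: (ann_free_mul anti (y := e2)) => //.
by rewrite amulC // oppr_eq0.
Qed.

Lemma eps24_free (e1 e2 e3 e4 : A) (mu : {scalar A}) (D : seq A) :
  eps24_pencil e1 e2 e3 e4 mu -> {subset D <= annihilator A} ->
  {in D, forall v, mu v = 0} -> free (e1 ∘ e2 :: D) ->
  free ([:: e1; e2; e3; e4; e1 ∘ e2; e1 ∘ e3] ++ D).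
Proof.
move=> wit DA Dmu fr; have [f0 mu12 [mu13 _ _ _]] := wit.
have f21 : free [:: e1 ∘ e3, e1 ∘ e2 & D].
  apply: (free_ext1 (f := mu : {linear A -> K^o})) fr; first by rewrite mu13 oner_eq0.
  by move=> v; rewrite inE => /orP[/eqP ->|/Dmu].
have := eps24_ann_free wit _ f21; rewrite cat_cons => fr6.
have perm6 (u1 u2 u3 u4 u5 u6 : A) :
    perm_eq [:: u3; u4; u2; u1; u6; u5] [:: u1; u2; u3; u4; u5; u6].
  by apply/permP => p; rewrite /=; ring.
have := perm6 e1 e2 e3 e4 (e1 ∘ e2) (e1 ∘ e3).
rewrite -(perm_cat2r D) => /perm_free <-; apply: fr6 => v.
by rewrite !inE => /or3P[/eqP ->|/eqP ->|/DA].
Qed.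

Lemma eps24_degeneration (e1 e2 e3 e4 : A) (mu : {scalar A}) :
  eps24_pencil e1 e2 e3 e4 mu ->
  degenerates A (anticomm_table K (dim A) tab_eps24).
Proof.
move=> wit; have [f0 mu12 [mu13 mu24 mu14 mu23]] := wit.
pose U := (annihilator A :&: lker (linfun (mu : {linear A -> K^o})))%VS.
have UP v : (v \in U) = (v \in annihilator A) && (mu v == 0).
  by rewrite memv_cap memv_ker lfunE.
have [||D [f1D_free f1D DU]] := @complete_basis U [:: e1 ∘ e2].
- by rewrite seq1_free.
- by move=> v; rewrite inE => /eqP ->; rewrite UP mul_ann mu12 eqxx.
have f1DP v : v \in annihilator A -> mu v = 0 -> v \in <<e1 ∘ e2 :: D>>%VS.
  by move=> vA v0; rewrite -[_ :: D]/([:: e1 ∘ e2] ++ D) f1D UP vA v0 eqxx.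
have DA : {subset D <= annihilator A} by move=> v /DU; rewrite UP => /andP[].
have Dmu : {in D, forall v, mu v = 0} by move=> v /DU; rewrite UP => /andP[_ /eqP].
have FD : <<[:: e1 ∘ e2; e1 ∘ e3] ++ D>>%VS = annihilator A.
  apply/eqP; rewrite eqEsubv; apply/andP; split.
    by apply/span_subvP => v; rewrite !inE => /or3P[/eqP ->|/eqP ->|/DA].
  apply/subvP => v vA; rewrite -[v](subrK (mu v *: (e1 ∘ e3))) memvD //.
    apply: subvP (f1DP _ _ _); first by apply/sub_span => u; rewrite !inE orbCA orbC =>
      /orP[->|->]; rewrite ?orbT.
    - by rewrite memvB // memvZ.
    by rewrite linearB linearZ /= mu13 mulr1 subrr.
  by rewrite memvZ // memv_span // !inE eqxx orbT.
(* Central vectors in the kernel of [mu] are spanned by e1 e2, of weight 2, and [D], of weight 0. In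
   weight 3 the products therefore survive only through their value under [mu], as multiples of e1
   e3; the product e3 e4 has weight 4 and vanishes in the limit. *)
apply: (@two_step_degeneration _ _ _ 4
   [:: e1; e2; e3; e4; e1 ∘ e2; e1 ∘ e3] D (nth 0%N [:: 1; 1; 2; 2; 2; 3]%N)) => //.
- exact: eps24_free wit DA Dmu f1D_free.
- by do 6?[case=> [//|]].
have low v : v \in annihilator A -> mu v = 0 ->
    v \in <<[:: e1; e2; e3; e4; e1 ∘ e2] ++ D>>%VS.
  move=> vA v0; apply: subvP (f1DP v vA v0); apply/sub_span => u.
  by rewrite !inE => /orP[->|->]; rewrite ?orbT.
move=> [|[|[|[|i]]]] [|[|[|[|j]]]] //= ij; try (by exfalso; lia); tprod_simpl.
- by rewrite mem0v.
- by rewrite mem0v.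
- by rewrite ?subr0 low.
- by rewrite ?subr0 low.
- by rewrite low ?memvB // linearB /= mu24 mu13 subrr.
rewrite ?subr0; have : e3 ∘ e4 \in annihilator A by [].
rewrite -FD; apply: subvP; apply/sub_span => u.
by rewrite !inE => /or3P[] ->; rewrite ?orbT.
Qed.

End TwoStep.
End Witnesses.

(** * Classification *)

Section Witnesses.
Variables (K : fieldType) (A : algebra K).

Definition T3_witness : Prop := exists a b : A, a ∘ (a ∘ b) != 0.

Definition T222_witness : Prop := exists x y1 y2 y3 : A,
  free [:: x; x ∘ y1; x ∘ y2; x ∘ y3] /\
  [/\ x ∘ (x ∘ y1) = 0, x ∘ (x ∘ y2) = 0 & x ∘ (x ∘ y3) = 0].

Definition eps23_witness : Prop := exists x y z : A,
  free [:: y ∘ z; x ∘ y; x ∘ z].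

Definition eta3_witness : Prop := exists (E : seq (A * A)) (c : A),
  [/\ size E = 3%N, hyperbolic c E & c != 0].

Lemma in_span1 (v a : A) : v \in <<[:: a]>>%VS -> exists c, v = c *: a.
Proof. by rewrite span_seq1 => /vlineP. Qed.

Lemma in_span2 (v a b : A) :
  v \in <<[:: a; b]>>%VS -> exists c d, v = c *: a + d *: b.
Proof.
rewrite span_cons => /memv_addP[u /vlineP[c ->] [w /in_span1[d ->] ->]].
by exists c, d.
Qed.

Lemma free2_neq0 (a b : A) : free [:: a; b] -> a != 0 /\ b != 0.
Proof. by move=> fr; split; apply: (free_not0 fr); rewrite !inE eqxx ?orbT. Qed.

Lemma free2C (a b : A) : free [:: a; b] = free [:: b; a].
Proof. exact: perm_free (permEl (perm_catC [:: a] [:: b])). Qed.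

Lemma free2_coef (a b : A) c d :
  free [:: a; b] -> c *: a + d *: b = 0 -> c = 0 /\ d = 0.
Proof.
move=> /(@freeP _ _ _ (in_tuple [:: a; b])) fr cd0.
have {}fr := fr (nth 0 [:: c; d]); split.
  by apply: (fr _ (Ordinal (isT : 0 < 2)%N)); rewrite !big_ord_recl big_ord0 addr0.
by apply: (fr _ (Ordinal (isT : 1 < 2)%N)); rewrite !big_ord_recl big_ord0 addr0.
Qed.

Lemma dual_functional (a b : A) : free [:: b; a] ->
  exists mu : {scalar A}, mu b = 1 /\ mu a = 0.
Proof.
move=> fr; exists (coord (in_tuple [:: b; a]) (Ordinal (isT : 0 < 2)%N)).
by split; [have := coord_free (X := in_tuple [:: b; a]) (Ordinal (isT : 0 < 2)%N)
  (Ordinal (isT : 0 < 2)%N) fr | have := coord_free (X := in_tuple [:: b; a])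
  (Ordinal (isT : 1 < 2)%N) (Ordinal (isT : 0 < 2)%N) fr].
Qed.

Lemma free_cons_notin (v : A) (X : seq A) :
  free X -> ~~ free (v :: X) -> v \in <<X>>%VS.
Proof. by move=> fX; rewrite free_cons fX andbT negbK. Qed.

Lemma mk_model s r (E F : seq A) :
  anticomm A -> table_wf s r (size (E ++ F)) -> size E = r -> free (E ++ F) ->
  {subset F <= annihilator A} ->
  (forall i j, (i < j < r)%N ->
     (E ++ F)`_i ∘ (E ++ F)`_j = tprod s (E ++ F) i j) ->
  (forall v, exists2 u, u \in <<E>>%VS & v - u \in annihilator A) ->
  model s r (size (E ++ F)) A.
Proof.
move=> anti s_wf sizeE EF_free F_ann EM cover; exists (E ++ F).
have F_nth i : (r <= i)%N -> (E ++ F)`_i \in annihilator A.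
  move=> ri; rewrite nth_cat sizeE ltnNge ri /=.
  have [lt_i|le_i] := ltnP (i - r) (size F); first by rewrite F_ann ?mem_nth.
  by rewrite nth_default ?mem0v.
split=> // [i j ik jk|v].
  have [ri|ir] := leqP r i.
    by rewrite (annP _ (F_nth _ ri)) (tprod_out _ s_wf) // ri.
  have [rj|jr] := leqP r j.
    by rewrite (ann_mulr anti (F_nth _ rj)) (tprod_out _ s_wf) // rj orbT.
  have [lt_ij|lt_ji|->] := ltngtP i j.
  - by rewrite EM // lt_ij.
  - by rewrite amulC // tprodC EM // lt_ji.
  by rewrite anti [RHS]big1 // => t _; rewrite subrr scale0r.
have [u /(@coord_span _ _ _ (in_tuple E)) uE vu] := cover v.
exists (fun i => if insub i is Some i' then coord (in_tuple E) i' u else 0).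
suff <- : u = \sum_(i < r) (if insub (val i) is Some i'
  then coord (in_tuple E) i' u else 0) *: (E ++ F)`_i by [].
rewrite [LHS]uE; rewrite -[in RHS]sizeE; apply: eq_bigr => i _.
by rewrite valK nth_cat ltn_ord.
Qed.

End Witnesses.

Definition eps24_witness (K : closedFieldType) (A : algebra K) : Prop :=
  exists e1 e2 e3 e4 : A, exists mu : {scalar A}, eps24_pencil e1 e2 e3 e4 mu.

Section Classification.
Variables (K : closedFieldType) (A : algebra K).
Hypothesis anti : anticomm A.

Lemma two_step_T222 (x y1 y2 y3 : A) :
  two_step A -> free [:: x ∘ y1; x ∘ y2; x ∘ y3] -> T222_witness A.
Proof.
move=> two fr; have two_r := two_step_r anti two.
exists x, y1, y2, y3; split; last by rewrite !two_r.
apply: (free_ext1 (f := amul A y1)) => //.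
  by rewrite /= amulC // oppr_eq0 (free_not0 fr) ?mem_head.
by move=> v; rewrite !inE => /or3P[] /eqP ->; apply: two_r.
Qed.

Section TwoStepT22.
Hypotheses (two : two_step A) (no222 : ~ T222_witness A)
  (no24 : ~ eps24_witness A).

Let two_r := two_step_r anti two.

(** A third independent value of L_x would be a witness for T^{2,2,2}. *)
Lemma in_span_ad (x y z v : A) :
  free [:: x ∘ y; x ∘ z] -> exists p q, x ∘ v = p *: (x ∘ y) + q *: (x ∘ z).
Proof.
move=> fr; apply: in_span2; apply: free_cons_notin => //; apply/negP => fr3.
by apply: no222; apply: two_step_T222 fr3.
Qed.

(** Otherwise some functional vanishes on x u but neither on u v nor on x u', and then x, u and
    suitable multiples of u', v form a pencil for eps_24. *)
Lemma mul_in_line (x u u' v : A) :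
  free [:: x ∘ u; x ∘ u'] -> u ∘ u' = 0 -> x ∘ v = 0 ->
  exists c, u ∘ v = c *: (x ∘ u).
Proof.
move=> fr uu' xv; apply: in_span1; rewrite -[_ \in _]negbK; apply/negP => uv.
have [xu0 _] := free2_neq0 fr.
have fr1 : free [:: x ∘ u] by rewrite seq1_free.
have fr_uv : free [:: u ∘ v; x ∘ u] by rewrite free_cons uv.
have fr_xu' : free [:: x ∘ u'; x ∘ u].
  by rewrite free2C.
have [mu1 [mu1v mu1u]] := dual_functional fr_uv.
have [mu2 [mu2v mu2u]] := dual_functional fr_xu'.
(* [mu1] is nonzero on u v and [mu2] on x u'; if neither is nonzero on both, their sum is. *)
have [mu [mu_u mu_v mu_u']] : exists mu : {scalar A},
    [/\ mu (x ∘ u) = 0, mu (u ∘ v) != 0 & mu (x ∘ u') != 0].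
  have [mu1u'|?] := eqVneq (mu1 (x ∘ u')) 0; last first.
    by exists mu1; rewrite mu1v oner_eq0.
  have [mu2uv|?] := eqVneq (mu2 (u ∘ v)) 0; last first.
    by exists mu2; rewrite mu2v oner_eq0.
  pose mu : {scalar A} := (mu1 : {linear A -> K^o}) \+ (mu2 : {linear A -> K^o}).
  have muE v' : mu v' = mu1 v' + mu2 v' by [].
  exists mu.
  by rewrite !muE mu1u mu2u mu1v mu2v mu1u' mu2uv !(addr0, add0r) oner_eq0.
apply: no24; exists x, u, ((mu (x ∘ u'))^-1 *: u'), ((mu (u ∘ v))^-1 *: v), mu.
split=> //; rewrite !amulZr !linearZ /= uu' xv linear0 !mulr0.
by split; rewrite ?mulVf.
Qed.

(** For p nonzero, x, z + w, y and a multiple of v would form a pencil for eps_24: adding [w] to [z]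
    changes no product with x or y, but produces the product with v that the pencil requires. *)
Lemma orthogonal_mul (x y z v w : A) :
  free [:: x ∘ y; x ∘ z] -> y ∘ z = 0 ->
  [/\ x ∘ v = 0, y ∘ v = 0 & z ∘ v = 0] ->
  [/\ x ∘ w = 0, y ∘ w = 0 & z ∘ w = 0] ->
  forall p q, v ∘ w = p *: (x ∘ y) + q *: (x ∘ z) -> p = 0.
Proof.
move=> fr yz [xv yv zv] [xw yw zw] p q vw; apply/eqP/negPn/negP => p0.
have [mu [mu_y mu_z]] := dual_functional fr.
have [_ xz0] := free2_neq0 fr.
apply: no24; exists x, (z + w), y, (- p^-1 *: v), mu.
have wv : w ∘ v = - (p *: (x ∘ y) + q *: (x ∘ z)) by rewrite amulC // vw.
split.
- by rewrite amulDr xw addr0.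
- by rewrite amulDr xw addr0 mu_z.
rewrite !amulZr xv scaler0 linear0 !amulDl zv add0r wv.
rewrite [z ∘ y]amulC // yz oppr0 add0r [w ∘ y]amulC // yw oppr0 linear0; split=> //.
rewrite scalerN scaleNr opprK scalerDr linearD !linearZ /= mu_y mu_z.
by rewrite !mulr0 addr0 mulr1 mulVf.
Qed.

Lemma T22_model (x y z : A) :
  free [:: x ∘ y; x ∘ z] -> y ∘ z = 0 -> model tab_T22 3 5 A.
Proof.
move=> fr yz; have [xy0 xz0] := free2_neq0 fr.
have ort v : exists2 u, u \in <<[:: x; y; z]>>%VS &
    [/\ x ∘ (v - u) = 0, y ∘ (v - u) = 0 & z ∘ (v - u) = 0].
  have [p [q xv]] := in_span_ad v fr.
  set v1 := v - (p *: y + q *: z).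
  have xv1 : x ∘ v1 = 0 by rewrite amulBr amulDr !amulZr xv subrr.
  have [al yv1] := mul_in_line fr yz xv1.
  have fr' : free [:: x ∘ z; x ∘ y].
    by rewrite free2C.
  have zy : z ∘ y = 0 by rewrite amulC // yz oppr0.
  have [be zv1] := mul_in_line fr' zy xv1.
  (* Apart from the factors [al] and [be] for y and z, the same lemma for y + z gives one factor
     [ga], which forces al = be. A single multiple of [x] then corrects both products. *)
  have fr'' : free [:: x ∘ (y + z); x ∘ z].
    rewrite free_cons seq1_free xz0 andbT; apply/negP => /in_span1[c].
    move/eqP; rewrite amulDr -subr_eq0 -addrA -[X in _ + (X - _)]scale1r -scalerBl.
    rewrite -[x ∘ y]scale1r => /eqP /(free2_coef fr)[/eqP].
    by rewrite oner_eq0.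
  have yzz : (y + z) ∘ z = 0 by rewrite amulDl yz anti addr0.
  have [ga yzv1] := mul_in_line fr'' yzz xv1.
  have : (al - ga) *: (x ∘ y) + (be - ga) *: (x ∘ z) = 0.
    rewrite !scalerBl addrACA -opprD -scalerDr -amulDr -yzv1 amulDl yv1 zv1.
    by rewrite subrr.
  move=> /(free2_coef fr)[/eqP]; rewrite subr_eq0 => /eqP alE /eqP.
  rewrite subr_eq0 => /eqP beE.
  exists (p *: y + q *: z - al *: x).
    by rewrite memvB ?memvD ?memvZ ?memv_span // !inE eqxx ?orbT.
  rewrite opprB addrA addrAC -/v1 !(amulDr _ v1) !amulZr xv1 yv1 zv1 anti.
  rewrite beE -alE [y ∘ x]amulC // [z ∘ x]amulC // !scalerN !subrr.
  by rewrite scaler0 addr0.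
have ort_ann v : [/\ x ∘ v = 0, y ∘ v = 0 & z ∘ v = 0] -> v \in annihilator A.
  move=> v0; apply/annP => w; have [u uE w0] := ort w.
  have vw' : v ∘ (w - u) = 0.
    (* Replacing [x] by x + v leaves the products with y and z unchanged, so the rank bound for
       L_{x+v} places v (w - u) in the span of x y and x z. [orthogonal_mul], applied also with y
       and z exchanged, makes both coefficients zero. *)
    have fr_xv : free [:: (x + v) ∘ y; (x + v) ∘ z].
      have [xv yv zv] := v0.
      by rewrite !amulDl [v ∘ y]amulC // yv [v ∘ z]amulC // zv oppr0 !addr0.
    have [p [q]] := in_span_ad (w - u) fr_xv.
    have [xv yv zv] := v0; have [xw yw zw] := w0.
    rewrite !amulDl [v ∘ y]amulC // yv [v ∘ z]amulC // zv oppr0 !addr0 xw add0r.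
    move=> vwE; have p0 := orthogonal_mul fr yz v0 w0 vwE.
    have fr' : free [:: x ∘ z; x ∘ y].
      by rewrite free2C.
    have zy : z ∘ y = 0 by rewrite amulC // yz oppr0.
    have vwE' := vwE; rewrite [RHS]addrC in vwE'.
    have q0 : q = 0 := (orthogonal_mul fr' zy (And3 xv zv yv) (And3 xw zw yw) vwE').
    by rewrite vwE p0 q0 !scale0r addr0.
  have vu : v ∘ u = 0.
    have [xv yv zv] := v0.
    apply: (span_linear0 (f := amul A v)) uE => t.
    rewrite !inE /= amulC // => /or3P[] /eqP ->; rewrite ?xv ?yv ?zv oppr0 //.
  by rewrite -[w](subrK u) amulDr vw' vu addr0.
apply: (@mk_model _ _ _ 3 [:: x; y; z] [:: x ∘ y; x ∘ z]) => //.
- apply: (free_ext_cons (f := amul A x) (Y := [:: y; z])) => //.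
    by move=> v; rewrite !inE => /or3P[] /eqP ->; rewrite /= ?two_r ?anti.
  apply: (free_ext1 (f := amul A y)) => //; first by rewrite /= amulC // oppr_eq0.
  by move=> v; rewrite !inE => /orP[] /eqP ->; rewrite /= two_r.
- by move=> v; rewrite !inE => /orP[] /eqP ->; apply: two_step_ann.
- by move=> [|[|[|i]]] [|[|[|j]]] //= ij; try (by exfalso; lia); tprod_simpl.
by move=> v; have [u uE u0] := ort v; exists u => //; apply: ort_ann.
Qed.

End TwoStepT22.
Section Rank1.
Variable c : A.
Hypotheses (c0 : c != 0) (line : forall u w : A, exists k, u ∘ w = k *: c).

Let pairs (E : seq (A * A)) := flatten [seq [:: p.1; p.2] | p <- E].
Let perp (E : seq (A * A)) (v : A) :=
  forall p, p \in E -> p.1 ∘ v = 0 /\ p.2 ∘ v = 0.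

(** Orthogonal projection onto the span of the pairs, one pair at a time. *)
Lemma hyperbolic_split E v : hyperbolic c E ->
  exists2 u, u \in <<pairs E>>%VS & perp E (v - u).
Proof.
elim: E => [|[e1 e2] E IHE]; first by exists 0; rewrite ?mem0v.
rewrite /hyperbolic /= => /andP[/andP[/eqP e12 Ec] /andP[/allP eE pE]].
have [|u uE vu] := IHE; first by rewrite /hyperbolic Ec.
have [k1 k1E] := line e1 (v - u); have [k2 k2E] := line e2 (v - u).
exists (u + (k1 *: e2 - k2 *: e1)).
  rewrite memvD //.
    apply: subvP uE; apply/sub_span => t tE.
    by rewrite !in_cons tE !orbT.
  by rewrite memvB ?memvZ ?memv_span // !inE eqxx ?orbT.
rewrite opprD addrA => p; rewrite in_cons => /orP[/eqP ->|pE'] /=.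
  rewrite !(amulDr _ (v - u)) k1E k2E opprB amulBr !amulZr anti e12 scaler0 sub0r.
  rewrite subrr amulBr !amulZr anti scaler0 subr0.
  by rewrite [e2 ∘ e1]amulC // e12 scalerN subrr.
have [p1 p2] := vu p pE'; have /and4P[/eqP h1 /eqP h2 /eqP h3 /eqP h4] := eE _ pE'.
rewrite !(amulDr _ (v - u)) p1 p2 !add0r opprB !amulBr !amulZr.
rewrite [p.1 ∘ e1]amulC // [p.1 ∘ e2]amulC // [p.2 ∘ e1]amulC // [p.2 ∘ e2]amulC //.
by move: h1 h2 h3 h4 => /= -> -> -> ->; rewrite !oppr0 !scaler0 subrr.
Qed.

Lemma hyperbolic_next E : hyperbolic c E ->
  (forall v, perp E v -> v \in annihilator A) \/
  exists p, hyperbolic c (p :: E).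
Proof.
move=> hE.
have [[v [w [v0 w0 vw]]]|none] :=
  classic (exists v w, [/\ perp E v, perp E w & v ∘ w != 0]).
  right; have [k kE] := line v w; exists (v, k^-1 *: w).
  have k0 : k != 0 by apply: contraNneq vw => k0; rewrite kE k0 scale0r.
  move: hE; rewrite /hyperbolic /= => /andP[-> ->].
  rewrite amulZr kE scalerA mulVf // scale1r eqxx /= andbT.
  apply/allP => p pE; have [v1 v2] := v0 p pE; have [w1 w2] := w0 p pE.
  rewrite !amulZl ![v ∘ _]amulC // ![w ∘ _]amulC //.
  by rewrite v1 v2 w1 w2 !oppr0 !scaler0 eqxx.
left=> v v0; apply/annP => w; have [u uE w0] := hyperbolic_split w hE.
rewrite -[w](subrK u) amulDr.
have -> : v ∘ (w - u) = 0.
  by apply/eqP/negPn/negP => vw; apply: none; exists v, (w - u).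
rewrite add0r; apply: (span_linear0 (f := amul A v)) uE => t.
case/flattenP => l /mapP[p /v0[p1 p2] ->].
by rewrite !inE => /orP[] /eqP ->; rewrite /= amulC // ?p1 ?p2 oppr0.
Qed.

End Rank1.

(** If a b = c and a d is nonzero, the image of L_a is the line of [c]; it contains d a, so the
    image of L_d is the same line. What remains is [u] orthogonal to x and y, and there x + u has
    the same product with y as x. *)
Lemma rank1_line (c x y : A) :
  (forall x y z : A, ~~ free [:: x ∘ y; x ∘ z]) -> c != 0 -> x ∘ y = c ->
  forall u w : A, exists k, u ∘ w = k *: c.
Proof.
move=> dep c0 xy u w.
have in_line (a b d : A) : a ∘ b != 0 -> exists k, a ∘ d = k *: (a ∘ b).
  move=> ab; apply: in_span1; apply: free_cons_notin; first by rewrite seq1_free.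
  exact: dep.
have swap (a b d : A) : a ∘ b = c -> a ∘ d != 0 ->
    exists k, d ∘ a = k *: c /\ d ∘ a != 0.
  move=> ab ad; have [k adE] : exists k, a ∘ d = k *: c.
    by rewrite -ab; apply: in_line; rewrite ab.
  by exists (- k); rewrite scaleNr -adE -amulC // amulC // oppr_eq0.
have through (a b d e : A) : a ∘ b = c -> a ∘ d != 0 -> exists k, d ∘ e = k *: c.
  move=> ab ad; have [k [da da0]] := swap a b d ab ad.
  by have [k' ->] := in_line d a e da0; exists (k' * k); rewrite da scalerA.
have yx : y ∘ (- x) = c by rewrite amulNr -amulC.
have [xu|/(through _ _ _ w xy) //] := eqVneq (x ∘ u) 0.
have [yu|/(through _ _ _ w yx) //] := eqVneq (y ∘ u) 0.
have uy : (x + u) ∘ y = c by rewrite amulDl xy [u ∘ y]amulC // yu oppr0 addr0.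
have [xw|xw] := eqVneq (x ∘ w) 0; last first.
  have [k kE] := through _ _ _ u xy xw; exists (- k).
  by rewrite amulC // kE scaleNr.
have := in_line (x + u) y w; rewrite uy => /(_ c0)[k].
by rewrite amulDl xw add0r => ->; exists k.
Qed.

Lemma eta1_model (x y c : A) :
  two_step A -> c != 0 -> hyperbolic c [:: (x, y)] ->
  (forall v, exists2 u, u \in <<[:: x; y]>>%VS & v - u \in annihilator A) ->
  model tab_eta1 2 3 A.
Proof.
move=> two c0 hE cover; have := hE; rewrite /hyperbolic /= !andbT => /eqP xy.
have cA : c \in annihilator A by rewrite -xy two_step_ann.
apply: (@mk_model _ _ _ 2 [:: x; y] [:: c]) => //.
- apply: (hyperbolic_ann_free anti c0 hE); last by rewrite seq1_free.
  by move=> v; rewrite inE => /eqP ->.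
- by move=> v; rewrite inE => /eqP ->.
by move=> [|[|i]] [|[|j]] //= ij; try (by exfalso; lia); tprod_simpl.
Qed.

Lemma eta2_model (e1 e2 e3 e4 c : A) :
  two_step A -> c != 0 -> hyperbolic c [:: (e1, e2); (e3, e4)] ->
  (forall v, exists2 u, u \in <<[:: e1; e2; e3; e4]>>%VS
     & v - u \in annihilator A) ->
  model tab_eta2 4 5 A.
Proof.
move=> two c0 hE cover; have := hE; rewrite /hyperbolic /= !andbT.
move=> /andP[/andP[/eqP e12 /eqP e34] /and4P[/eqP e13 /eqP e14 /eqP e23 /eqP e24]].
have cA : c \in annihilator A by rewrite -e12 two_step_ann.
apply: (@mk_model _ _ _ 4 [:: e1; e2; e3; e4] [:: c]) => //.
- apply: (hyperbolic_ann_free anti c0 hE); last by rewrite seq1_free.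
  by move=> v; rewrite inE => /eqP ->.
- by move=> v; rewrite inE => /eqP ->.
by move=> [|[|[|[|i]]]] [|[|[|[|j]]]] //= ij; try (by exfalso; lia); tprod_simpl.
Qed.

(** With no witness among the first three, an L_x of rank 2 gives T^{2,2}. If every L_x has rank at
    most 1, the product is an alternating form with values in a line, and its rank 0, 2, 4 or at
    least 6 decides. *)
Lemma two_step_classification : two_step A ->
  [\/ forall a b : A, a ∘ b = 0, model tab_eta1 2 3 A, model tab_eta2 4 5 A
    | model tab_T22 3 5 A] \/
  [\/ T222_witness A, eps23_witness A, eps24_witness A | eta3_witness A].
Proof.
move=> two.
have [?|no222] := classic (T222_witness A); first by right; constructor 1.
have [?|no23] := classic (eps23_witness A); first by right; constructor 2.
have [?|no24] := classic (eps24_witness A); first by right; constructor 3.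
have [[x [y [z fr]]]|dep] := classic (exists x y z : A, free [:: x ∘ y; x ∘ z]).
  have /in_span2[p [q yz]] : y ∘ z \in <<[:: x ∘ y; x ∘ z]>>%VS.
    apply: free_cons_notin => //; apply/negP => fr3.
    by apply: no23; exists x, y, z.
  (* Since y z = p x y + q x z, these multiples of [x] make the new y and z orthogonal without
     changing x y and x z. *)
  left; constructor 4; apply: (T22_model two no222 no24
    (x := x) (y := y - q *: x) (z := z + p *: x)).
    by rewrite amulBr amulDr !amulZr anti !scaler0 subr0 addr0.
  rewrite amulBl !amulDr !amulZl !amulZr anti scaler0 scaler0 addr0 yz.
  by rewrite [y ∘ x]amulC // scalerN addrAC addrK subrr.
have {}dep (x y z : A) : ~~ free [:: x ∘ y; x ∘ z].
  by apply/negP => fr; apply: dep; exists x, y, z.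
have [zero|] := classic (forall a b : A, a ∘ b = 0).
  by left; constructor 1.
move=> nz; have [x [y c0]] : exists x y : A, x ∘ y != 0.
  apply: NNPP => none; apply: nz => a b; apply/eqP/negPn/negP => ab.
  by apply: none; exists a, b.
pose c := x ∘ y; have line := rank1_line dep c0 (erefl c).
have h1 : hyperbolic c [:: (x, y)] by rewrite /hyperbolic /= eqxx.
have cover E : hyperbolic c E ->
    (forall v, (forall p, p \in E -> p.1 ∘ v = 0 /\ p.2 ∘ v = 0) ->
      v \in annihilator A) ->
    forall v, exists2 u, u \in <<flatten [seq [:: p.1; p.2] | p <- E]>>%VS
      & v - u \in annihilator A.
  move=> hE perpE v; have [u uE v0] := hyperbolic_split line v hE.
  by exists u => //; apply: perpE.
have [|[p h2]] := hyperbolic_next line h1.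
  by left; constructor 2; apply: (eta1_model two c0 h1); apply: (cover _ h1).
have [|[q h3]] := hyperbolic_next line h2.
  left; constructor 3; case: p h2 => e1 e2 h2 in a *.
  by apply: (eta2_model two c0 h2); apply: (cover _ h2).
by right; constructor 4; exists [:: q; p; (x, y)], c.
Qed.

Lemma classification : engel A ->
  [\/ forall a b : A, a ∘ b = 0, model tab_eta1 2 3 A, model tab_eta2 4 5 A
    | model tab_T22 3 5 A] \/
  [\/ T3_witness A, T222_witness A |
    two_step A /\ [\/ eps23_witness A, eps24_witness A | eta3_witness A]].
Proof.
move=> eng.
have [?|no3] := classic (T3_witness A); first by right; constructor 1.
have sq (a b : A) : a ∘ (a ∘ b) = 0.
  by apply/eqP/negPn/negP => ab; apply: no3; exists a, b.
have [two|ntwo] := classic (two_step A).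
  have [?|[?|?|?|?]] := two_step_classification two; first by left.
  - by right; constructor 2.
  - by right; constructor 3; split=> //; constructor 1.
  - by right; constructor 3; split=> //; constructor 2.
  by right; constructor 3; split=> //; constructor 3.
right; constructor 2.
have [x [y [z xyz]]] : exists x y z : A, x ∘ (y ∘ z) != 0.
  apply: NNPP => none; apply: ntwo => a b d; rewrite amulC //.
  apply/eqP; rewrite oppr_eq0; apply/negPn/negP => n0.
  by apply: none; exists d, a, b.
(* Polarising L_a^2 = 0 shows that a (b d) is alternating in its arguments. *)
have alt (a b d : A) : a ∘ (b ∘ d) = - (b ∘ (a ∘ d)).
  have := sq (a + b) d; rewrite !(amulDl, amulDr) !sq add0r addr0 => /eqP.
  by rewrite addr_eq0 => /eqP.
set u := x ∘ (y ∘ z) in xyz.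
have sqr (a b : A) : a ∘ (b ∘ a) = 0 by rewrite [b ∘ a]amulC // amulNr sq oppr0.
have yxz : y ∘ (x ∘ z) = - u by rewrite alt.
have zxy : z ∘ (x ∘ y) = u.
  by rewrite [x ∘ y]amulC // amulNr alt opprK [z ∘ x]amulC // amulNr yxz opprK.
have yu : y ∘ u = 0 by rewrite alt sq amul0r oppr0.
have zu : z ∘ u = 0 by rewrite alt sqr amul0r oppr0.
(* L_x sends these to x y, x z and u. They are independent because L_z maps x y to u and kills x z
   and u, while L_y maps x z to -u and kills u. *)
exists x, y, z, (y ∘ z); split; last by rewrite !sq.
have fr_u : free [:: u] by rewrite seq1_free.
have fr_ru : free [:: x ∘ y; u].
  apply: (free_ext1 (f := amul A z)) fr_u; first by rewrite /= zxy.
  by move=> v; rewrite inE => /eqP ->.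
have [mu [mu_r mu_u]] := dual_functional fr_ru.
have fr_qu : free [:: x ∘ z; u].
  apply: (free_ext1 (f := amul A y)) fr_u; first by rewrite /= yxz oppr_eq0.
  by move=> v; rewrite inE => /eqP ->.
have fr_rqu : free [:: x ∘ y; x ∘ z; u].
  apply: (free_ext1 (f := amul A z)) fr_qu; first by rewrite /= zxy.
  by move=> v; rewrite !inE => /orP[] /eqP -> /=; rewrite ?sqr.
apply: (free_ext1 (f := (mu : {linear A -> K^o}) \o (amul A y))) fr_rqu.
  by rewrite /= amulC // linearN /= mu_r oppr_eq0 oner_eq0.
move=> v; rewrite !inE => /or3P[] /eqP -> /=; first by rewrite sqr linear0.
  by rewrite yxz linearN /= mu_u oppr0.
by rewrite yu linear0.
Qed.

End Classification.

(** * Closed conditions *)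

Section Dependence.
Variables (K : fieldType) (n : nat).

Lemma not_row_freeP m p (M : 'M[K]_(m, p)) :
  ~~ row_free M <-> exists2 c : 'rV[K]_m, c != 0 & c *m M = 0.
Proof.
rewrite -kermx_eq0; split=> [|[c c0 cM]].
  by case/rowV0Pn => c /sub_kermxP cM c0; exists c.
by apply/rowV0Pn; exists c => //; apply/sub_kermxP.
Qed.

Lemma closure_dependent (S : structure K n -> Prop) m p
    (F : 'I_m -> structure K n -> 'rV[K]_p) mu :
  zariski_closure S mu -> (forall i j, polyfun (fun chi => F i chi 0 j)) ->
  (forall chi, S chi -> exists2 c : 'rV[K]_m, c != 0 &
     \sum_i c 0 i *: F i chi = 0) ->
  exists2 c : 'rV[K]_m, c != 0 & \sum_i c 0 i *: F i mu = 0.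
Proof.
move=> Smu pF S0; pose M chi := \matrix_i F i chi.
have ME chi (c : 'rV[K]_m) : c *m M chi = \sum_i c 0 i *: F i chi.
  by rewrite mulmx_sum_row; apply: eq_bigr => i _; rewrite rowK.
have /not_row_freeP[c c0 cM] : ~~ row_free (M mu).
  apply: (closure_row_free Smu) => [i j|chi /S0[c c0 cF]].
    by apply: polyfun_ext (pF i j) => chi; rewrite mxE.
  by apply/not_row_freeP; exists c; rewrite ?ME.
by exists c; rewrite -?ME.
Qed.

End Dependence.

Section Invariants.
Variable K : fieldType.
Implicit Types A B : algebra K.

(* That the annihilator has codimension at most [r], in terms of dependent
   families, which makes it visibly a closed condition. *)
Definition ann_codim_le (r : nat) A : Prop :=
  forall X : 'I_r.+1 -> A, exists2 c : 'rV[K]_r.+1, c != 0 &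
    \sum_i c 0 i *: X i \in annihilator A.

(** Products span the square, so its dimension is bounded by the rank of families of products. *)
Definition square_dim_le (s : nat) A : Prop :=
  forall X Y : 'I_s.+1 -> A, exists2 c : 'rV[K]_s.+1, c != 0 &
    \sum_i c 0 i *: (X i ∘ Y i) = 0.

(* For l = m this is the Pfaffian of the alternating form l(uv) on the span of
   x, y, z, w. *)
Definition pfaffian A (l m : {scalar A}) (x y z w : A) : K :=
  l (x ∘ y) * m (z ∘ w) - l (x ∘ z) * m (y ∘ w) + l (x ∘ w) * m (y ∘ z).

(** In characteristic 2 the polarised identity does not imply the quadratic one, hence both. *)
Definition pfaffian_zero A : Prop := forall (l m : {scalar A}) x y z w,
  pfaffian l m x y z w + pfaffian m l x y z w = 0 /\ pfaffian l l x y z w = 0.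

(** In characteristic 2 this says that the middle coefficient of the quadratic form vanishes. *)
Definition pfaffian_disc_zero A : Prop := forall (l m : {scalar A}) x y z w,
  (pfaffian l m x y z w + pfaffian m l x y z w) ^+ 2 =
  4%:R * pfaffian l l x y z w * pfaffian m m x y z w.

Lemma polyfun_pfaffian n (l m : {scalar 'cV[K]_n}) x y z w :
  polyfun (fun mu : structure K n => @pfaffian (salg mu) l m x y z w).
Proof.
have P (k : {scalar 'cV[K]_n}) u v :
    polyfun (fun mu : structure K n => k (amul (salg mu) u v)).
  apply: (polyfun_scalar k (F := fun mu : structure K n => amul (salg mu) u v)).
  exact: polyvec_mul (polyvec_const _) (polyvec_const _).
by apply: polyfunD; [apply: polyfunB|]; apply: polyfunM.
Qed.

Lemma pfaffian_iso A B (f : {linear A -> B}) (l m : {scalar B}) x y z w :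
  (forall a b, f (a ∘ b) = f a ∘ f b) ->
  pfaffian l m (f x) (f y) (f z) (f w) =
  pfaffian ((l : {linear B -> K^o}) \o f : {scalar A})
    ((m : {linear B -> K^o}) \o f : {scalar A}) x y z w.
Proof. by move=> fM; rewrite /pfaffian /= !fM. Qed.

Lemma anticomm_degenerates A B : degenerates A B -> anticomm A -> anticomm B.
Proof.
apply: (degenerates_closed (P := @anticomm K)) => [{}A {}B|n S mu Smu anti a].
  case=> f [g fK gK] fM anti b; rewrite -[b]gK -fM anti linear0 //.
apply: (closure_polyvec (F := fun chi : structure K n => amul (salg chi) a a) Smu).
  exact: polyvec_mul (polyvec_const _) (polyvec_const _).
by move=> chi /anti; apply.
Qed.

Lemma engel_degenerates A B : degenerates A B -> engel A -> engel B.
Proof.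
move=> AB [m m0 nil]; exists m => //; clear m0; move: A B AB nil.
apply: (@degenerates_closed _
  (fun A => forall a b : A, iter m (amul A a) b = 0)) => [A B|n S mu Smu nil a b].
  case=> f [g fK gK] fM nil a b; rewrite -[a]gK -[b]gK.
  have -> k : iter k (amul B (f (g a))) (f (g b)) = f (iter k (amul A (g a)) (g b)).
    by elim: k => //= k ->; rewrite fM.
  by rewrite nil linear0.
apply: (closure_polyvec
  (F := fun chi : structure K n => iter m (amul (salg chi) a) b) Smu).
  elim: m {nil} => [|m IHm] /=; first exact: polyvec_const.
  exact: polyvec_mul (polyvec_const _) IHm.
by move=> chi /nil; apply.
Qed.

Lemma two_step_degenerates A B : degenerates A B -> two_step A -> two_step B.
Proof.
apply: (degenerates_closed (P := @two_step K)) => [{}A {}B|n S mu Smu two a b c].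
  case=> f [g fK gK] fM two a b c.
  by rewrite -[a]gK -[b]gK -[c]gK -!fM two linear0.
apply: (closure_polyvec
  (F := fun chi : structure K n => amul (salg chi) (amul (salg chi) a b) c) Smu).
  apply: polyvec_mul (polyvec_const _).
  exact: polyvec_mul (polyvec_const _) (polyvec_const _).
by move=> chi /two; apply.
Qed.

Lemma ann_codim_degenerates r A B :
  degenerates A B -> ann_codim_le r A -> ann_codim_le r B.
Proof.
apply: (degenerates_closed (P := @ann_codim_le r)) => [{}A {}B|n S mu Smu codim X].
  case=> f [g fK gK] fM codim X; have [c c0 cX] := codim (g \o X).
  exists c => //; apply/annP => b; rewrite -[RHS](linear0 f).
  rewrite -(annP _ cX (g b)) fM gK linear_sum; congr (_ ∘ _).
  by apply: eq_bigr => i _; rewrite linearZ /= gK.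
(* The matrix of L_{X i}, with entries polynomial in [chi]: a combination of the [X i] is central
   exactly when the same combination of these matrices is zero. *)
pose M i (chi : structure K n) : 'M[K]_n :=
  \matrix_(j, k) amul (salg chi) (X i) (delta_mx j 0) k 0.
have ME chi (c : 'rV[K]_r.+1) : \sum_i c 0 i *: mxvec (M i chi) = 0 <->
    (\sum_i c 0 i *: X i : salg chi) \in annihilator (salg chi).
  have -> : \sum_i c 0 i *: mxvec (M i chi) = mxvec (\sum_i c 0 i *: M i chi).
    by rewrite linear_sum; apply: eq_bigr => i _; rewrite linearZ.
  have cM j k : (\sum_i c 0 i *: M i chi) j k =
      amul (salg chi) (\sum_i c 0 i *: X i) (delta_mx j 0) k 0.
    rewrite amul_suml !summxE; apply: eq_bigr => i _.
    by rewrite amulZl [LHS]mxE [RHS]mxE; congr (_ * _); rewrite [LHS]mxE.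
  split=> [/eqP|c0].
    rewrite mxvec_eq0 => /eqP /matrixP M0; apply/annP => b.
    rewrite [b](matrix_sum_delta b) amul_sumr big1 // => j _.
    rewrite big_ord1 amulZr; suff -> : amul (salg chi) (\sum_i c 0 i *: X i)
      (delta_mx j 0) = 0 by rewrite scaler0.
    by apply/colP => k; rewrite -cM M0 !mxE.
  apply/eqP; rewrite mxvec_eq0; apply/eqP/matrixP => j k.
  by rewrite cM (annP _ c0) !mxE.
have [||c c0 /ME cX] := closure_dependent (F := fun i chi => mxvec (M i chi)) Smu.
- move=> i j; case/mxvec_indexP: j => j k.
  apply: (polyfun_ext (g := fun chi : structure K n =>
    amul (salg chi) (X i) (delta_mx j 0) k 0)).
    by move=> chi; rewrite mxvecE mxE.
  exact: polyvec_mul (polyvec_const _) (polyvec_const _) _.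
- by move=> chi /codim/(_ X)[c c0 /ME cX]; exists c.
by exists c.
Qed.

Lemma closure_products_dependent n (S : structure K n -> Prop) m
    (X Y : 'I_m -> 'cV[K]_n) mu :
  zariski_closure S mu ->
  (forall chi, S chi -> exists2 c : 'rV[K]_m, c != 0 &
     \sum_i c 0 i *: amul (salg chi) (X i) (Y i) = 0) ->
  exists2 c : 'rV[K]_m, c != 0 &
     \sum_i c 0 i *: amul (salg mu) (X i) (Y i) = 0.
Proof.
move=> Smu dep.
have trE chi (c : 'rV[K]_m) :
    \sum_i c 0 i *: (amul (salg chi) (X i) (Y i))^T =
    (\sum_i c 0 i *: amul (salg chi) (X i) (Y i))^T.
  by rewrite linear_sum; apply: eq_bigr => i _; rewrite linearZ.
have [||c c0] := closure_dependent
  (F := fun i (chi : structure K n) => (amul (salg chi) (X i) (Y i))^T) Smu.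
- move=> i j; apply: (polyfun_ext (g := fun chi : structure K n =>
    amul (salg chi) (X i) (Y i) j 0)); first by move=> chi; rewrite mxE.
  exact: polyvec_mul (polyvec_const _) (polyvec_const _) _.
- by move=> chi /dep[c c0 cX]; exists c; rewrite // trE cX trmx0.
by rewrite trE => /eqP; rewrite trmx_eq0 => /eqP cX; exists c.
Qed.

Lemma square_dim_degenerates s A B :
  degenerates A B -> square_dim_le s A -> square_dim_le s B.
Proof.
apply: (degenerates_closed (P := @square_dim_le s)) => [{}A {}B|n S mu Smu sq X Y].
  case=> f [g fK gK] fM sq X Y; have [c c0 cX] := sq (g \o X) (g \o Y).
  exists c => //; rewrite -[RHS](linear0 f) -cX linear_sum.
  by apply: eq_bigr => i _; rewrite linearZ fM /= !gK.
by apply: (closure_products_dependent Smu) => chi /sq.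
Qed.

(** This contradicts [eps23_witness], in a form that is visibly closed. *)
Definition products_dependent A : Prop := forall x y z : A,
  exists2 c : 'rV[K]_3, c != 0 &
  \sum_i c 0 i *: nth 0 [:: y ∘ z; x ∘ y; x ∘ z] i = 0.

Lemma products_dependent_degenerates A B :
  degenerates A B -> products_dependent A -> products_dependent B.
Proof.
apply: (degenerates_closed (P := products_dependent)) =>
  [{}A {}B|n S mu Smu dep x y z].
  case=> f [g fK gK] fM dep x y z; have [c c0 cX] := dep (g x) (g y) (g z).
  exists c => //; rewrite -[RHS](linear0 f) -cX linear_sum.
  apply: eq_bigr => i _; rewrite linearZ -[x in LHS]gK -[y in LHS]gK -[z in LHS]gK.
  by rewrite -!fM; case: i => -[|[|[|]]].
pose X := nth x [:: y; x; x]; pose Y := nth x [:: z; y; z].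
have XY chi (i : 'I_3) : nth 0 [:: amul (salg chi) y z; amul (salg chi) x y;
    amul (salg chi) x z] i = amul (salg chi) (X i) (Y i).
  by case: i => -[|[|[|]]].
have [|c c0 cX] := @closure_products_dependent _ _ 3
    (fun i => X i) (fun i => Y i) _ Smu.
  move=> chi Schi; have [c c0 cX] := dep _ Schi x y z.
  by exists c => //; rewrite -[RHS]cX; apply: eq_bigr => i _; rewrite XY.
by exists c => //; rewrite -[RHS]cX; apply: eq_bigr => i _; rewrite XY.
Qed.

Lemma pfaffian_zero_degenerates A B :
  degenerates A B -> pfaffian_zero A -> pfaffian_zero B.
Proof.
apply: (degenerates_closed (P := pfaffian_zero)) =>
  [{}A {}B|n S mu Smu pf l m x y z w].
  case=> f [g fK gK] fM pf l m x y z w.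
  by rewrite -[x]gK -[y]gK -[z]gK -[w]gK !pfaffian_iso.
have P := polyfun_pfaffian; split.
  apply: (closure_polyfun (f := fun chi => @pfaffian (salg chi) l m x y z w +
    @pfaffian (salg chi) m l x y z w) Smu); first exact: polyfunD.
  by move=> chi /pf/(_ l m x y z w)[].
apply: (closure_polyfun (f := fun chi => @pfaffian (salg chi) l l x y z w) Smu).
  exact: P.
by move=> chi /pf/(_ l m x y z w)[].
Qed.

Lemma pfaffian_disc_degenerates A B :
  degenerates A B -> pfaffian_disc_zero A -> pfaffian_disc_zero B.
Proof.
apply: (degenerates_closed (P := pfaffian_disc_zero)) =>
  [{}A {}B|n S mu Smu pf l m x y z w].
  case=> f [g fK gK] fM pf l m x y z w.
  by rewrite -[x]gK -[y]gK -[z]gK -[w]gK !pfaffian_iso.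
have P := polyfun_pfaffian; apply/eqP; rewrite -subr_eq0; apply/eqP.
apply: (closure_polyfun (f := fun chi => (@pfaffian (salg chi) l m x y z w +
    @pfaffian (salg chi) m l x y z w) ^+ 2 - 4%:R * @pfaffian (salg chi) l l x y z w
    * @pfaffian (salg chi) m m x y z w) Smu).
  apply: polyfunB; first by apply: polyfunX; apply: polyfunD.
  by apply: polyfunM => //; apply: polyfunM => //; apply: polyfun_const.
by move=> chi /pf ->; rewrite subrr.
Qed.

End Invariants.

Section Bounds.
Variables (K : fieldType) (A : algebra K).

Lemma dependent_nfree (V : vectType K) m (X : seq V) (c : 'rV[K]_m) :
  (m <= size X)%N -> c != 0 -> \sum_i c 0 i *: X`_i = 0 -> ~~ free X.
Proof.
move=> mX c0 cX; apply: contra c0 => X_free; apply/eqP/rowP => i; rewrite mxE.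
have Y_free : free (take m X) by apply: (catl_free (Y := drop m X)); rewrite cat_take_drop.
have sz : size (take m X) == m by rewrite size_takel.
have /(@freeP _ _ _ (Tuple sz))/(_ (c 0)) := Y_free.
apply; rewrite -[RHS]cX.
by apply: eq_bigr => j _; rewrite /= nth_take.
Qed.

Lemma ann_codim_size r (E : seq A) : ann_codim_le r A -> ann_free E -> (size E <= r)%N.
Proof.
move=> codim E_free; rewrite leqNgt; apply/negP => rE.
have [c c0 cE] := codim (fun i => E`_i).
have ZA : {subset vbasis (annihilator A) <= annihilator A}.
  by move=> v; apply: vbasis_mem.
have Z_free := basis_free (vbasisP (annihilator A)).
have := E_free _ ZA Z_free; rewrite cat_free => /and3P[EF _ /directv_addP cap0].
suff cE0 : \sum_i c 0 i *: E`_i = 0.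
  by have := dependent_nfree rE c0 cE0; rewrite EF.
apply/eqP; rewrite -memv0 -cap0 memv_cap (span_basis (vbasisP _)) cE andbT.
apply: memv_suml => i _; rewrite memvZ // memv_span // mem_nth //.
exact: leq_trans (ltn_ord i) rE.
Qed.

Lemma ann_codim_cover r (E : seq A) : ann_codim_le r A -> ann_free E -> size E = r ->
  forall v, exists2 u, u \in <<E>>%VS & v - u \in annihilator A.
Proof.
move=> codim E_free sizeE v; apply: NNPP => none.
have : (size (v :: E) <= r)%N.
  apply: ann_codim_size codim _ => D DA D_free.
  rewrite cat_cons free_cons E_free // andbT; apply/negP.
  rewrite span_cat => /memv_addP[u uE [d dD vE]]; apply: none; exists u => //.
  rewrite vE addrAC subrr add0r; apply: subvP dD; exact/span_subvP.
by rewrite /= sizeE ltnn.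
Qed.

Lemma square_dim_size s (P : seq (A * A)) : square_dim_le s A ->
  free [seq p.1 ∘ p.2 | p <- P] -> (size P <= s)%N.
Proof.
move=> sq P_free; rewrite leqNgt; apply/negP => sP.
have [c c0 cP] := sq (fun i => (nth (0, 0) P i).1) (fun i => (nth (0, 0) P i).2).
suff : ~~ free [seq p.1 ∘ p.2 | p <- P] by rewrite P_free.
apply: (dependent_nfree _ c0); first by rewrite size_map.
rewrite -[RHS]cP; apply: eq_bigr => i _.
by rewrite (nth_map (0, 0)) // (leq_trans (ltn_ord i)).
Qed.

Lemma square_dim_span s (P : seq (A * A)) : square_dim_le s A ->
  free [seq p.1 ∘ p.2 | p <- P] -> size P = s ->
  forall a b : A, a ∘ b \in <<[seq p.1 ∘ p.2 | p <- P]>>%VS.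
Proof.
move=> sq P_free sizeP a b; apply: free_cons_notin => //; apply/negP => fr.
by have := square_dim_size (P := (a, b) :: P) sq fr; rewrite /= sizeP ltnn.
Qed.

End Bounds.

Section ModelInvariants.
Variables (K : fieldType) (A : algebra K) (s : seq (nat * nat * nat)) (r k : nat).
Hypotheses (anti : anticomm A) (s_wf : table_wf s r k).

Lemma model_ann_codim : model s r k A -> ann_codim_le r A.
Proof.
case=> X [sizeX X_free XM cover] Y.
have [d dE] : exists d : 'I_r.+1 -> nat -> K, forall i,
    Y i - \sum_(j < r) d i j *: X`_j \in annihilator A.
  exact: (fin_all_exists (fun i => cover (Y i))).
pose M : 'M[K]_(r.+1, r) := \matrix_(i, j) d i j.
have [c c0 cM] : exists2 c : 'rV[K]_r.+1, c != 0 & c *m M = 0.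
  apply/not_row_freeP; rewrite /row_free neq_ltn.
  by rewrite ltnS (leq_trans (rank_leq_col _)).
exists c => //.
have -> : \sum_i c 0 i *: Y i =
    \sum_i c 0 i *: (Y i - \sum_(j < r) d i j *: X`_j).
  apply/eqP; rewrite -subr_eq0 -sumrB; apply/eqP.
  transitivity (\sum_i \sum_(j < r) (c 0 i * M i j) *: X`_j).
    apply: eq_bigr => i _; rewrite -scalerBr subKr scaler_sumr.
    by apply: eq_bigr => j _; rewrite scalerA mxE.
  rewrite exchange_big big1 // => j _; rewrite -scaler_suml.
  by have /rowP/(_ j) := cM; rewrite !mxE => ->; rewrite scale0r.
by apply: memv_suml => i _; rewrite memvZ.
Qed.

(** Collecting by table entries, each entry contributes a 2 by 2 minor of the two coordinate
    vectors. *)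
Lemma sum_tprod (X : seq A) (c d : nat -> K) :
  \sum_(i < r) \sum_(j < r) (c i * d j) *: tprod s X i j =
  \sum_(t <- s) (c t.1.1.-1 * d t.1.2.-1 - c t.1.2.-1 * d t.1.1.-1)
    *: X`_t.2.-1.
Proof.
transitivity (\sum_(t <- s) \sum_(i < r) \sum_(j < r) (c i * d j *
    ((t.1 == (i.+1, j.+1))%:R - (t.1 == (j.+1, i.+1))%:R)) *: X`_t.2.-1).
  rewrite [RHS]exchange_big; apply: eq_bigr => i _.
  rewrite [RHS]exchange_big; apply: eq_bigr => j _.
  by rewrite scaler_sumr; apply: eq_bigr => t _; rewrite scalerA.
have /and3P[_ _ /allP s_b] := s_wf.
apply: eq_big_seq => -[[t1 t2] t3] /s_b /and3P[/= t1r t2r _].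
rewrite -(eq_bigr _ (fun i _ => scaler_suml _ _ _ _)) -scaler_suml; congr (_ *: _).
have pick (u1 u2 : nat) (F : nat -> nat -> K) : (0 < u1 <= r)%N -> (0 < u2 <= r)%N ->
    \sum_(i < r) \sum_(j < r) F i j * ((u1, u2) == (i.+1, j.+1))%:R =
    F u1.-1 u2.-1.
  move=> u1_r u2_r; have l1 : (u1.-1 < r)%N by lia.
  have l2 : (u2.-1 < r)%N by lia.
  rewrite (bigD1 (Ordinal l1)) //= [X in _ + X]big1 ?addr0; last first.
    move=> i /eqP it; rewrite big1 // => j _; rewrite xpair_eqE.
    have -> : (u1 == i.+1) = false.
      by apply/eqP => tE; apply: it; apply: val_inj; rewrite /= tE.
    by rewrite mulr0.
  rewrite (bigD1 (Ordinal l2)) //= [X in _ + X]big1 ?addr0; last first.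
    move=> i /eqP it; rewrite xpair_eqE.
    have -> : (u2 == i.+1) = false.
      by apply/eqP => tE; apply: it; apply: val_inj; rewrite /= tE.
    by rewrite andbF mulr0.
  by rewrite !prednK ?eqxx ?mulr1 //; [case/andP: u2_r | case/andP: u1_r].
transitivity (\sum_(i < r) \sum_(j < r) c i * d j * ((t1, t2) == (i.+1, j.+1))%:R -
  \sum_(i < r) \sum_(j < r) c i * d j * ((t1, t2) == (j.+1, i.+1))%:R).
  rewrite -sumrB; apply: eq_bigr => i _; rewrite -sumrB.
  by apply: eq_bigr => j _; rewrite mulrBr.
congr (_ - _); first exact: (pick t1 t2 (fun i j => c i * d j)).
by rewrite exchange_big; exact: (pick t1 t2 (fun i j => c j * d i)).
Qed.

Lemma model_square_dim q : size (undup [seq t.2 | t <- s]) = q ->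
  model s r k A -> square_dim_le q A.
Proof.
move=> sizeq [X [sizeX X_free XM cover]] Y Z.
pose T := [seq X`_l.-1 | l <- undup [seq t.2 | t <- s]].
have mulT a b : a ∘ b \in <<T>>%VS.
  have [c aE] := cover a; have [d bE] := cover b.
  rewrite (model_mul anti s_wf XM aE bE) sum_tprod big_seq memv_suml // => t ts.
  rewrite memvZ // memv_span //; apply/mapP; exists t.2 => //.
  by rewrite mem_undup map_f.
pose P : q.+1.-tuple A := mktuple (fun i => Y i ∘ Z i).
have : ~~ free P.
  apply/negP => P_free; have : (\dim <<P>> <= \dim <<T>>)%N.
    apply: dimvS; apply/span_subvP => v /tnthP[i ->].
    by rewrite tnth_mktuple mulT.
  rewrite (eqnP P_free) size_tuple => /leq_trans/(_ (dim_span T)).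
  by rewrite size_map sizeq ltnn.
move=> P_dep; apply: NNPP => none; case/negP: P_dep; apply/freeP => c cP i.
apply/eqP/negPn/negP => ci; apply: none; exists (\row_i c i).
  by apply/eqP => /rowP/(_ i); rewrite !mxE => c0; rewrite c0 eqxx in ci.
by rewrite -[RHS]cP; apply: eq_bigr => j _; rewrite mxE -tnth_nth tnth_mktuple.
Qed.

Lemma model_two_step : all (fun t => r < t.2)%N s -> model s r k A -> two_step A.
Proof.
move=> /allP s_r [X [sizeX X_free XM cover]] a b.
have [c aE] := cover a; have [d bE] := cover b; apply/annP.
rewrite (model_mul anti s_wf XM aE bE) sum_tprod big_seq memv_suml // => t ts.
rewrite memvZ //; apply: (model_ann anti s_wf XM cover).
have /and3P[_ _ /allP/(_ t ts)] := s_wf; have := s_r t ts.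
by case: t {ts} => -[t1 t2] t3 /=; lia.
Qed.

End ModelInvariants.

Lemma scalar_entry (K : fieldType) (V : vectType K) (x : {scalar V}) :
  (forall u v, x (u + v) = x u + x v) * (forall c u, x (c *: u) = c * x u) *
  (forall u, x (- u) = - x u) * (x 0 = 0).
Proof.
by split; [split; [split|]|] => [u v|c u|u|];
  rewrite (linearD, linearZ, linearN, linear0).
Qed.

(** Turns an identity of vectors into identities in the field, where [ring] applies. *)
Lemma coord_inj (K : fieldType) (V : vectType K) (u v : V) :
  (forall x : {scalar V}, x u = x v) -> u = v.
Proof.
move=> xuv; rewrite (coord_vbasis (memvf u)) (coord_vbasis (memvf v)).
by apply: eq_bigr => i _; rewrite (xuv (coord (vbasis fullv) i)).
Qed.

Ltac vector_ring := apply: coord_inj => ?; rewrite ?scalar_entry; ring.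

Section Pfaffians.
Variables (K : fieldType) (A : algebra K).
Hypothesis anti : anticomm A.

Lemma model_mulE s r k : table_wf s r k -> model s r k A ->
  exists X : seq A, exists rep : A -> (nat -> K) -> Prop,
    (forall v, exists c, rep v c) /\
    forall v w c d, rep v c -> rep w d -> v ∘ w =
      \sum_(t <- s) (c t.1.1.-1 * d t.1.2.-1 - c t.1.2.-1 * d t.1.1.-1)
        *: X`_t.2.-1.
Proof.
move=> s_wf [X [sizeX X_free XM cover]]; exists X.
exists (fun v c => v - \sum_(i < r) c i *: X`_i \in annihilator A).
split=> // v w c d vE wE.
by rewrite (model_mul anti s_wf XM vE wE) (sum_tprod s_wf).
Qed.

(** Every form l(uv) is the wedge of the first coordinate with another linear form, so the wedge of
    any two of them is zero. *)
Lemma T222_pfaffian : model tab_T222 4 7 A -> pfaffian_zero A.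
Proof.
move=> /(@model_mulE tab_T222 4 7 isT)[X [rep [cover mulE]]] l m x y z w.
have [a xE] := cover x; have [b yE] := cover y.
have [c zE] := cover z; have [d wE] := cover w.
rewrite /pfaffian (mulE _ _ _ _ xE yE) (mulE _ _ _ _ xE zE) (mulE _ _ _ _ xE wE)
  (mulE _ _ _ _ yE zE) (mulE _ _ _ _ yE wE) (mulE _ _ _ _ zE wE).
rewrite !big_cons !big_nil /= !addr0 !linearD !linearZ /=.
by split; ring.
Qed.

Lemma T222_products_dependent : model tab_T222 4 7 A -> products_dependent A.
Proof.
move=> /(@model_mulE tab_T222 4 7 isT)[X [rep [cover mulE]]] x y z.
have [a xE] := cover x; have [b yE] := cover y; have [c zE] := cover z.
(* With first coordinates a, b, c of x, y, z one has a (y z) + c (x y) - b (x z) = 0. If all three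
   vanish this relation is trivial, but then y z = 0. *)
have [abc0|abc] := eqVneq (\row_(i < 3) nth 0 [:: a 0%N; c 0%N; - b 0%N] i) 0.
  exists (\row_(i < 3) (i == 0)%:R).
    by apply/eqP => /rowP/(_ 0); rewrite !mxE eqxx => /eqP; rewrite oner_eq0.
  have b0 : b 0%N = 0.
    have /rowP/(_ (Ordinal (isT : 2 < 3)%N)) := abc0.
    by rewrite !mxE /= => /eqP; rewrite oppr_eq0 => /eqP.
  have c0 : c 0%N = 0.
    by have /rowP/(_ (Ordinal (isT : 1 < 3)%N)) := abc0; rewrite !mxE.
  rewrite !big_ord_recl big_ord0 !mxE /= (mulE _ _ _ _ yE zE).
  rewrite !big_cons !big_nil /= b0 c0.
  by vector_ring.
exists (\row_(i < 3) nth 0 [:: a 0%N; c 0%N; - b 0%N] i) => //.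
rewrite !big_ord_recl big_ord0 !mxE /= (mulE _ _ _ _ xE yE) (mulE _ _ _ _ xE zE)
  (mulE _ _ _ _ yE zE).
by rewrite !big_cons !big_nil /=; vector_ring.
Qed.

(** The form of e_5 is the wedge of the first two coordinates; its wedge with itself and with the
    form [om] of e_6 is zero. So the Pfaffian on the pencil is the square of the e_6 coefficient
    times the Pfaffian [delta] of [om]. *)
Lemma eps24_disc : model tab_eps24 4 6 A -> pfaffian_disc_zero A.
Proof.
move=> /(@model_mulE tab_eps24 4 6 isT)[X [rep [cover mulE]]] l m x y z w.
have [a xE] := cover x; have [b yE] := cover y.
have [c zE] := cover z; have [d wE] := cover w.
pose om (u v : nat -> K) := (u 0%N * v 2%N - u 2%N * v 0%N) +
  (u 1%N * v 3%N - u 3%N * v 1%N).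
pose delta := om a b * om c d - om a c * om b d + om a d * om b c.
have pfE (k k' : {scalar A}) : pfaffian k k' x y z w + pfaffian k' k x y z w =
    2%:R * (k X`_5 * k' X`_5 * delta).
  rewrite /pfaffian (mulE _ _ _ _ xE yE) (mulE _ _ _ _ xE zE) (mulE _ _ _ _ xE wE)
    (mulE _ _ _ _ yE zE) (mulE _ _ _ _ yE wE) (mulE _ _ _ _ zE wE).
  rewrite !big_cons !big_nil /= !addr0 !linearD !linearZ /= /delta /om.
  by ring.
have pfE2 (k : {scalar A}) : pfaffian k k x y z w = k X`_5 * k X`_5 * delta.
  rewrite /pfaffian (mulE _ _ _ _ xE yE) (mulE _ _ _ _ xE zE) (mulE _ _ _ _ xE wE)
    (mulE _ _ _ _ yE zE) (mulE _ _ _ _ yE wE) (mulE _ _ _ _ zE wE).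
  rewrite !big_cons !big_nil /= !addr0 !linearD !linearZ /= /delta /om.
  by ring.
rewrite pfE !pfE2; ring.
Qed.

End Pfaffians.

(** * Normal forms *)

Section NormalForms.
Variables (K : closedFieldType) (A : algebra K).
Hypothesis anti : anticomm A.

Lemma in_span3 (v a b c : A) : v \in <<[:: a; b; c]>>%VS ->
  exists k l m, v = k *: a + l *: b + m *: c.
Proof.
rewrite span_cons => /memv_addP[u /vlineP[k ->] [w /in_span2[l [m ->]] ->]].
by exists k, l, m; rewrite addrA.
Qed.

Lemma ann_free_perm (E E' : seq A) : perm_eq E E' -> ann_free E -> ann_free E'.
Proof.
move=> EE' fE D DA D_free; have := fE D DA D_free.
by rewrite (perm_free (Y := E' ++ D)) // perm_cat2r.
Qed.

Lemma ann_codim_model s r k (E F : seq A) :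
  table_wf s r k -> size (E ++ F) = k -> size E = r -> ann_codim_le r A ->
  ann_free E -> free F -> {subset F <= annihilator A} ->
  (forall i j, (i < j < r)%N ->
     (E ++ F)`_i ∘ (E ++ F)`_j = tprod s (E ++ F) i j) ->
  model s r k A.
Proof.
move=> s_wf kE sizeE codim E_free F_free F_ann EM.
rewrite -{}kE in s_wf *.
apply: mk_model => //; first exact: E_free.
exact: ann_codim_cover codim E_free sizeE.
Qed.

Lemma eta3_model : two_step A -> ann_codim_le 6 A -> eta3_witness A ->
  model tab_eta3 6 7 A.
Proof.
move=> two codim [E [c [sizeE hE c0]]].
case: E sizeE hE => [|[e1 e2] [|[e3 e4] [|[e5 e6] [|]]]] // _ hE.
have := hE; rewrite /hyperbolic /= !andbT.
move=> /andP[/and3P[/eqP e12 /eqP e34 /eqP e56]].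
move=> /andP[/andP[/and4P[/eqP e13 /eqP e14 /eqP e23 /eqP e24]
  /and4P[/eqP e15 /eqP e16 /eqP e25 /eqP e26]]
  /and4P[/eqP e35 /eqP e36 /eqP e45 /eqP e46]].
apply: (@ann_codim_model _ _ _ [:: e1; e2; e3; e4; e5; e6] [:: c]) => //.
- exact: (hyperbolic_ann_free anti c0 hE).
- by rewrite seq1_free.
- by move=> v; rewrite inE => /eqP ->; rewrite -e12 two_step_ann.
by move=> [|[|[|[|[|[|i]]]]]] [|[|[|[|[|[|j]]]]]] //= ij; try (by exfalso; lia);
  tprod_simpl.
Qed.

Lemma eps23_model : two_step A -> ann_codim_le 3 A -> eps23_witness A ->
  model tab_eps23 3 6 A.
Proof.
move=> two codim [x [y [z fr]]].
apply: (@ann_codim_model _ _ _ [:: x; y; z] [:: y ∘ z; x ∘ y; x ∘ z]) => //.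
- apply: ann_free_block => //; by have := fr; rewrite free_cons => /andP[].
- by move=> v; rewrite !inE => /or3P[] /eqP ->; apply: two_step_ann.
by move=> [|[|[|i]]] [|[|[|j]]] //= ij; try (by exfalso; lia); tprod_simpl.
Qed.

Lemma T3_model : engel A -> ann_codim_le 3 A -> square_dim_le 2 A ->
  T3_witness A -> model tab_T3 3 4 A.
Proof.
move=> eng codim sq [a [b0 /(T3_chain eng)[b n0 a0]]].
set e3 := a ∘ b in n0 a0; set e4 := a ∘ e3 in n0 a0.
have fr34 : free [:: e3; e4].
  apply: (free_ext1 (f := amul A a)) => // [v|]; last by rewrite seq1_free.
  by rewrite inE => /eqP ->.
have E_free : ann_free [:: a; b; e3] by apply: ann_free_block.
have mul34 (u v : A) : exists p q, u ∘ v = p *: e3 + q *: e4.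
  by apply: in_span2; apply: (square_dim_span (P := [:: (a, b); (a, e3)]) sq).
(* Modulo the annihilator, e4 = k a + l b + m e3. Multiplying by a gives l = m = 0, and then e3 e4 =
   -k e4, so k = 0 by the Engel condition. *)
have e4A : e4 \in annihilator A.
  have [u /in_span3[k [l [m uE]]] e4u] := ann_codim_cover codim E_free erefl e4.
  have := ann_mulr anti e4u a; rewrite amulBr a0 uE !amulDr !amulZr anti.
  rewrite scaler0 !add0r => /eqP; rewrite oppr_eq0 => /eqP.
  move=> /(free2_coef fr34)[l0 m0].
  move: e4u; rewrite uE l0 m0 !scale0r !addr0 => e4u.
  have e34 : e3 ∘ e4 = (- k) *: e4.
    have := ann_mulr anti e4u e3; rewrite amulBr amulZr => /eqP.
    by rewrite subr_eq0 => /eqP ->; rewrite [e3 ∘ a]amulC // scalerN scaleNr.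
  have /eqP := engel_eigen eng e34 n0; rewrite oppr_eq0 => /eqP k0.
  by move: e4u; rewrite k0 scale0r subr0.
have [p [q be3]] := mul34 b e3.
(* Otherwise e3 + (q/p) e4 is an eigenvector of L_b with eigenvalue p. The term q e4 is removed
   afterwards by passing from b to b - q a. *)
have p0 : p = 0.
  apply/eqP/negPn/negP => pn0.
  have vE : b ∘ (e3 + (q / p) *: e4) = p *: (e3 + (q / p) *: e4).
    rewrite amulDr amulZr (ann_mulr anti e4A) scaler0 addr0 be3 scalerDr scalerA.
    by rewrite mulrCA mulfV // mulr1.
  have vn0 : e3 + (q / p) *: e4 != 0.
    rewrite -[e3]scale1r; apply/eqP => /(free2_coef fr34)[/eqP].
    by rewrite oner_eq0.
  by have /eqP := engel_eigen eng vE vn0; rewrite (negPf pn0).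
have ab' : a ∘ (b - q *: a) = e3 by rewrite amulBr amulZr anti scaler0 subr0.
apply: (@ann_codim_model _ _ _ [:: a; b - q *: a; e3] [:: e4]) => //.
- by apply: ann_free_block => //=; rewrite ab'.
- by rewrite seq1_free.
- by move=> v; rewrite inE => /eqP ->.
move=> [|[|[|i]]] [|[|[|j]]] //= ij; try (by exfalso; lia); tprod_simpl => //.
by rewrite amulBl amulZl be3 p0 scale0r add0r subrr.
Qed.

Lemma dual_functionals3 (f1 f2 f3 : A) : free [:: f1; f2; f3] ->
  exists l1 l2 l3 : {scalar A},
  [/\ [/\ l1 f1 = 1, l1 f2 = 0 & l1 f3 = 0], [/\ l2 f1 = 0, l2 f2 = 1 & l2 f3 = 0]
    & [/\ l3 f1 = 0, l3 f2 = 0 & l3 f3 = 1]].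
Proof.
move=> fr; pose l (i : 'I_3) : {scalar A} := coord (in_tuple [:: f1; f2; f3]) i.
pose i1 := Ordinal (isT : 0 < 3)%N; pose i2 := Ordinal (isT : 1 < 3)%N.
pose i3 := Ordinal (isT : 2 < 3)%N; exists (l i1), (l i2), (l i3).
have lE (i j : 'I_3) := coord_free (X := in_tuple [:: f1; f2; f3]) j i fr.
by split; split; [apply: (lE i1 i1) | apply: (lE i1 i2) | apply: (lE i1 i3)
  | apply: (lE i2 i1) | apply: (lE i2 i2) | apply: (lE i2 i3)
  | apply: (lE i3 i1) | apply: (lE i3 i2) | apply: (lE i3 i3)].
Qed.

(** Polarising against the functionals dual to the f_i = x y_i expresses all y_i y_j through the f_i
    with only three constants a, b, c. These disappear when multiples of [x] are added to the
    y_i. *)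
Lemma T222_model : two_step A -> ann_codim_le 4 A -> pfaffian_zero A ->
  T222_witness A -> model tab_T222 4 7 A.
Proof.
move=> two codim pf [x [y1 [y2 [y3 [fr _]]]]].
have {}fr : free [:: x ∘ y1; x ∘ y2; x ∘ y3].
  by move: fr; rewrite free_cons => /andP[].
have [l1 [l2 [l3 [[l11 l12 l13] [l21 l22 l23] [l31 l32 l33]]]]] :=
  dual_functionals3 fr.
have polar (l m : {scalar A}) : l (x ∘ y1) * m (y2 ∘ y3) - l (x ∘ y2) * m (y1 ∘ y3) +
    l (x ∘ y3) * m (y1 ∘ y2) + (m (x ∘ y1) * l (y2 ∘ y3) -
    m (x ∘ y2) * l (y1 ∘ y3) + m (x ∘ y3) * l (y1 ∘ y2)) = 0.
  by have [] := pf l m x y1 y2 y3.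
have pff (l : {scalar A}) : l (x ∘ y1) * l (y2 ∘ y3) - l (x ∘ y2) * l (y1 ∘ y3) +
    l (x ∘ y3) * l (y1 ∘ y2) = 0.
  by have [] := pf l l x y1 y2 y3.
set f1 := x ∘ y1 in fr l11 l21 l31 polar pff.
set f2 := x ∘ y2 in fr l12 l22 l32 polar pff.
set f3 := x ∘ y3 in fr l13 l23 l33 polar pff.
have l1s : l1 (y2 ∘ y3) = 0.
  by have := pff l1; rewrite l11 l12 l13 !mul0r mul1r subr0 addr0.
have l2q : l2 (y1 ∘ y3) = 0.
  have := pff l2; rewrite l21 l22 l23 !mul0r mul1r sub0r addr0 => /eqP.
  by rewrite oppr_eq0 => /eqP.
have l3p : l3 (y1 ∘ y2) = 0.
  by have := pff l3; rewrite l31 l32 l33 !mul0r mul1r subr0 add0r.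
pose a := l1 (y1 ∘ y3); pose b := l1 (y1 ∘ y2); pose c := l2 (y1 ∘ y2).
have sE : y2 ∘ y3 = a *: f2 - b *: f3.
  apply: coord_inj => m; rewrite !scalar_entry; apply/eqP; rewrite -subr_eq0.
  by have := polar l1 m; rewrite l11 l12 l13 l1s => <-; apply/eqP; rewrite /a /b; ring.
have qE : y1 ∘ y3 = a *: f1 + c *: f3.
  have l2s : l2 (y2 ∘ y3) = a by rewrite sE !scalar_entry l22 l23; ring.
  apply: coord_inj => m; rewrite !scalar_entry; apply/eqP; rewrite -subr_eq0 -oppr_eq0.
  have := polar l2 m; rewrite l21 l22 l23 l2q l2s => <-; apply/eqP.
  by rewrite /c; ring.
have pE : y1 ∘ y2 = b *: f1 + c *: f2.
  have l3s : l3 (y2 ∘ y3) = - b by rewrite sE !scalar_entry l32 l33; ring.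
  have l3q : l3 (y1 ∘ y3) = c by rewrite qE !scalar_entry l31 l33; ring.
  apply: coord_inj => m; rewrite !scalar_entry; apply/eqP; rewrite -subr_eq0.
  have := polar l3 m; rewrite l31 l32 l33 l3p l3s l3q => <-; apply/eqP.
  by ring.
have shift (y : A) t : x ∘ (y + t *: x) = x ∘ y.
  by rewrite amulDr amulZr anti scaler0 addr0.
have mulyy (y z : A) t u : (y + t *: x) ∘ (z + u *: x) =
    y ∘ z - u *: (x ∘ y) + t *: (x ∘ z).
  rewrite amulDl !amulDr !amulZl !amulZr anti !scaler0 addr0.
  by rewrite [y ∘ x]amulC // scalerN.
apply: (@ann_codim_model _ _ _
  [:: x; y1 + (- c) *: x; y2 + b *: x; y3 + a *: x] [:: f1; f2; f3]) => //.
- by apply: ann_free_block => //=; rewrite !shift.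
- by move=> v; rewrite !inE => /or3P[] /eqP ->; apply: two_step_ann.
move=> [|[|[|[|i]]]] [|[|[|[|j]]]] //= ij; try (by exfalso; lia); tprod_simpl;
  rewrite ?shift // mulyy -/f1 -/f2 -/f3 ?pE ?qE ?sE; vector_ring.
Qed.

Lemma eps24_model : two_step A -> ann_codim_le 4 A -> square_dim_le 2 A ->
  pfaffian_disc_zero A -> eps24_witness A -> model tab_eps24 4 6 A.
Proof.
move=> two codim sq disc [e1 [e2 [e3 [e4 [mu wit]]]]].
have [f0 mu12 [mu13 mu24 mu14 mu23]] := wit.
have fr : free [:: e1 ∘ e2; e1 ∘ e3].
  rewrite free2C; apply: (free_ext1 (f := mu : {linear A -> K^o})).
  - by rewrite mu13 oner_eq0.
  - by move=> v; rewrite inE => /eqP ->.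
  by rewrite seq1_free.
have [la [la12 la13]] := dual_functional fr.
pose pf (k k' : {scalar A}) := pfaffian k k' e1 e2 e3 e4.
have pf_mu : pf mu mu = - 1.
  by rewrite /pf /pfaffian mu12 mu13 mu24 mu14; ring.
(* The discriminant condition makes the root [c] double. *)
have [c cE] := @solve_monicpoly K 2
  (nth 0 [:: pf la la; pf la mu + pf mu la]) isT.
rewrite !big_ord_recl big_ord0 /= expr0 mulr1 addr0 expr1 in cE.
pose l0f (v : A) := la v + c * mu v.
have l0_scalar : scalar l0f by move=> k u v; rewrite /l0f !scalar_entry; ring.
pose l0 : {scalar A} := HB.pack l0f (GRing.isLinear.Build _ _ _ _ l0f l0_scalar).
have l0E v : l0 v = la v + c * mu v by [].
have pf_l0 : pf l0 l0 = 0.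
  transitivity (pf la la + (pf la mu + pf mu la) * c + c ^+ 2 * pf mu mu).
    by rewrite /pf /pfaffian !l0E; ring.
  by rewrite pf_mu cE; ring.
have polar0 : pf l0 mu + pf mu l0 = 0.
  have /eqP := disc l0 mu e1 e2 e3 e4; rewrite -![pfaffian _ _ _ _ _ _]/(pf _ _).
  by rewrite pf_l0 mulr0 mul0r expf_eq0 => /eqP.
have l12 : l0 (e1 ∘ e2) = 1 by rewrite l0E la12 mu12 mulr0 addr0.
have in_sq u v : u ∘ v \in <<[:: e1 ∘ e2; e1 ∘ e3]>>%VS.
  exact: (square_dim_span (P := [:: (e1, e2); (e1, e3)]) sq fr erefl).
have span0 v : v \in <<[:: e1 ∘ e2; e1 ∘ e3]>>%VS -> l0 v = 0 -> mu v = 0 -> v = 0.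
  move=> /in_span2[p [q ->]].
  rewrite !scalar_entry l12 mu12 mu13 mulr0 add0r !mulr1 => l0uv q0.
  by move: l0uv; rewrite q0 mul0r addr0 => ->; rewrite !scale0r addr0.
have l0_mu_eq0 u v : l0 (u ∘ v) = 0 -> mu (u ∘ v) = 0 -> u ∘ v = 0.
  by apply: span0.
(* As l0 (e1 e2) = 1, these corrections make [l0] vanish on the products of e1 and e2 with e3' and
   e4'; as mu (e1 e2) = 0, the values of [mu] there do not change. On the square, [l0] and [mu] are
   coordinates. *)
pose e3' := e3 + l0 (e2 ∘ e3) *: e1 - l0 (e1 ∘ e3) *: e2.
pose e4' := e4 + l0 (e2 ∘ e4) *: e1 - l0 (e1 ∘ e4) *: e2.
have e21 : e2 ∘ e1 = - (e1 ∘ e2) by rewrite amulC.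
have mul1 v p q : e1 ∘ (v + p *: e1 - q *: e2) = e1 ∘ v - q *: (e1 ∘ e2).
  by rewrite amulBr amulDr !amulZr anti scaler0 addr0.
have mul2 v p q : e2 ∘ (v + p *: e1 - q *: e2) = e2 ∘ v - p *: (e1 ∘ e2).
  by rewrite amulBr amulDr !amulZr anti e21 scalerN scaler0 subr0.
have wit' : eps24_pencil e1 e2 e3' e4' mu.
  by split=> //; rewrite !mul1 !mul2 !scalar_entry mu12 mu13 mu24 mu14 mu23; split; ring.
have e14' : e1 ∘ e4' = 0.
  apply: l0_mu_eq0; last by have [_ _ []] := wit'.
  by rewrite mul1 !scalar_entry l12; ring.
have e23' : e2 ∘ e3' = 0.
  apply: l0_mu_eq0; last by have [_ _ []] := wit'.
  by rewrite mul2 !scalar_entry l12; ring.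
have l24' : l0 (e2 ∘ e4') = 0 by rewrite mul2 !scalar_entry l12; ring.
have [_ _ [mu13' mu24' _ _]] := wit'.
have e24' : e2 ∘ e4' = e1 ∘ e3'.
  apply/eqP; rewrite -subr_eq0; apply/eqP; apply: span0.
  - by rewrite memvB ?in_sq.
  - by rewrite scalar_entry scalar_entry l24' mul1 !scalar_entry l12; ring.
  by rewrite scalar_entry scalar_entry mu24' mu13' subrr.
have e34 (k : {scalar A}) : k (e3' ∘ e4') = k (e3 ∘ e4) -
    l0 (e2 ∘ e4) * k (e1 ∘ e3) + l0 (e1 ∘ e4) * k (e2 ∘ e3) -
    l0 (e1 ∘ e3) * k (e2 ∘ e4').
  rewrite {1}/e3' amulBl amulDl !amulZl e14' scaler0 addr0 /e4' amulBr amulDr.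
  rewrite !amulZr [e3 ∘ e1]amulC // [e3 ∘ e2]amulC // -/e4' !scalar_entry.
  by ring.
(* The values of [l0] and [mu] on e3' e4' are the Pfaffian of [l0] and its polarisation with [mu],
   both zero. *)
have e34' : e3' ∘ e4' = 0.
  apply: l0_mu_eq0; rewrite e34.
    rewrite l24'; transitivity (pf l0 l0) => //.
    by rewrite /pf /pfaffian l12; ring.
  rewrite mu24' mu13 mu23; transitivity (pf l0 mu + pf mu l0) => //.
  by rewrite /pf /pfaffian l12 mu12 mu13 mu14 mu23 mu24; ring.
apply: (@ann_codim_model _ _ _ [:: e1; e2; e3'; e4'] [:: e1 ∘ e2; e1 ∘ e3']) => //.
- apply: ann_free_perm (eps24_ann_free anti wit').
  by apply/permP => p /=; ring.
- rewrite free2C; apply: (free_ext1 (f := mu : {linear A -> K^o})).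
  + by have [_ _ [-> _ _ _]] := wit'; rewrite oner_eq0.
  + by move=> v; rewrite inE => /eqP ->.
  by rewrite seq1_free.
- by move=> v; rewrite !inE => /orP[] /eqP ->; apply: two_step_ann.
by move=> [|[|[|[|i]]]] [|[|[|[|j]]]] //= ij; try (by exfalso; lia); tprod_simpl.
Qed.

End NormalForms.

(** * Degenerations among the algebras of low level *)

Section Degenerations.
Variables (K : closedFieldType) (A : algebra K).
Hypotheses (anti : anticomm A) (eng : engel A).

Lemma zero_model : (forall a b : A, a ∘ b = 0) -> model [::] 0 0 A.
Proof.
move=> zero; exists [::]; split=> //; first exact: nil_free.
by move=> v; exists (fun _ => 0); apply/annP => w; rewrite zero.
Qed.

(** All basis vectors have weight 1, so every product has weight 2 and vanishes in the limit. *)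
Lemma zero_degeneration : degenerates A (anticomm_table K (dim A) [::]).
Proof.
apply: (@table_degeneration _ _ _ 0 [::] (vbasis fullv) (fun _ => 1%N)) => //.
- exact: vbasisP.
- by move=> i j; rewrite ltn0 andbF.
move=> i j i_n /andP[_ j_n]; rewrite cat0s in i_n j_n *.
apply: (subvP _ _ (memvf _)); rewrite -{1}(span_basis (vbasisP fullv)).
apply/span_subvP => v /(nthP 0)[l ln <-]; exact: mem_below.
Qed.

Lemma two_step_eta1 (x y : A) : two_step A -> x ∘ y != 0 ->
  degenerates A (anticomm_table K (dim A) tab_eta1).
Proof.
move=> two xy; apply: (eta1_degeneration anti eng (x := x) (y := y)).
  apply: (free_ext1 (f := amul A y)) => [|v|].
  - by rewrite /= amulC // oppr_eq0.
  - by rewrite inE => /eqP ->; rewrite /= two_step_r.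
  by rewrite seq1_free.
by rewrite two_step_r.
Qed.

Lemma two_step_T22 (x y z : A) : two_step A -> free [:: x ∘ y; x ∘ z] ->
  degenerates A (anticomm_table K (dim A) tab_T22).
Proof.
move=> two fr; have [xy _] := free2_neq0 fr.
apply: (T22_degeneration anti eng (x := x) (y := y) (z := z)).
- apply: (free_ext1 (f := amul A y)) => // [|v].
    by rewrite /= amulC // oppr_eq0.
  by rewrite !inE => /orP[] /eqP ->; rewrite /= two_step_r.
- by rewrite two_step_r.
by rewrite two_step_r.
Qed.

(* Replacing e3 by e3 + e5, for a central e5 outside of A^2, splits the Jordan
   block of size 3 of the action of e1 into two blocks of size 2 in the limit. *)
Lemma T3_T22_degeneration : model tab_T3 3 4 A -> (5 <= dim A)%N ->
  degenerates A (anticomm_table K (dim A) tab_T22).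
Proof.
case=> X [sizeX X_free XM cover] dimA.
have X_ann := model_ann anti (isT : table_wf tab_T3 3 4) XM cover.
case: X sizeX X_free XM cover X_ann => [|a [|e2 [|e3 [|e4 [|]]]]] // _.
move=> X_free XM cover X_ann.
have e4A : e4 \in annihilator A := X_ann 3%N isT.
have ae2 : a ∘ e2 = e3 by have := XM 0%N 1%N isT isT; tprod_simpl.
have ae3 : a ∘ e3 = e4 by have := XM 0%N 2%N isT isT; tprod_simpl.
have e23 : e2 ∘ e3 = 0 by have := XM 1%N 2%N isT isT; tprod_simpl.
have fr34 : free [:: e3; e4] by have := catr_free (X := [:: a; e2]) X_free.
have [_ e40] := free2_neq0 fr34.
have E_free : ann_free [:: a; e2; e3].
  by apply: (ann_free_block anti) => //=; rewrite ae2 ae3.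
have [||D [D_free DE DA]] := @complete_basis _ _ (annihilator A) [:: e4].
- by rewrite seq1_free.
- by move=> v; rewrite inE => /eqP ->.
have full : (<<[:: a; e2; e3]>> + annihilator A)%VS = fullv.
  apply/eqP; rewrite eqEsubv subvf /=; apply/subvP => v _; have [c vc] := cover v.
  rewrite -[v](subrK (\sum_(i < 3) c i *: [:: a; e2; e3; e4]`_i)) addrC memv_add //.
  apply: memv_suml => i _; rewrite memvZ // memv_span // !inE.
  by case: i => -[|[|[|]]] //= _; rewrite eqxx ?orbT.
case: D D_free DE DA => [|e5 D] D_free DE DA.
  have := dimv_leqif_eq (subvv (fullv : {vspace A})).
  have : (\dim (<<[:: a; e2; e3]>> + annihilator A) <= 4)%N.
    by rewrite -DE -span_cat (leq_trans (dim_span _)).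
  by rewrite full dimvf leqNgt dimA.
have e5A : e5 \in annihilator A by apply: DA; rewrite mem_head.
have DA' v : v \in D -> v \in annihilator A by move=> vD; apply: DA; rewrite in_cons vD orbT.
have old_free : free ([:: a; e2; e3] ++ [:: e4, e5 & D]).
  apply: E_free D_free => v; rewrite !inE => /or3P[/eqP ->|/eqP ->|/DA'] //.
have old_span : <<[:: a; e2; e3] ++ [:: e4, e5 & D]>>%VS = fullv.
  by rewrite span_cat -full -DE.
pose X := [:: a; e2; e3 + e5; e3; e4].
have bb : basis_of fullv (X ++ D).
  rewrite basisEdim; apply/andP; split; last first.
    by rewrite -old_span (eqnP old_free).
  rewrite -old_span; apply/span_subvP => v.
  have mem u : u \in X ++ D -> u \in <<X ++ D>>%VS by apply: memv_span.
  rewrite !inE => /or4P[/eqP ->|/eqP ->|/eqP ->|/or3P[/eqP ->|/eqP ->|vD]];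
    try by apply: mem; rewrite !inE eqxx ?orbT.
    rewrite -[e5](addrK e3) [e5 + e3]addrC.
    by rewrite memvB //; apply: mem; rewrite !inE eqxx ?orbT.
  by apply: mem; rewrite mem_cat vD orbT.
(* Both a e2 = e3 and a (e3 + e5) = e4 are homogeneous for these weights, whereas a e3 = e4 drops
   from weight 1 to 0 and vanishes in the limit. *)
apply: (@table_degeneration _ _ _ 3 X D (nth 0%N [:: 0; 1; 0; 1; 0]%N)) => //.
  have ann0 u v : v \in annihilator A -> u ∘ v = 0 by move/(ann_mulr anti).
  move=> [|[|[|[|i]]]] [|[|[|[|[|j]]]]] //= ij; try (by exfalso; lia); tprod_simpl.
  all: rewrite ?amulDr ?amulDl ?(ann0 _ _ e4A) ?(ann0 _ _ e5A) ?(annP _ e5A)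
    ?ae2 ?ae3 ?e23 ?anti ?(addr0, add0r, subr0, subrr) ?mem0v //.
  by rewrite /below /=; apply: memv_span; rewrite !inE eqxx ?orbT.
move=> i j i_n /andP[kj jn].
have -> : (X ++ D)`_j = D`_(j - size X) by rewrite nth_cat ltnNge kj.
have [lt_j|le_j] := ltnP (j - size X) (size D); last first.
  by rewrite (nth_default _ le_j) amul0r mem0v.
by rewrite (ann_mulr anti) ?mem0v // DA' ?mem_nth.
Qed.

End Degenerations.

(** * Levels *)

Section Obstructions.
Variables (K : closedFieldType) (A : algebra K).
Hypothesis anti : anticomm A.

Lemma two_step_not_T3 : two_step A -> ~ T3_witness A.
Proof. by move=> two [a [b /eqP]]; rewrite two_step_r. Qed.

Lemma T22_bounds (x y z : A) : free [:: x ∘ y; x ∘ z] ->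
  (forall r, ann_codim_le r A -> 2 < r)%N /\ (forall s, square_dim_le s A -> 1 < s)%N.
Proof.
move=> fr; split=> n => [codim|sq].
  by apply: (ann_codim_size (E := [:: x; y; z]) codim); apply: ann_free_block.
exact: (square_dim_size (P := [:: (x, y); (x, z)]) sq).
Qed.

Lemma T222_bounds : T222_witness A ->
  (forall r, ann_codim_le r A -> 3 < r)%N /\ (forall s, square_dim_le s A -> 2 < s)%N.
Proof.
case=> x [y1 [y2 [y3 [+ _]]]]; rewrite free_cons => /andP[_ fr].
split=> n => [codim|sq].
  by apply: (ann_codim_size (E := [:: x; y1; y2; y3]) codim); apply: ann_free_block.
exact: (square_dim_size (P := [:: (x, y1); (x, y2); (x, y3)]) sq).
Qed.

Lemma eps23_bounds : eps23_witness A ->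
  (forall r, ann_codim_le r A -> 2 < r)%N /\ (forall s, square_dim_le s A -> 2 < s)%N.
Proof.
case=> x [y [z fr]]; split=> n => [codim|sq]; last first.
  exact: (square_dim_size (P := [:: (y, z); (x, y); (x, z)]) sq).
move: fr; rewrite free_cons => /andP[_ fr].
by apply: (ann_codim_size (E := [:: x; y; z]) codim); apply: ann_free_block.
Qed.

Lemma eps24_bounds : eps24_witness A ->
  (forall r, ann_codim_le r A -> 3 < r)%N /\ (forall s, square_dim_le s A -> 1 < s)%N.
Proof.
case=> e1 [e2 [e3 [e4 [mu wit]]]]; split=> n => [codim|sq].
  apply: (ann_codim_size (E := [:: e3; e4; e2; e1]) codim).
  exact: (eps24_ann_free anti wit).
have [f0 mu12 [mu13 _ _ _]] := wit.
apply: (square_dim_size (P := [:: (e1, e3); (e1, e2)]) sq).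
apply: (free_ext1 (f := mu : {linear A -> K^o})) => [|v|] /=.
- by rewrite mu13 oner_eq0.
- by rewrite inE => /eqP ->.
by rewrite seq1_free.
Qed.

Lemma hyperbolic_bound (E : seq (A * A)) c r :
  c != 0 -> hyperbolic c E -> ann_codim_le r A -> ((size E).*2 <= r)%N.
Proof.
move=> c0 hE codim; have := ann_codim_size codim (hyperbolic_ann_free anti c0 hE).
suff -> : size (flatten [seq [:: p.1; p.2] | p <- E]) = (size E).*2 by [].
by elim: E {hE} => //= p E ->.
Qed.

Lemma model_eta1_witness : model tab_eta1 2 3 A -> exists x y : A, x ∘ y != 0.
Proof.
case=> X [sizeX X_free XM _].
case: X sizeX X_free XM => [|x [|y [|c [|]]]] // _ X_free XM; exists x, y.
have -> : x ∘ y = c by have := XM 0%N 1%N isT isT; tprod_simpl.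
by apply: (free_not0 X_free); rewrite !inE eqxx !orbT.
Qed.

Lemma model_eta2_witness : model tab_eta2 4 5 A ->
  exists e1 e2 e3 e4 c : A, c != 0 /\ hyperbolic c [:: (e1, e2); (e3, e4)].
Proof.
case=> X [sizeX X_free XM _].
case: X sizeX X_free XM => [|e1 [|e2 [|e3 [|e4 [|c [|]]]]]] // _ X_free XM.
exists e1, e2, e3, e4, c.
split; first by apply: (free_not0 X_free); rewrite !inE eqxx !orbT.
have e12 : e1 ∘ e2 = c by have := XM 0%N 1%N isT isT; tprod_simpl.
have e13 : e1 ∘ e3 = 0 by have := XM 0%N 2%N isT isT; tprod_simpl.
have e14 : e1 ∘ e4 = 0 by have := XM 0%N 3%N isT isT; tprod_simpl.
have e23 : e2 ∘ e3 = 0 by have := XM 1%N 2%N isT isT; tprod_simpl.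
have e24 : e2 ∘ e4 = 0 by have := XM 1%N 3%N isT isT; tprod_simpl.
have e34 : e3 ∘ e4 = c by have := XM 2%N 3%N isT isT; tprod_simpl.
by rewrite /hyperbolic /= e12 e13 e14 e23 e24 e34 !eqxx.
Qed.

Lemma model_T22_witness : model tab_T22 3 5 A ->
  exists x y z : A, free [:: x ∘ y; x ∘ z].
Proof.
case=> X [sizeX X_free XM _].
case: X sizeX X_free XM => [|x [|y [|z [|f [|g [|]]]]]] // _ X_free XM.
exists x, y, z.
have -> : x ∘ y = f by have := XM 0%N 1%N isT isT; tprod_simpl.
have -> : x ∘ z = g by have := XM 0%N 2%N isT isT; tprod_simpl.
exact: (catr_free (X := [:: x; y; z]) X_free).
Qed.

Lemma model_eta3_witness : model tab_eta3 6 7 A -> eta3_witness A.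
Proof.
case=> X [sizeX X_free XM _].
case: X sizeX X_free XM => [|e1 [|e2 [|e3 [|e4 [|e5 [|e6 [|c [|]]]]]]]] // _.
move=> X_free XM; exists [:: (e1, e2); (e3, e4); (e5, e6)], c; split=> //; last first.
  by apply: (free_not0 X_free); rewrite !inE eqxx !orbT.
have e12 : e1 ∘ e2 = c by have := XM 0%N 1%N isT isT; tprod_simpl.
have e13 : e1 ∘ e3 = 0 by have := XM 0%N 2%N isT isT; tprod_simpl.
have e14 : e1 ∘ e4 = 0 by have := XM 0%N 3%N isT isT; tprod_simpl.
have e15 : e1 ∘ e5 = 0 by have := XM 0%N 4%N isT isT; tprod_simpl.
have e16 : e1 ∘ e6 = 0 by have := XM 0%N 5%N isT isT; tprod_simpl.
have e23 : e2 ∘ e3 = 0 by have := XM 1%N 2%N isT isT; tprod_simpl.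
have e24 : e2 ∘ e4 = 0 by have := XM 1%N 3%N isT isT; tprod_simpl.
have e25 : e2 ∘ e5 = 0 by have := XM 1%N 4%N isT isT; tprod_simpl.
have e26 : e2 ∘ e6 = 0 by have := XM 1%N 5%N isT isT; tprod_simpl.
have e34 : e3 ∘ e4 = c by have := XM 2%N 3%N isT isT; tprod_simpl.
have e35 : e3 ∘ e5 = 0 by have := XM 2%N 4%N isT isT; tprod_simpl.
have e36 : e3 ∘ e6 = 0 by have := XM 2%N 5%N isT isT; tprod_simpl.
have e45 : e4 ∘ e5 = 0 by have := XM 3%N 4%N isT isT; tprod_simpl.
have e46 : e4 ∘ e6 = 0 by have := XM 3%N 5%N isT isT; tprod_simpl.
have e56 : e5 ∘ e6 = c by have := XM 4%N 5%N isT isT; tprod_simpl.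
by rewrite /hyperbolic /= e12 e13 e14 e15 e16 e23 e24 e25 e26 e34 e35 e36 e45 e46
  e56 !eqxx.
Qed.

Lemma model_eps23_witness : model tab_eps23 3 6 A -> eps23_witness A.
Proof.
case=> X [sizeX X_free XM _].
case: X sizeX X_free XM => [|x [|y [|z [|f [|g [|h [|]]]]]]] // _ X_free XM.
exists x, y, z.
have -> : x ∘ y = g by have := XM 0%N 1%N isT isT; tprod_simpl.
have -> : x ∘ z = h by have := XM 0%N 2%N isT isT; tprod_simpl.
have -> : y ∘ z = f by have := XM 1%N 2%N isT isT; tprod_simpl.
exact: (catr_free (X := [:: x; y; z]) X_free).
Qed.

Lemma model_eps24_witness : model tab_eps24 4 6 A -> eps24_witness A.
Proof.
case=> X [sizeX X_free XM _].
case: X sizeX X_free XM => [|e1 [|e2 [|e3 [|e4 [|f1 [|f2 [|]]]]]]] // _ X_free XM.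
have fr : free [:: f1; f2] by apply: (catr_free (X := [:: e1; e2; e3; e4]) X_free).
have [f10 _] := free2_neq0 fr.
have [mu [mu2 mu1]] := dual_functional (etrans (free2C _ _) fr).
exists e1, e2, e3, e4, mu.
have e12 : e1 ∘ e2 = f1 by have := XM 0%N 1%N isT isT; tprod_simpl.
have e13 : e1 ∘ e3 = f2 by have := XM 0%N 2%N isT isT; tprod_simpl.
have e14 : e1 ∘ e4 = 0 by have := XM 0%N 3%N isT isT; tprod_simpl.
have e23 : e2 ∘ e3 = 0 by have := XM 1%N 2%N isT isT; tprod_simpl.
have e24 : e2 ∘ e4 = f2 by have := XM 1%N 3%N isT isT; tprod_simpl.
by split; rewrite ?e12 // e13 e14 e23 e24 mu2 linear0.
Qed.

Lemma model_T3_witness : model tab_T3 3 4 A -> T3_witness A.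
Proof.
case=> X [sizeX X_free XM _].
case: X sizeX X_free XM => [|a [|b [|c [|d [|]]]]] // _ X_free XM; exists a, b.
have -> : a ∘ b = c by have := XM 0%N 1%N isT isT; tprod_simpl.
have -> : a ∘ c = d by have := XM 0%N 2%N isT isT; tprod_simpl.
by apply: (free_not0 X_free); rewrite !inE eqxx !orbT.
Qed.

Lemma model_T222_witness : model tab_T222 4 7 A -> T222_witness A.
Proof.
move=> M; have two := model_two_step anti (isT : table_wf tab_T222 4 7) isT M.
case: M => X [sizeX X_free XM _].
case: X sizeX X_free XM => [|x [|y1 [|y2 [|y3 [|f1 [|f2 [|f3 [|]]]]]]]] // _.
move=> X_free XM; apply: (two_step_T222 anti (x := x) (y1 := y1) (y2 := y2)
  (y3 := y3) two).
have -> : x ∘ y1 = f1 by have := XM 0%N 1%N isT isT; tprod_simpl.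
have -> : x ∘ y2 = f2 by have := XM 0%N 2%N isT isT; tprod_simpl.
have -> : x ∘ y3 = f3 by have := XM 0%N 3%N isT isT; tprod_simpl.
exact: (catr_free (X := [:: x; y1; y2; y3]) X_free).
Qed.

End Obstructions.

Section Levels.
Variable K : closedFieldType.
Implicit Types A B : algebra K.

(** The models of expected level [l]: [level_step] bounds their levels from above, the chain lemmas
    from below. *)
Definition level_class (l : nat) A : Prop :=
  match l with
  | 0 => model [::] 0 0 A
  | 1 => model tab_eta1 2 3 A
  | 2 => model tab_eta2 4 5 A \/ model tab_T22 3 5 A
  | 3 => model tab_eta3 6 7 A \/ model tab_eps23 3 6 A \/ model tab_eps24 4 6 A
         \/ model tab_T3 3 4 A \/ model tab_T222 4 7 A
  | _ => False
  end.

Definition level_le (l : nat) A : Prop :=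
  exists2 k : nat, (k <= l)%N & level_class k A.

Definition witnessed A : Prop :=
  [\/ T3_witness A, T222_witness A |
    two_step A /\ [\/ eps23_witness A, eps24_witness A | eta3_witness A]].

Lemma level_classification A : anticomm A -> engel A ->
  level_le 2 A \/ witnessed A.
Proof.
move=> anti eng; have [[zero|?|?|?]|?] := classification anti eng; last by right.
- by left; exists 0%N => //; apply: zero_model.
- by left; exists 1%N.
- by left; exists 2%N => //; left.
by left; exists 2%N => //; right.
Qed.

Lemma model_degenerates_two_step s r k A B :
  anticomm A -> model s r k A -> table_wf s r k -> all (fun t => r < t.2)%N s ->
  degenerates A B -> two_step B.
Proof.
move=> anti M s_wf s_r AB; apply: two_step_degenerates AB _.
exact: model_two_step M.
Qed.

Lemma model_degenerates_bounds s r k A B :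
  anticomm A -> model s r k A -> table_wf s r k -> degenerates A B ->
  ann_codim_le r B /\ square_dim_le (size (undup [seq t.2 | t <- s])) B.
Proof.
move=> anti M s_wf AB; split.
  by apply: ann_codim_degenerates AB _; apply: model_ann_codim M.
by apply: square_dim_degenerates AB _; apply: model_square_dim M.
Qed.

Lemma zero_closure A B : anticomm A -> degenerates A B ->
  model [::] 0 0 A -> model [::] 0 0 B.
Proof.
move=> anti AB M; have [codim _] := model_degenerates_bounds anti M isT AB.
apply: zero_model => a b; have [c c0] := codim (fun _ => a).
rewrite big_ord1; have c00 : c 0 0 != 0.
  by apply: contraNneq c0 => c0; apply/eqP/rowP => i; rewrite ord1 c0 mxE.
move=> /annP/(_ b); rewrite amulZl => /eqP; rewrite scaler_eq0 (negPf c00).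
by move/eqP.
Qed.

Section Closures.
Variables A B : algebra K.
Hypotheses (anti : anticomm A) (eng : engel A) (AB : degenerates A B).

Let antiB : anticomm B := anticomm_degenerates AB anti.
Let engB : engel B := engel_degenerates AB eng.

Ltac contradict_bounds codim sq := exfalso; first
  [ by match goal with H : eta3_witness _ |- _ =>
      let E := fresh in let c := fresh in let sz := fresh in
      let hE := fresh in let c0 := fresh in
      case: H => [E [c [sz hE c0]]];
      have := hyperbolic_bound antiB c0 hE codim; rewrite sz end
  | by match goal with H : model tab_eta2 4 5 _ |- _ =>
      have [e1 [e2 [e3 [e4 [c [c0 hE]]]]]] := model_eta2_witness H;
      have := hyperbolic_bound antiB c0 hE codim end
  | by match goal with H : model tab_T22 3 5 _ |- _ =>
      have [x [y [z fr]]] := model_T22_witness H;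
      have := (T22_bounds antiB fr).2 _ sq end
  | by match goal with H : model tab_T22 3 5 _ |- _ =>
      have [x [y [z fr]]] := model_T22_witness H;
      have := (T22_bounds antiB fr).1 _ codim end
  | by match goal with H : T222_witness _ |- _ =>
      have := (T222_bounds antiB H).1 _ codim end
  | by match goal with H : T222_witness _ |- _ =>
      have := (T222_bounds antiB H).2 _ sq end
  | by match goal with H : eps23_witness _ |- _ =>
      have := (eps23_bounds antiB H).1 _ codim end
  | by match goal with H : eps23_witness _ |- _ =>
      have := (eps23_bounds antiB H).2 _ sq end
  | by match goal with H : eps24_witness _ |- _ =>
      have := (eps24_bounds antiB H).1 _ codim end
  | by match goal with H : eps24_witness _ |- _ =>
      have := (eps24_bounds antiB H).2 _ sq end ].

Let level_cases : [\/ level_le 1 B, model tab_eta2 4 5 B, model tab_T22 3 5 B |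
  witnessed B].
Proof.
have [[[|[|[|//]]] // _ C]|W] := level_classification antiB engB.
- by constructor 1; exists 0%N.
- by constructor 1; exists 1%N.
- by case: C => C; [constructor 2 | constructor 3].
by constructor 4.
Qed.

Let two_step_cases : two_step B ->
  [\/ level_le 1 B, model tab_eta2 4 5 B, model tab_T22 3 5 B |
   [\/ T222_witness B, eps23_witness B, eps24_witness B | eta3_witness B]].
Proof.
move=> two; case: level_cases => [C|C|C|W].
- by constructor 1.
- by constructor 2.
- by constructor 3.
constructor 4; case: W => [/(two_step_not_T3 antiB two) //|C|[_ [C|C|C]]].
- by constructor 1.
- by constructor 2.
- by constructor 3.
by constructor 4.
Qed.

Lemma eta1_closure : model tab_eta1 2 3 A ->
  level_le 0 B \/ model tab_eta1 2 3 B.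
Proof.
move=> M; have two := model_degenerates_two_step anti M isT isT AB.
have [codim sq] := model_degenerates_bounds anti M isT AB.
case: (two_step_cases two) => [[[|[|//]] // _ C]|C|C|[C|C|C|C]];
  try contradict_bounds codim sq; last by right.
by left; exists 0%N.
Qed.

Lemma eta2_closure : model tab_eta2 4 5 A ->
  level_le 1 B \/ model tab_eta2 4 5 B.
Proof.
move=> M; have two := model_degenerates_two_step anti M isT isT AB.
have [codim sq] := model_degenerates_bounds anti M isT AB.
by case: (two_step_cases two) => [C|C|C|[C|C|C|C]];
  try contradict_bounds codim sq; [left | right].
Qed.

Lemma T22_closure : model tab_T22 3 5 A ->
  level_le 1 B \/ model tab_T22 3 5 B.
Proof.
move=> M; have two := model_degenerates_two_step anti M isT isT AB.
have [codim sq] := model_degenerates_bounds anti M isT AB.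
by case: (two_step_cases two) => [C|C|C|[C|C|C|C]];
  try contradict_bounds codim sq; [left | right].
Qed.

Let level_le1 : level_le 1 B -> level_le 2 B.
Proof. by case=> k k1 C; exists k => //; apply: leq_trans k1 _. Qed.

Let level_eta2 : model tab_eta2 4 5 B -> level_le 2 B.
Proof. by move=> C; exists 2%N => //; left. Qed.

Let level_T22 : model tab_T22 3 5 B -> level_le 2 B.
Proof. by move=> C; exists 2%N => //; right. Qed.

Lemma eta3_closure : model tab_eta3 6 7 A ->
  level_le 2 B \/ model tab_eta3 6 7 B.
Proof.
move=> M; have two := model_degenerates_two_step anti M isT isT AB.
have [codim sq] := model_degenerates_bounds anti M isT AB.
case: (two_step_cases two) => [C|C|C|[C|C|C|C]]; auto;
  try contradict_bounds codim sq.
by right; apply: eta3_model.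
Qed.

Lemma eps23_closure : model tab_eps23 3 6 A ->
  level_le 2 B \/ model tab_eps23 3 6 B.
Proof.
move=> M; have two := model_degenerates_two_step anti M isT isT AB.
have [codim sq] := model_degenerates_bounds anti M isT AB.
case: (two_step_cases two) => [C|C|C|[C|C|C|C]]; auto;
  try contradict_bounds codim sq.
by right; apply: eps23_model.
Qed.

(** The numerical bounds also admit e1 e2 = f1, e3 e4 = f2, which has a witness for eps_24 without
    being a model of it; its Pfaffian has two distinct roots, which the discriminant excludes. *)
Lemma eps24_closure : model tab_eps24 4 6 A ->
  level_le 2 B \/ model tab_eps24 4 6 B.
Proof.
move=> M; have two := model_degenerates_two_step anti M isT isT AB.
have [codim sq] := model_degenerates_bounds anti M isT AB.
case: (two_step_cases two) => [C|C|C|[C|C|C|C]]; auto;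
  try contradict_bounds codim sq.
right; apply: eps24_model => //.
by apply: pfaffian_disc_degenerates AB _; apply: eps24_disc.
Qed.

(** The bounds 4 and 3 leave witnesses for eps_23 and eps_24 open. The first contradicts
    [products_dependent]; in the second the Pfaffian of [mu] is -1. *)
Lemma T222_closure : model tab_T222 4 7 A ->
  level_le 2 B \/ model tab_T222 4 7 B.
Proof.
move=> M; have two := model_degenerates_two_step anti M isT isT AB.
have [codim sq] := model_degenerates_bounds anti M isT AB.
have pf : pfaffian_zero B.
  by apply: pfaffian_zero_degenerates AB _; apply: T222_pfaffian.
have dep : products_dependent B.
  by apply: products_dependent_degenerates AB _; apply: T222_products_dependent.
case: (two_step_cases two) => [C|C|C|[C|C|C|C]]; auto;
  try contradict_bounds codim sq.
- by right; apply: T222_model.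
- exfalso; case: C => x [y [z fr]]; have [c c0 cX] := dep x y z.
  by have := @dependent_nfree _ _ 3 [:: y ∘ z; x ∘ y; x ∘ z] c isT c0 cX; rewrite fr.
exfalso; case: C => e1 [e2 [e3 [e4 [mu [_ mu12 [mu13 mu24 mu14 _]]]]]].
have [_ /eqP] := pf mu mu e1 e2 e3 e4.
by rewrite /pfaffian mu12 mu13 mu24 mu14 !mul0r mulr1 addr0 sub0r oppr_eq0 oner_eq0.
Qed.

Lemma T3_closure : model tab_T3 3 4 A ->
  level_le 2 B \/ model tab_T3 3 4 B.
Proof.
move=> M; have [codim sq] := model_degenerates_bounds anti M isT AB.
case: level_cases => [C|C|C|[C|C|[two [C|C|C]]]]; auto;
  try contradict_bounds codim sq.
by right; apply: T3_model.
Qed.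

End Closures.

Lemma model_isomorphic_eq s r k A B : anticomm A -> anticomm B ->
  model s r k A -> table_wf s r k -> model s r k B -> dim A = dim B ->
  isomorphic A B.
Proof.
move=> antiA antiB MA s_wf MB dimAB.
apply: isomorphic_trans (model_table antiA s_wf MA) _.
by rewrite dimAB; apply: isomorphic_sym; apply: model_table MB.
Qed.

(** In a fixed dimension a model determines the isomorphism class, so a non-trivial degeneration
    cannot keep it. *)
Lemma level_step l A B : anticomm A -> engel A -> nontrivially_degenerates A B ->
  level_class l.+1 A -> level_le l B.
Proof.
move=> anti eng [AB nAB]; have antiB := anticomm_degenerates AB anti.
have same s r k : model s r k A -> table_wf s r k -> model s r k B -> False.
  move=> MA s_wf MB; apply: nAB.
  exact: (model_isomorphic_eq anti antiB MA s_wf MB (degenerates_dim AB)).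
case: l => [|[|[|//]]].
- move=> M; have [//|MB] := eta1_closure anti eng AB M.
  by case: (same _ _ _ M isT MB).
- case=> M.
    by have [//|/(same _ _ _ M isT)] := eta2_closure anti eng AB M.
  by have [//|/(same _ _ _ M isT)] := T22_closure anti eng AB M.
case=> [M|[M|[M|[M|M]]]].
- by have [//|/(same _ _ _ M isT)] := eta3_closure anti eng AB M.
- by have [//|/(same _ _ _ M isT)] := eps23_closure anti eng AB M.
- by have [//|/(same _ _ _ M isT)] := eps24_closure anti eng AB M.
- by have [//|/(same _ _ _ M isT)] := T3_closure anti eng AB M.
by have [//|/(same _ _ _ M isT)] := T222_closure anti eng AB M.
Qed.

Lemma chain_bound m l A : anticomm A -> engel A -> level_le l A ->
  degeneration_chain m A -> (m <= l)%N.
Proof.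
elim: m l A => // m IHm l A anti eng [k kl C] [B AB chainB].
have [AB' nAB] := AB.
have antiB := anticomm_degenerates AB' anti.
have engB := engel_degenerates AB' eng.
case: k C kl => [M _|k /(level_step anti eng AB) CB kl].
  case: nAB.
  apply: (model_isomorphic_eq anti antiB M isT _ (degenerates_dim AB')).
  exact: (zero_closure anti AB' M).
by apply: leq_trans kl; apply: (IHm _ _ antiB engB CB chainB).
Qed.

End Levels.

(** * Chains of degenerations: lower bounds for the level *)

Section Chains.
Variable K : closedFieldType.
Implicit Types A B : algebra K.

Lemma model_dim s r k A : model s r k A -> (k <= dim A)%N.
Proof.
by case=> X [<- X_free _ _]; rewrite -(eqnP X_free) -dimvf dimvS ?subvf.
Qed.

Lemma table_model_id s r k n :
  table_wf s r k -> (k <= n)%N -> model s r k (anticomm_table K n s).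
Proof.
move=> s_wf kn; have := @table_model K s r k n id s_wf _ _.
have -> : [seq (id t.1.1, id t.1.2, id t.2) | t <- s] = s.
  by rewrite -[RHS]map_id; apply: eq_map => -[[]].
apply=> [i /andP[i0 ik]|i j _ _ //].
by rewrite i0 (leq_trans ik).
Qed.

Lemma chain_extend s r k A m : anticomm A -> engel A ->
  degenerates A (anticomm_table K (dim A) s) -> table_wf s r k ->
  (k <= dim A)%N -> ~ model s r k A ->
  (forall B, anticomm B -> engel B -> dim B = dim A -> model s r k B ->
     degeneration_chain m B) ->
  degeneration_chain m.+1 A.
Proof.
move=> anti eng AB s_wf kA nA chainB.
have antiB : anticomm (anticomm_table K (dim A) s) := @anticomm_table_anticomm _ _ _.
have MB := table_model_id s_wf kA.
exists (anticomm_table K (dim A) s).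
  split=> // iso; apply: nA.
  exact: (model_isomorphic anti (isomorphic_sym iso) MB).
apply: chainB => //; first exact: engel_degenerates AB eng.
exact: esym (degenerates_dim AB).
Qed.

Lemma eta1_chain A : anticomm A -> engel A -> model tab_eta1 2 3 A ->
  degeneration_chain 1 A.
Proof.
move=> anti eng M.
apply: (chain_extend (s := [::]) (r := 0) (k := 0)) => //.
  exact: zero_degeneration.
move=> M0; have := model_square_dim anti (isT : table_wf [::] 0 0) erefl M0.
have [x [y xy]] := model_eta1_witness M.
by move/(square_dim_size (P := [:: (x, y)])) => /=; rewrite seq1_free xy => /(_ isT).
Qed.

Lemma level2_chain A : anticomm A -> engel A ->
  model tab_eta2 4 5 A \/ model tab_T22 3 5 A -> degeneration_chain 2 A.
Proof.
move=> anti eng M.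
have [two [x [y xy]]] : two_step A /\ exists x y : A, x ∘ y != 0.
  case: M => M.
    split; first exact: (model_two_step anti (isT : table_wf tab_eta2 4 5) isT M).
    have [e1 [e2 [e3 [e4 [c [c0 /andP[]]]]]]] := model_eta2_witness M.
    by move=> /andP[/eqP e12 _] _; exists e1, e2; rewrite e12.
  split; first exact: (model_two_step anti (isT : table_wf tab_T22 3 5) isT M).
  have [x [y [z /free2_neq0[xy _]]]] := model_T22_witness M.
  by exists x, y.
apply: (chain_extend (s := tab_eta1) (r := 2) (k := 3)) => //.
- exact: two_step_eta1 two xy.
- by case: M => /model_dim; apply: leq_trans.
- move=> /model_ann_codim codim; case: M => M.
    have [e1 [e2 [e3 [e4 [c [c0 hE]]]]]] := model_eta2_witness M.
    by have := hyperbolic_bound anti c0 hE codim.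
  have [x' [y' [z' fr]]] := model_T22_witness M.
  by have := (T22_bounds anti fr).1 _ codim.
by move=> B antiB engB _; apply: eta1_chain.
Qed.

(** All go through T^{2,2} except eta_3, whose square is a line and which goes through eta_2. The
    bound 5 is the number of basis vectors in the table of T^{2,2}; T^3 alone fits into dimension
    4. *)
Lemma level3_chain A : anticomm A -> engel A -> (5 <= dim A)%N ->
  level_class 3 A -> degeneration_chain 3 A.
Proof.
move=> anti eng dimA M.
have chain2 B : anticomm B -> engel B -> dim B = dim A ->
    model tab_eta2 4 5 B \/ model tab_T22 3 5 B -> degeneration_chain 2 B.
  by move=> antiB engB _; apply: level2_chain.
have to_T22 : degenerates A (anticomm_table K (dim A) tab_T22) ->
    ~ model tab_T22 3 5 A -> degeneration_chain 3 A.
  move=> AB nA; apply: (chain_extend anti eng AB (r := 3) (k := 5)) => // B aB eB dB MB.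
  by apply: chain2 => //; right.
have T22_two s r k : model s r k A -> table_wf s r k -> all (fun t => r < t.2)%N s ->
    (exists x y z : A, free [:: x ∘ y; x ∘ z]) ->
    degenerates A (anticomm_table K (dim A) tab_T22).
  move=> MA s_wf s_r [x [y [z fr]]].
  exact: two_step_T22 (model_two_step anti s_wf s_r MA) fr.
case: M => [M|[M|[M|[M|M]]]].
- have [E [c [sizeE hE c0]]] := model_eta3_witness M.
  have two := model_two_step anti (isT : table_wf tab_eta3 6 7) isT M.
  have hbound r := hyperbolic_bound anti c0 hE (r := r); rewrite sizeE in hbound.
  apply: (chain_extend anti eng (s := tab_eta2) (r := 4) (k := 5)) => //.
  + case: E sizeE hE {hbound} => [|[e1 e2] [|[e3 e4] E]] // _ hE.
    apply: (eta2_degeneration anti two (e1 := e1) (e2 := e2) (e3 := e3) (e4 := e4)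
      (c := c)) => //.
    move: hE; rewrite /hyperbolic /= => /andP[/and3P[-> -> _] /andP[/andP[-> _] _]].
    by [].
  + by move=> /model_ann_codim/hbound.
  by move=> B aB eB dB MB; apply: chain2 => //; left.
- have W := model_eps23_witness M; apply: to_T22.
    apply: (T22_two _ _ _ M isT isT); case: W => x [y [z]].
    by rewrite free_cons => /andP[_ fr]; exists x, y, z.
  by move=> /(model_square_dim anti (isT : table_wf tab_T22 3 5) erefl)/(eps23_bounds anti W).2.
- have W := model_eps24_witness M; apply: to_T22.
    apply: (T22_two _ _ _ M isT isT).
    case: W => e1 [e2 [e3 [e4 [mu [f0 mu12 [mu13 _ _ _]]]]]]; exists e1, e3, e2.
    apply: (free_ext1 (f := mu : {linear A -> K^o})) => [|v|] /=.
    + by rewrite mu13 oner_eq0.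
    + by rewrite inE => /eqP ->.
    by rewrite seq1_free.
  by move=> /model_ann_codim/(eps24_bounds anti W).1.
- apply: to_T22; first exact: T3_T22_degeneration.
  move=> /(model_two_step anti (isT : table_wf tab_T22 3 5) isT) two.
  exact: (two_step_not_T3 anti two (model_T3_witness M)).
have W := model_T222_witness anti M; apply: to_T22.
  apply: (T22_two _ _ _ M isT isT); case: W => x [y1 [y2 [y3 [+ _]]]].
  rewrite free_cons => /andP[_]; rewrite free_cons => /andP[_ fr].
  by exists x, y2, y3.
by move=> /model_ann_codim/(T222_bounds anti W).1.
Qed.

End Chains.

(** * Zero summands and stable isomorphism *)

Section StableIsomorphism.
Variable K : closedFieldType.
Implicit Types A B : algebra K.

Lemma zero_algebra_mul n (x y : zero_algebra K n) : x ∘ y = 0.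
Proof.
apply/colP => k; rewrite !mxE big1 // => i _; rewrite big1 // => j _.
by rewrite ffunE mulr0.
Qed.

Lemma dsum_mulE A B (x y : dsum A B) : x ∘ y = (x.1 ∘ y.1, x.2 ∘ y.2).
Proof. by []. Qed.

Lemma dsum_zero_anticomm A n : anticomm A -> anticomm (dsum A (zero_algebra K n)).
Proof. by move=> anti x; rewrite dsum_mulE anti zero_algebra_mul. Qed.

Lemma dsum_zero_engel A n : engel A -> engel (dsum A (zero_algebra K n)).
Proof.
case=> -[//|m] m0 nil; exists m.+1 => // a b.
have fst_iter k : (iter k (amul (dsum A (zero_algebra K n)) a) b).1 =
    iter k (amul A a.1) b.1 by elim: k => //= k ->.
by rewrite iterS dsum_mulE fst_iter zero_algebra_mul -iterS nil.
Qed.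

Lemma dsum_zero_model A n s r k : anticomm A ->
  model s r k A -> model s r k (dsum A (zero_algebra K n)).
Proof.
move=> anti.
pose f (x : A) : dsum A (zero_algebra K n) := (x, 0).
have f_lin : linear f.
  move=> c x y; rewrite [RHS]surjective_pairing /f; congr pair.
  by rewrite /= scaler0 addr0.
pose fl : {linear A -> dsum A (zero_algebra K n)} :=
  HB.pack f (GRing.isLinear.Build _ _ _ _ f f_lin).
apply: (@model_transfer _ A (dsum A (zero_algebra K n)) s r k fl).
- exact: dsum_zero_anticomm.
- by move=> x y [].
- by move=> a b; rewrite dsum_mulE /= zero_algebra_mul.
move=> [v z]; exists v; apply/annP => w.
by rewrite dsum_mulE /= zero_algebra_mul subrr amul0l.
Qed.

(** A stable isomorphism gives the model for one zero summand only, while the infinite level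
    concerns all large ones. *)
Lemma dsum_zero_model_widen A p m s r k : anticomm A ->
  model s r k (dsum A (zero_algebra K p)) ->
  model s r k (dsum A (zero_algebra K (p + m))).
Proof.
move=> anti.
pose f (x : dsum A (zero_algebra K p)) : dsum A (zero_algebra K (p + m)) :=
  (x.1, col_mx x.2 0).
have f_lin : linear f.
  move=> c x y; rewrite [RHS]surjective_pairing /f; congr pair.
  by rewrite /= scale_col_mx add_col_mx scaler0 addr0.
pose fl : {linear dsum A (zero_algebra K p) -> dsum A (zero_algebra K (p + m))} :=
  HB.pack f (GRing.isLinear.Build _ _ _ _ f f_lin).
apply: (@model_transfer _ _ (dsum A (zero_algebra K (p + m))) s r k fl).
- exact: dsum_zero_anticomm.
- by move=> [x1 x2] [y1 y2] [-> /eq_col_mx[->]].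
- by move=> a b; rewrite !dsum_mulE /= /f /= !zero_algebra_mul col_mx0.
move=> [v z]; exists (v, 0); apply/annP => w.
by rewrite dsum_mulE /= zero_algebra_mul subrr amul0l.
Qed.

Lemma dim_dsum_zero A n : dim (dsum A (zero_algebra K n)) = (dim A + n)%N.
Proof.
transitivity (dim A + dim 'cV[K]_n)%N; first by [].
by rewrite dim_matrix; congr (_ + _)%N; apply: muln1.
Qed.

Lemma anticomm_table_dim n s : dim (anticomm_table K n s) = n.
Proof. by transitivity (dim 'cV[K]_n); rewrite // dim_matrix; apply: muln1. Qed.

Lemma stable_model A s r k n s' :
  anticomm A -> model s r k (anticomm_table K n s') -> table_wf s r k ->
  stably_isomorphic A (anticomm_table K n s') ->
  exists p, forall m, model s r k (dsum A (zero_algebra K (p + m))).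
Proof.
move=> anti M s_wf [p [q iso]]; exists p => m.
apply: dsum_zero_model_widen => //.
apply: (model_isomorphic _ (isomorphic_sym iso)); first exact: dsum_zero_anticomm.
by apply: dsum_zero_model M; apply: anticomm_table_anticomm.
Qed.

Lemma model_stable A s r k m s' :
  anticomm A -> table_wf s r k ->
  model s r k (anticomm_table K (dim A + m) s') ->
  model s r k (dsum A (zero_algebra K m)) ->
  stably_isomorphic A (anticomm_table K (dim A + m) s').
Proof.
move=> anti s_wf MT MA; exists m, 0%N.
have antiT := @anticomm_table_anticomm K s' (dim A + m)%N.
apply: (model_isomorphic_eq _ _ MA s_wf (dsum_zero_model 0 antiT MT)).
- exact: dsum_zero_anticomm.
- exact: dsum_zero_anticomm.
by rewrite !dim_dsum_zero anticomm_table_dim addn0.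
Qed.

End StableIsomorphism.

Section TableModels.
Variable K : closedFieldType.

(* The indices beyond [q] are counted from the end, as in the names
   n - 2, n - 1, n of the last basis vectors. *)
Definition tail_index (q k n i : nat) : nat :=
  if (i <= q)%N then i else (n - k + i)%N.

Lemma table_model_tail s r k q n : table_wf s r k -> (q <= k <= n)%N ->
  model s r k (anticomm_table K n [seq (tail_index q k n t.1.1,
    tail_index q k n t.1.2, tail_index q k n t.2) | t <- s]).
Proof.
move=> s_wf /andP[qk kn].
apply: table_model s_wf _ _ => [i /andP[i0 ik]|i j].
  by rewrite /tail_index; case: ifP; lia.
by rewrite !inE /tail_index => ik jk; case: ifP; case: ifP; lia.
Qed.

Lemma eta3_table_model n : (7 <= n)%N -> model tab_eta3 6 7 (eta3 K n).
Proof. by move=> n7; exact: (@table_model_tail tab_eta3 6 7 7 n isT n7). Qed.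

Lemma eps23_table_model n : (6 <= n)%N -> model tab_eps23 3 6 (T22_eps23 K n).
Proof.
move=> n6; have := @table_model_tail tab_eps23 3 6 3 n isT n6.
congr (model _ _ _ (anticomm_table K n _)); rewrite /tail_index /=.
by do ![congr cons | congr pair]; lia.
Qed.

Lemma eps24_table_model n : (6 <= n)%N -> model tab_eps24 4 6 (T22_eps24 K n).
Proof.
move=> n6; have := @table_model_tail tab_eps24 4 6 4 n isT n6.
congr (model _ _ _ (anticomm_table K n _)); rewrite /tail_index /=.
by do ![congr cons | congr pair]; lia.
Qed.

Lemma T3_table_model n : (4 <= n)%N -> model tab_T3 3 4 (T3 K n).
Proof.
move=> n4; have := @table_model_tail tab_T3 3 4 3 n isT n4.
congr (model _ _ _ (anticomm_table K n _)); rewrite /tail_index /=.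
by do ![congr cons | congr pair]; lia.
Qed.

Lemma T222_table_model n : (7 <= n)%N -> model tab_T222 4 7 (T222 K n).
Proof.
move=> n7; have := @table_model_tail tab_T222 4 7 4 n isT n7.
congr (model _ _ _ (anticomm_table K n _)); rewrite /tail_index /=.
by do ![congr cons | congr pair]; lia.
Qed.

End TableModels.

Lemma witnessed_degeneration (K : closedFieldType) (A : algebra K) :
  anticomm A -> engel A -> (7 <= dim A)%N -> witnessed A ->
  exists B, degenerates A B /\ level_class 3 B.
Proof.
move=> anti eng dimA W.
have dim_le k : (k <= 7)%N -> (k <= dim A)%N by move/leq_trans; apply.
case: W => [[a [b n0]]|[x [y1 [y2 [y3 [fr [h1 h2 h3]]]]]]|[two [W|W|W]]].
- exists (anticomm_table K (dim A) tab_T3); split; first exact: T3_degeneration n0.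
  by do 3![right]; left; apply: table_model_id => //; apply: dim_le.
- exists (anticomm_table K (dim A) tab_T222).
  split; first exact: T222_degeneration fr h1 h2 h3.
  by do 4![right]; apply: table_model_id => //; apply: dim_le.
- case: W => x [y [z fr]]; exists (anticomm_table K (dim A) tab_eps23).
  split; first exact: (eps23_degeneration anti two fr).
  by right; left; apply: table_model_id => //; apply: dim_le.
- case: W => e1 [e2 [e3 [e4 [mu wit]]]]; exists (anticomm_table K (dim A) tab_eps24).
  split; first exact: (eps24_degeneration anti two wit).
  by do 2![right]; left; apply: table_model_id => //; apply: dim_le.
case: W => E [c [sizeE hE c0]].
case: E sizeE hE => [|[e1 e2] [|[e3 e4] [|[e5 e6] [|]]]] // _ hE.
exists (anticomm_table K (dim A) tab_eta3).
split; first exact: (eta3_degeneration anti two hE c0).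
by left; apply: table_model_id => //; apply: dim_le.
Qed.

(** An algebra of level 3 is too high for the models of level at most 2, so it degenerates to some
    [B] of class 3; were that degeneration non-trivial, it would prolong a chain from [B] to length
    4. The bound 7 makes room for the largest tables. *)
Lemma level3_classification (K : closedFieldType) (A : algebra K) :
  anticomm A -> engel A -> (7 <= dim A)%N -> has_level A 3 <-> level_class 3 A.
Proof.
move=> anti eng dimA; split=> [[chain3 max3]|C]; last first.
  split; first by apply: level3_chain => //; apply: leq_trans dimA.
  by move=> m; apply: chain_bound => //; exists 3%N.
have [low|W] := level_classification anti eng.
  by have := chain_bound anti eng low chain3.
have [B [AB CB]] := witnessed_degeneration anti eng dimA W.
have antiB := anticomm_degenerates AB anti.
have engB := engel_degenerates AB eng.
have [iso|niso] := classic (isomorphic A B).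
  have back s r k : model s r k B -> model s r k A.
    exact: model_isomorphic (isomorphic_sym iso).
  by move: CB => /=; move=> [/back|[/back|[/back|[/back|/back]]]]; auto 6.
have : degeneration_chain 4 A.
  exists B => //; apply: level3_chain => //.
  by rewrite -(degenerates_dim AB); apply: leq_trans dimA.
by move/max3.
Qed.

Theorem corollary9p2 (K : closedFieldType) (A : algebra K)
    (hanti : anticomm A) (hengel : engel A) :
  has_infinite_level A 3 <->
  (exists2 n : nat, (7 <= n)%N & stably_isomorphic A (eta3 K n)) \/
  (exists2 n : nat, (6 <= n)%N & stably_isomorphic A (T22_eps23 K n)) \/
  (exists2 n : nat, (6 <= n)%N & stably_isomorphic A (T22_eps24 K n)) \/
  (exists2 n : nat, (4 <= n)%N & stably_isomorphic A (T3 K n)) \/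
  (exists2 n : nat, (7 <= n)%N & stably_isomorphic A (T222 K n)).
Proof.
have level3 m : (7 <= m)%N -> has_level (dsum A (zero_algebra K m)) 3 <->
    level_class 3 (dsum A (zero_algebra K m)).
  move=> m7; apply: level3_classification.
  - exact: dsum_zero_anticomm.
  - exact: dsum_zero_engel.
  by rewrite dim_dsum_zero (leq_trans m7) ?leq_addl.
split=> [[N levelN]|stable].
  (* Large enough for the level to be 3, and for dim A + m to be an admissible n for each of the
     five names. *)
  pose m := (N + 7)%N; have m7 : (7 <= m)%N by apply: leq_addl.
  have nm k : (k <= 7)%N -> (k <= dim A + m)%N.
    by move=> k7; rewrite (leq_trans k7) // (leq_trans m7) ?leq_addl.
  have /(level3 m m7) C := levelN m (leq_addr _ _).
  have stab s r k s' : table_wf s r k ->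
      model s r k (anticomm_table K (dim A + m) s') ->
      model s r k (dsum A (zero_algebra K m)) ->
      stably_isomorphic A (anticomm_table K (dim A + m) s').
    exact: model_stable.
  case: C => [|[|[|[|]]]] C.
  - left; exists (dim A + m)%N; first exact: nm.
    exact: stab _ (eta3_table_model _ (nm 7 isT)) C.
  - right; left; exists (dim A + m)%N; first exact: nm.
    exact: stab _ (eps23_table_model _ (nm 6 isT)) C.
  - do 2![right]; left; exists (dim A + m)%N; first exact: nm.
    exact: stab _ (eps24_table_model _ (nm 6 isT)) C.
  - do 3![right]; left; exists (dim A + m)%N; first exact: nm.
    exact: stab _ (T3_table_model _ (nm 4 isT)) C.
  do 4![right]; exists (dim A + m)%N; first exact: nm.
  exact: stab _ (T222_table_model _ (nm 7 isT)) C.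
suff [p Cp] : exists p, forall m, level_class 3 (dsum A (zero_algebra K (p + m))).
  exists (p + 7)%N => m pm; apply/level3; first by lia.
  by rewrite -(subnKC (leq_trans (leq_addr 7 p) pm)).
case: stable => [[n n7 st]|[[n n6 st]|[[n n6 st]|[[n n4 st]|[n n7 st]]]]].
- have [p Cp] := stable_model hanti (@eta3_table_model K n n7) isT st.
  by exists p => m; left.
- have [p Cp] := stable_model hanti (@eps23_table_model K n n6) isT st.
  by exists p => m; right; left.
- have [p Cp] := stable_model hanti (@eps24_table_model K n n6) isT st.
  by exists p => m; do 2![right]; left.
- have [p Cp] := stable_model hanti (@T3_table_model K n n4) isT st.
  by exists p => m; do 3![right]; left.
have [p Cp] := stable_model hanti (@T222_table_model K n n7) isT st.
by exists p => m; do 4![right].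
Qed.
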